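(* Let $\mathcal{X}$ be a finite set, let $l,r\ge 1$ be integers, let $f:\mathcal{X}^r\to[0,\infty)$ be a function with support $\mathcal{S}=\{\bm{x}\in\mathcal{X}^r: f(\bm{x})>0\}$, and let $\mathbb{E}[Z]$ be the expected partition function of the random $(l,r)$-regular factor graph ensemble with $N$ variable nodes and factor function $f$. Let $$F=\max_{\nu,\mu}\left\{\frac{l}{r}\mathcal{H}(\mu)-(l-1)\mathcal{H}(\nu)+\frac{l}{r}\sum_{\bm{x}\in\mathcal{X}^r}\mu(\bm{x})\log f(\bm{x})\right\},$$ where the maximum is over pairs of probability measures $\nu$ on $\mathcal{X}$ and $\mu$ on $\mathcal{X}^r$ satisfying $$\frac1r\sum_{i=1}^r\ \sum_{\bm{x}\in\mathcal{X}^r:\,x_i=z}\mu(\bm{x})=\nu(z)\qquad\text{for all } z\in\mathcal{X}.$$ Assume that the maximizer is unique, denote it by $(\nu^*,\mu^* )$, and assume $\nu^*(x)>0$ for all $x\in\mathcal{X}$. Let $C,V',V$ be the $|\mathcal{X}|\times|\mathcal{X}|$ matrices $$C(x,x')=\begin{cases}\frac{r(l-1)}{l\,\nu^*(x)},& x=x'\\ 0,& x\neq x'\end{cases},\qquad V'(x,x')=\frac1{r^2}\sum_{k,k'=1}^r\ \sum_{\substack{\bm{x}\in\mathcal{X}^r\\ x_k=x,\ x_{k'}=x'}}\mu^*(\bm{x}),\qquad V(x,x')=\nu^*(x)\nu^*(x'),$$ and assume $$\det\left(I_{|\mathcal{X}|}-C(V'-V)\right)>0.$$ Then, as $N\to\infty$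 (through those $N$ for which $r$ divides $lN$ and $\mathbb{E}[Z]>0$), $$\mathbb{E}[Z]=\mathrm{e}^{NF}\,l^{\frac{|\mathcal{X}|-1}{2}}\,\frac1s\,\det\left(I_{|\mathcal{X}|}-C(V'-V)\right)^{-\frac12}(1+o(1)),$$ where $s$ is some integer depending on $l$, $r$ and the support $\mathcal{S}$ of $f$.
   Context: Random $(l,r)$-regular factor graph ensemble: there are $N$ variable nodes, each with $l$ edge sockets, and $lN/r$ factor nodes, each with $r$ ordered edge sockets (so $lN/r$ is an integer). The $Nl$ variable sockets are connected to the $Nl$ factor sockets by a bijection chosen uniformly at random among the $(Nl)!$ possible ones (multiple edges are allowed). For an assignment $\bm{x}\in\mathcal{X}^N$ of values to the variable nodes and a factor node $a$, $\bm{x}_{\partial a}\in\mathcal{X}^r$ is the ordered $r$-tuple of values of the variable nodes connected to the sockets $1,\dots,r$ of $a$. The partition function is $Z=\sum_{\bm{x}\in\mathcal{X}^N}\prod_a f(\bm{x}_{\partial a})$, the product running over all factor nodes, and $\mathbb{E}$ denotes expectation over the random connection. $\mathcal{H}$ denotes the entropy of a probability measure on a finite set, $\mathcal{H}(\nu)=-\sum_x\nu(x)\log\nu(x)$ with natural logarithm and $0\log 0=0$; in the expression for $F$, $\mu(\bm{x})\log f(\bm{x})$ is $0$ if $\mu(\bm{x})=0$ and $-\infty$ if $\mu(\bm{x})>0=f(\bm{x})$. $I_k$ is the $k\times k$ identity matrix. *)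

(* Defs.v *)
From HB Require Import structures.
From mathcomp Require Import all_boot all_order all_algebra.
From mathcomp Require Import all_classical all_reals all_analysis.
Set Implicit Arguments.
Unset Strict Implicit.
Unset Printing Implicit Defensive.
Import Order.TTheory GRing.Theory Num.Theory.
Import numFieldNormedType.Exports.
Local Open Scope ring_scope.

(* Libraries: MathComp and MathComp-Analysis.  The set X^r is rendered as
   {ffun 'I_r -> X}. *)

Section Ensemble.
Variables (R : realType) (X : finType) (l r : nat).
Variable f : {ffun 'I_r -> X} -> R.

(* Only meaningful when r divides l * N. *)
Definition nfactor (N : nat) : nat := (l * N) %/ r.

(* The socket (a, i) of factor node a is joined to the socket g (a, i) of
   variable node (g (a, i)).1. *)
Definition connection (N : nat) :=
  {ffun 'I_(nfactor N) * 'I_r -> 'I_N * 'I_l}.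

Definition connections (N : nat) : {set connection N} :=
  [set g : connection N | injectiveb g && [forall s, s \in codom g]].

Definition nbhd_values (N : nat) (g : connection N)
    (x : {ffun 'I_N -> X}) (a : 'I_(nfactor N)) : {ffun 'I_r -> X} :=
  [ffun i => x (g (a, i)).1].

Definition partition_fun (N : nat) (g : connection N) : R :=
  \sum_(x : {ffun 'I_N -> X}) \prod_(a < nfactor N) f (nbhd_values g x a).

Definition expected_Z (N : nat) : R :=
  (\sum_(g in connections N) partition_fun g) / #|connections N|%:R.

End Ensemble.

Section Variational.
Variable R : realType.

Definition is_dist (T : finType) (p : {ffun T -> R}) : Prop :=
  (forall x, 0 <= p x) /\ \sum_x p x = 1.

(* ln 0 = 0 in the library; in any case the term vanishes when p x = 0. *)
Definition entropy (T : finType) (p : {ffun T -> R}) : R :=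
  - \sum_x p x * ln (p x).

Variables (X : finType) (l r : nat).
Notation measure_pair := ({ffun X -> R} * {ffun {ffun 'I_r -> X} -> R})%type.

Definition feasible (p : measure_pair) : Prop :=
  [/\ is_dist p.1, is_dist p.2 &
      forall z, r%:R^-1 * \sum_(i < r)
        \sum_(x : {ffun 'I_r -> X} | x i == z) p.2 x = p.1 z].

(* lne 0 = -oo and 0 * -oo = 0, so a term of the sum is 0 when p.2 x = 0 and
   -oo when p.2 x > 0 = f x. *)
Definition objective (f : {ffun 'I_r -> X} -> R) (p : measure_pair) : \bar R :=
  ((l%:R / r%:R * entropy p.2 - (l%:R - 1) * entropy p.1)%:E +
   (l%:R / r%:R)%:E *
     \sum_(x : {ffun 'I_r -> X}) (p.2 x)%:E * lne (f x)%:E)%E.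

Definition maximizer (f : {ffun 'I_r -> X} -> R) (p : measure_pair) : Prop :=
  feasible p /\
  forall q, feasible q -> (objective f q <= objective f p)%E.

(* A maximum as soon as a maximizer exists.  It is then finite unless f = 0
   (consider point masses), in which case expected_Z is 0 for all large N. *)
Definition max_objective (f : {ffun 'I_r -> X} -> R) : \bar R :=
  ereal_sup [set objective f p | p in [set p | feasible p]]%classic.

Definition mx_of (g : X -> X -> R) : 'M[R]_#|X| :=
  \matrix_(i, j) g (enum_val i) (enum_val j).

Definition C_mx (nu : {ffun X -> R}) : 'M[R]_#|X| :=
  mx_of (fun x x' =>
    if x == x' then r%:R * (l%:R - 1) / (l%:R * nu x) else 0).

Definition V'_mx (mu : {ffun {ffun 'I_r -> X} -> R}) : 'M[R]_#|X| :=
  mx_of (fun x x' => (r%:R ^+ 2)^-1 *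
    \sum_(k < r) \sum_(k' < r)
      \sum_(y : {ffun 'I_r -> X} | (y k == x) && (y k' == x')) mu y).

Definition V_mx (nu : {ffun X -> R}) : 'M[R]_#|X| :=
  mx_of (fun x x' => nu x * nu x').

Definition det_factor (p : measure_pair) : R :=
  \det (1%:M - C_mx p.1 *m (V'_mx p.2 - V_mx p.1)).

End Variational.

(* Main.v *)
(** The first moment is a sum over types: if m(y) factor nodes carry the local
    configuration y, then, with M = l N / r factor nodes and A m the vector of
    numbers of sockets carrying each letter, the average over the connections
    contributes mult(m) f^m mult(A m / l) / mult(A m), where mult denotes
    multinomial coefficients and l must divide every entry of A m.
    By Stirling's formula in logarithmic form this is exp(N obj(m / M)) times a
    polynomial factor.  The maximizer mu charges exactly the support S of f;
    in the d = |S| - 1 coordinates obtained by eliminating one y0 in S, the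
    objective has at mu a Hessian whose determinant times the product of the
    mu(y) is the determinant of the statement, so the determinant hypothesis
    makes the maximum non-degenerate, and uniqueness plus compactness turn this
    into a global quadratic upper bound.  Types at distance more than
    log M / sqrt M from mu are therefore negligible, and the others form a
    Gaussian sum.
    The divisibility condition only depends on the d coordinates modulo l: it
    says that a homomorphism (Z/l)^d -> (Z/l)^X takes a prescribed value.  When
    it can be met at all, l^d / s residue classes meet it, where s is the size
    of the image, and on each class the sum is a Gaussian Riemann sum of mesh
    l / sqrt M.
    Stirling's formula is only proved with an unknown constant, which enters the
    limit as a d-th power.  It is identified by applying the asymptotics to
    X = bool, l = r = 1 and f = 1, where the partition function is exactly 2^N. *)
Require Import Defs.
From HB Require Import structures.
From mathcomp Require Import all_boot all_order all_algebra all_fingroup.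
From mathcomp Require Import all_classical all_reals all_analysis.
From mathcomp Require Import zify ring lra.
Set Implicit Arguments.
Unset Strict Implicit.
Unset Printing Implicit Defensive.
Import Order.TTheory GRing.Theory Num.Theory.
Import numFieldNormedType.Exports.
Local Open Scope classical_set_scope.
Local Open Scope ring_scope.

(** * Types and the first moment *)

(** Stirling's formula is needed in two strengths. Near [mu] all counts on the support are large,
    and the version with half-logarithms and constant applies. Elsewhere counts may be 0, and only
    an error of order ln k, valid for every k, is at hand; it suffices because the quadratic upper
    bound costs exp(-c (ln M)^2), which beats both polynomial factors and the number (M + 1)^d of
    types. The determinant of the statement arises as follows. The Hessian is [hess0] minus U^T C U;
    the inverse of [hess0] is a multinomial covariance matrix, which U carries to V' - V, and det(1
    - AB) = det(1 - BA) passes from size d to size |X|. Gaussian sums in dimension d need no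
    multiple integral: Schur complements peel off one coordinate at a time. The price is a
    one-dimensional estimate uniform in the shift of the lattice. In the Stirling constants, the
    terms for M and for the elements of S leave the exponent 1 - |S| = -d, and all the others
    cancel. Hence an example used to identify the constant must have d at least 1. *)

Definition typ (A T : finType) (w : {ffun A -> T}) : {ffun T -> nat} :=
  [ffun z => \sum_a (w a == z)]%N.

Lemma sum_typ (A T : finType) (w : {ffun A -> T}) : (\sum_z typ w z = #|A|)%N.
Proof.
under eq_bigr do rewrite ffunE.
rewrite exchange_big /= -sum1_card; apply: eq_bigr => a _.
by rewrite (bigD1 (w a)) //= eqxx big1 // => z /negPf; rewrite eq_sym => ->.
Qed.

Definition fcons (T : finType) (N : nat) (p : T * {ffun 'I_N -> T}) :
    {ffun 'I_N.+1 -> T} :=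
  [ffun i => if unlift ord0 i is Some j then p.2 j else p.1].

Lemma fcons_bij (T : finType) N : bijective (@fcons T N).
Proof.
exists (fun w : {ffun 'I_N.+1 -> T} => (w ord0, [ffun j => w (lift ord0 j)])).
  move=> [z w]; rewrite /fcons !ffunE unlift_none; congr (_, _).
  by apply/ffunP => j; rewrite !ffunE liftK.
move=> w; apply/ffunP => i; rewrite !ffunE /=.
by case: unliftP => [j ->|->]; rewrite ?ffunE.
Qed.

Lemma big_fcons (U : nmodType) (T : finType) N (F : {ffun 'I_N.+1 -> T} -> U) :
  \sum_w F w = \sum_z \sum_w F (fcons (z, w)).
Proof.
rewrite pair_bigA /= (reindex (@fcons T N)).
  by apply: eq_bigr => -[].
exact/onW_bij/fcons_bij.
Qed.

Lemma typ_fcons (T : finType) N z0 (w : {ffun 'I_N -> T}) z :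
  typ (fcons (z0, w)) z = ((z0 == z) + typ w z)%N.
Proof.
rewrite !ffunE big_ord_recl ffunE unlift_none; congr (_ + _)%N.
by apply: eq_bigr => j _; rewrite !ffunE liftK.
Qed.

(** Splitting words by their first letter gives the recursion of the multinomial coefficients; the
    product form avoids division in nat. *)
Lemma card_typ_ord (T : finType) N (n : {ffun T -> nat}) :
  (\sum_z n z = N)%N ->
  (#|[set w : {ffun 'I_N -> T} | typ w == n]%SET| * \prod_z (n z)`! = N`!)%N.
Proof.
elim: N n => [|N IH] n hn.
  have n0 z : n z = 0%N.
    by move/eqP: hn; rewrite sum_nat_eq0 => /forallP/(_ z)/eqP.
  rewrite big1 ?muln1 => [|z _]; last by rewrite n0.
  rewrite (_ : [set _ | _]%SET = [set: _]%SET) ?cardsT ?card_ffun ?card_ord //.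
  apply/setP => w; rewrite !inE; apply/eqP/ffunP => z.
  by rewrite ffunE big_ord0 n0.
rewrite -sum1_card.
(* Only letters with [n z] positive can come first; for the others the truncated subtraction would
   give a wrong type. *)
transitivity ((\sum_(z | (0 < n z)%N)
   #|[set w : {ffun 'I_N -> T} | typ w == [ffun y => n y - (z == y)]%N]%SET|)
   * \prod_z (n z)`!)%N.
  congr (_ * _)%N; rewrite big_mkcond big_fcons [RHS]big_mkcond.
  apply: eq_bigr => z _; rewrite -big_mkcond /=.
  case: ifPn => hz.
    rewrite sum1_card; apply: eq_card => w; rewrite -[LHS]/(fcons (z, w) \in [set v | typ v == n]%SET) !inE.
    apply/eqP/eqP => [/ffunP e|/ffunP e]; apply/ffunP => y; have := e y;
      rewrite typ_fcons !ffunE; case: eqP => [<-|_] /=; lia.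
  rewrite big1 // => w; rewrite !inE => /eqP/ffunP/(_ z).
  by rewrite typ_fcons eqxx /=; lia.
rewrite big_distrl /=.
transitivity (\sum_(z | (0 < n z)%N) n z * N`!)%N.
  apply: eq_bigr => z hz.
  rewrite -(IH [ffun y => n y - (z == y)]%N); last first.
    move: hn; rewrite (bigD1 z) //= [X in _ -> X = _](bigD1 z) //= ffunE eqxx.
    under [X in _ -> (_ + X)%N = _]eq_bigr => y hy do
      rewrite ffunE eq_sym (negPf hy) subn0.
    by lia.
  rewrite mulnCA; congr (_ * _)%N.
  rewrite (bigD1 z) //= [in RHS](bigD1 z) //= ffunE eqxx mulnA.
  congr (_ * _)%N; first by case: (n z) hz => // k _; rewrite factS subn1.
  by apply: eq_bigr => y hy; rewrite ffunE eq_sym (negPf hy) subn0.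
rewrite -big_distrl /= factS -hn; congr (_ * _)%N.
by rewrite big_mkcond; apply: eq_bigr => z _; case: (n z).
Qed.

Lemma card_typ (A T : finType) (n : {ffun T -> nat}) :
  (\sum_z n z = #|A|)%N ->
  (#|[set w : {ffun A -> T} | typ w == n]%SET| * \prod_z (n z)`! = (#|A|)`!)%N.
Proof.
move=> /card_typ_ord <-; congr (_ * _)%N.
pose h (w : {ffun A -> T}) : {ffun 'I_#|A| -> T} := [ffun i => w (enum_val i)].
have hi : injective h.
  move=> w w' /ffunP e; apply/ffunP => a; have := e (enum_rank a).
  by rewrite !ffunE enum_rankK.
have th w : typ (h w) = typ w.
  apply/ffunP => z; rewrite !ffunE [RHS](reindex (fun i : 'I_#|A| => enum_val i)) /=.
    by apply: eq_bigr => i _; rewrite ffunE.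
  by apply: onW_bij; exact: enum_val_bij.
rewrite -(card_imset _ hi); apply: eq_card => w; rewrite !inE.
apply/imsetP/eqP => [[v]|e]; first by rewrite inE => /eqP <- ->; rewrite th.
have hw : w = h [ffun a => w (enum_rank a)].
  by apply/ffunP => i; rewrite !ffunE enum_valK.
by exists [ffun a => w (enum_rank a)] => //; rewrite inE -th -hw e.
Qed.

Lemma typ_perm (A T : finType) (w w' : {ffun A -> T}) :
  typ w = typ w' -> exists p : {perm A}, w = [ffun a => w' (p a)].
Proof.
move=> e.
have cnt (v : {ffun A -> T}) z : count_mem z (fgraph v) = typ v z.
  rewrite -codom_ffun -sum1_count big_map big_enum_cond /= big_mkcond /= ffunE.
  by apply: eq_bigr => a _; rewrite eq_sym; case: eqP.
have : perm_eq (fgraph w) (fgraph w').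
  by apply/allP => z _ /=; rewrite !cnt e.
case/tuple_permP => s hs.
have qi : injective (fun a : A => enum_val (s (enum_rank a))).
  by move=> a b /enum_val_inj/perm_inj/enum_rank_inj.
exists (perm qi); apply/ffunP => a; rewrite ffunE permE.
rewrite -[RHS]tnth_fgraph -[in LHS](enum_rankK a) -tnth_fgraph.
rewrite (tnth_nth (w a)) hs -tnth_nth /=.
by rewrite tnth_mktuple.
Qed.

(** Same test as in [connections], over arbitrary finite types, so that sums over either match term
    by term. *)
Definition bijs (A B : finType) : {set {ffun A -> B}} :=
  [set g : {ffun A -> B} | injectiveb g && [forall s, s \in codom g]]%SET.

Lemma bijsP (A B : finType) (g : {ffun A -> B}) : g \in bijs A B -> bijective g.
Proof.
rewrite inE => /andP[/injectiveP gi /forallP gs].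
exists (fun b => iinv (gs b)) => [a|b]; last exact: f_iinv.
by apply: gi; rewrite f_iinv.
Qed.

Lemma bijs_bijective (A B : finType) (g : {ffun A -> B}) :
  bijective g -> g \in bijs A B.
Proof.
move=> gb; rewrite inE; apply/andP; split; first exact/injectiveP/bij_inj.
by case: gb => h _ hg; apply/forallP => b; rewrite -(hg b) codom_f.
Qed.

Lemma typ_comp (A B T : finType) (x : {ffun B -> T}) (g : {ffun A -> B}) :
  bijective g -> typ [ffun a => x (g a)] = typ x.
Proof.
move=> gb; apply/ffunP => z; rewrite !ffunE [RHS](reindex g) /=; last exact: onW_bij.
by apply: eq_bigr => a _; rewrite ffunE.
Qed.

(** Two words of the same type differ by a permutation of A, and composing with it injects the
    bijections producing one word into those producing the other. All words of the type of x are
    therefore produced equally often. *)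
Lemma avg_bijs (R : realType) (A B T : finType) (x : {ffun B -> T})
    (Phi : {ffun A -> T} -> R) : #|A| = #|B| ->
  (\sum_(g in bijs A B) Phi [ffun a => x (g a)]) / #|bijs A B|%:R =
  (\sum_(w | typ w == typ x) Phi w)
    / #|[set w : {ffun A -> T} | typ w == typ x]%SET|%:R.
Proof.
move=> eAB; pose h (g : {ffun A -> B}) := [ffun a => x (g a)].
pose c w := #|[set g in bijs A B | h g == w]%SET|.
have [g0 hg0] : exists g, g \in bijs A B.
  pose u a : B := enum_val (cast_ord eAB (enum_rank a)).
  pose v b : A := enum_val (cast_ord (esym eAB) (enum_rank b)).
  exists [ffun a => u a]; apply: bijs_bijective.
  exists v => t; rewrite ffunE /u /v enum_valK ?cast_ordK ?cast_ordKV enum_rankK //.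
have c_typ w w' : typ w = typ w' -> (c w' <= c w)%N.
  move=> /typ_perm[p ->]; pose k (g : {ffun A -> B}) := [ffun a => g (p a)].
  have ki : injective k.
    move=> g g' /ffunP e; apply/ffunP => a; have := e ((p^-1)%g a).
    by rewrite !ffunE permKV.
  rewrite /c -(card_imset _ ki); apply/subset_leq_card/fintype.subsetP => g'.
  case/imsetP => g; rewrite !inE => /andP[/andP[gi gs] /eqP <-] ->.
  have gb : bijective (k g).
    apply: (@eq_bij _ _ (g \o p)).
      by apply: bij_comp; [apply: bijsP; rewrite inE gi gs | exact: injF_bij (@perm_inj _ p)].
    by move=> a; rewrite /k ffunE.
  apply/andP; split; first by have := bijs_bijective gb; rewrite inE.
  by apply/eqP/ffunP => a; rewrite !ffunE.
have sumE (F : {ffun A -> T} -> R) : \sum_(g in bijs A B) F (h g) =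
    (\sum_(w | typ w == typ x) F w) * (c (h g0))%:R.
  rewrite (partition_big h (fun w => typ w == typ x)) /=; last first.
    by move=> g /bijsP/typ_comp ->.
  rewrite mulr_suml; apply: eq_bigr => w /eqP tw.
  rewrite (eq_bigr (fun=> F w)); last by move=> g /andP[_ /eqP ->].
  rewrite sumr_const -[LHS]mulr_natr; congr (_ * (1 *+ _)).
  transitivity (c w); first by apply: eq_card => g; rewrite [RHS]inE.
  have tg0 : typ (h g0) = typ x by apply/typ_comp/bijsP.
  by apply/eqP; rewrite eqn_leq !c_typ // tw tg0.
have cgt0 : (c (h g0))%:R != 0 :> R.
  by rewrite pnatr_eq0 -lt0n; apply/card_gt0P; exists g0; rewrite inE hg0 eqxx.
have cE (A' : finType) (P : pred A') : #|[set w | P w]%SET|%:R = \sum_(w | P w) 1 :> R.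
  by rewrite -sum1_card natr_sum; apply: eq_bigl => w; rewrite inE.
rewrite [X in _ / X](_ : _ = \sum_(g in bijs A B) 1); last first.
  by rewrite -sum1_card natr_sum.
rewrite cE (sumE Phi) (sumE (fun=> 1)).
by rewrite -mulf_div divff // mulr1.
Qed.

Definition mult (R : realType) (T : finType) (n : {ffun T -> nat}) : R :=
  (\sum_z n z)`!%:R / \prod_z (n z)`!%:R.

Lemma mult_card (R : realType) (A T : finType) (n : {ffun T -> nat}) :
  (\sum_z n z = #|A|)%N ->
  #|[set w : {ffun A -> T} | typ w == n]%SET|%:R = mult R n.
Proof.
move=> hn; rewrite /mult hn -(card_typ hn) natrM natr_prod mulfK //.
by apply/prodf_neq0 => z _; rewrite pnatr_eq0 -lt0n fact_gt0.
Qed.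

Section ExpectedZ.
Variables (R : realType) (X : finType) (l r : nat).
Hypotheses (hl : (0 < l)%N) (hr : (0 < r)%N).
Notation Xr := {ffun 'I_r -> X}.
Variable f : Xr -> R.

Definition socket_counts (m : Xr -> nat) : {ffun X -> nat} :=
  [ffun z => \sum_y m y * typ y z]%N.

Lemma sum_socket_counts (m : Xr -> nat) :
  (\sum_z socket_counts m z = (\sum_y m y) * r)%N.
Proof.
under eq_bigr do rewrite ffunE.
rewrite exchange_big big_distrl /=; apply: eq_bigr => y _.
by rewrite -big_distrr /= sum_typ card_ord.
Qed.

Definition weight (m : {ffun Xr -> nat}) : R :=
  mult R m * \prod_y f y ^+ m y
  * (mult R [ffun z => socket_counts m z %/ l]%N / mult R (socket_counts m)).

Lemma typ_fst N (x : {ffun 'I_N -> X}) :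
  typ [ffun b : 'I_N * 'I_l => x b.1] = [ffun z => l * typ x z]%N.
Proof.
apply/ffunP => z; rewrite !ffunE big_distrr /=.
under eq_bigr do rewrite ffunE.
rewrite -(pair_bigA _ (fun i j => nat_of_bool (x i == z))) /=.
by apply: eq_bigr => i _; rewrite sum_nat_const card_ord.
Qed.

Definition uncurry_ff M (W : {ffun 'I_M -> Xr}) : {ffun 'I_M * 'I_r -> X} :=
  [ffun s => W s.1 s.2].

Lemma uncurry_ff_bij M : bijective (@uncurry_ff M).
Proof.
exists (fun w : {ffun 'I_M * 'I_r -> X} => [ffun a => [ffun i => w (a, i)]]).
  by move=> W; apply/ffunP => a; rewrite ffunE; apply/ffunP => i; rewrite !ffunE.
by move=> w; apply/ffunP => -[a i]; rewrite !ffunE.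
Qed.

Lemma typ_uncurry M (W : {ffun 'I_M -> Xr}) :
  typ (uncurry_ff W) = socket_counts (typ W).
Proof.
apply/ffunP => z; rewrite !ffunE.
under eq_bigr do rewrite ffunE.
rewrite -(pair_bigA _ (fun i j => nat_of_bool (W i j == z))) /=.
under [RHS]eq_bigr do rewrite ffunE big_distrl /=.
rewrite [RHS]exchange_big /=; apply: eq_bigr => a _.
rewrite (bigD1 (W a)) //= eqxx mul1n ffunE [X in (_ + X)%N]big1 ?addn0 // => y /negPf.
by rewrite eq_sym => ->.
Qed.

(** For a fixed assignment, the factor sockets read a uniform word among those with the right letter
    counts. Exchanging the two sums and grouping the words by the type of their blocks gives
    [weight]. *)
Lemma expected_Z_types N : (r %| l * N)%N ->
  expected_Z l f N =
  \sum_(m : {ffun Xr -> 'I_(nfactor l r N).+1}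
        | (\sum_y m y == nfactor l r N)%N
          && [forall z, l %| socket_counts (fun y => val (m y)) z]%N)
    weight [ffun y => val (m y)].
Proof.
move=> hN; set M := nfactor l r N.
have MN : (M * r = l * N)%N by rewrite /M /nfactor divnK.
rewrite /expected_Z /partition_fun exchange_big mulr_suml /=.
pose sockets (x : {ffun 'I_N -> X}) := [ffun b : 'I_N * 'I_l => x b.1].
pose Phi (w : {ffun 'I_M * 'I_r -> X}) :=
  \prod_(a < M) f [ffun i => w (a, i)].
(* The number of assignments compatible with m over the number of words with the same letter counts;
   it is 0 unless l divides all these counts. *)
pose G (m : {ffun Xr -> nat}) : R :=
  #|[set x : {ffun 'I_N -> X} | [ffun z => l * typ x z]%N == socket_counts m]%SET|%:R
    / mult R (socket_counts m).
transitivity (\sum_(W : {ffun 'I_M -> Xr}) \prod_a f (W a) * G (typ W)).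
  transitivity (\sum_x \sum_(w : {ffun 'I_M * 'I_r -> X} | typ w == typ (sockets x))
      Phi w / mult R (typ w)).
    apply: eq_bigr => x _.
    transitivity ((\sum_(g in bijs ('I_M * 'I_r)%type ('I_N * 'I_l)%type)
        Phi [ffun a => sockets x (g a)])
        / #|bijs ('I_M * 'I_r)%type ('I_N * 'I_l)%type|%:R).
      congr (_ / _); apply: eq_big => // g _; rewrite /Phi; apply: eq_bigr => a _; congr f.
      by apply/ffunP => i; rewrite !ffunE.
    rewrite avg_bijs; last by rewrite !card_prod !card_ord MN mulnC.
    rewrite mult_card; last first.
      by rewrite sum_typ !card_prod !card_ord MN mulnC.
    by rewrite mulr_suml; apply: eq_bigr => w /eqP ->.
  under eq_bigr do rewrite big_mkcond.
  rewrite exchange_big /= (reindex (@uncurry_ff M)) /=; last first.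
    exact/onW_bij/uncurry_ff_bij.
  apply: eq_bigr => W _; rewrite -big_mkcond sumr_const /= typ_uncurry.
  rewrite /G mulrA -mulrnAl -[X in X / _ = _]mulr_natr; congr (_ * (1 *+ _) / _).
    apply: eq_bigr => a _; congr f; apply/ffunP => i; rewrite !ffunE.
    by [].
  apply: eq_card => x; transitivity (socket_counts (typ W) == typ (sockets x)) => //.
  by rewrite inE /sockets typ_fst eq_sym.
pose k (W : {ffun 'I_M -> Xr}) : {ffun Xr -> 'I_M.+1} :=
  [ffun y => inord (typ W y)].
have kE W y : val (k W y) = typ W y.
  rewrite ffunE /= inordK // ltnS -[X in (_ <= X)%N](card_ord M) -(sum_typ W).
  by rewrite (bigD1 y) //= leq_addr.
have kE' W : [ffun y => val (k W y)] = typ W by apply/ffunP => y; rewrite ffunE kE.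
rewrite (partition_big k (fun m => \sum_y m y == M)%N) /=; last first.
  move=> W _; under eq_bigr do rewrite kE.
  by rewrite sum_typ card_ord.
rewrite [RHS]big_mkcondr /=; apply: eq_bigr => m /eqP hm.
transitivity (\sum_(W | k W == m)
   \prod_y f y ^+ m y * G [ffun y => val (m y)]).
  apply: eq_bigr => W /eqP <-; rewrite kE'; congr (_ * _).
  rewrite (partition_big W xpredT) //=; apply: eq_bigr => y _.
  rewrite (eq_bigr (fun=> f y)); last by move=> a /eqP ->.
  rewrite prodr_const kE ffunE -sum1_card big_mkcond /=; congr (_ ^+ _).
rewrite sumr_const.
have -> : #|[pred W | k W == m]| = #|[set W : {ffun 'I_M -> Xr} | typ W == [ffun y => val (m y)]]%SET|.
  apply: eq_card => W; rewrite !inE; apply/eqP/eqP => [<-|e]; first by rewrite kE'.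
  by apply/ffunP => y; apply: val_inj; rewrite kE e ffunE.
rewrite -[LHS]mulr_natr mult_card; last first.
  rewrite card_ord -[RHS]hm; apply: eq_bigr => y _; rewrite ffunE.
  by [].
have -> : socket_counts (fun y => val (m y)) = socket_counts [ffun y => val (m y)].
  by apply/ffunP => z; rewrite !ffunE; apply: eq_bigr => y _; rewrite ffunE.
set A := socket_counts _.
have sA : (\sum_z A z = l * N)%N.
  rewrite sum_socket_counts -MN -[X in (_ = X * _)%N]hm; congr (_ * _)%N.
  by apply: eq_bigr => y _; rewrite ffunE.
case: ifPn => hdiv.
  rewrite /weight -/A /G -/A.
  have -> : [set x : {ffun 'I_N -> X} | [ffun z => l * typ x z]%N == A]%SET =
            [set x | typ x == [ffun z => A z %/ l]%N]%SET.
    apply/setP => x; rewrite !inE.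
    apply/eqP/eqP => /ffunP e; apply/ffunP => z; move: (e z).
      by rewrite [X in X = _ -> _]ffunE => e'; rewrite [RHS]ffunE -e' mulKn.
    rewrite [X in _ = X -> _]ffunE => e'; rewrite [LHS]ffunE e' mulnC divnK //.
    exact: (forallP hdiv).
  rewrite mult_card; last first.
    rewrite card_ord; apply/eqP; rewrite -(eqn_pmul2l hl) -sA big_distrr /=.
    apply/eqP/eq_bigr => z _; rewrite ffunE mulnC divnK //; exact: (forallP hdiv).
  have -> : \prod_y f y ^+ [ffun y => val (m y)] y = \prod_y f y ^+ m y.
    by apply: eq_bigr => y _; rewrite ffunE.
  by ring.
rewrite /G -/A [X in X%:R / _](_ : _ = 0%N) ?mul0r ?mulr0 ?mul0r //.
apply/eqP; rewrite cards_eq0; apply/eqP/setP => x; rewrite !inE.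
apply/negP => /eqP/ffunP e; case/negP: hdiv; apply/forallP => z.
by rewrite -e ffunE dvdn_mulr.
Qed.

End ExpectedZ.

(** * Gaussian lattice sums *)

Section Gauss1.
Variable R : realType.
Notation g := (@gauss_fun R).
Let mu := @lebesgue_measure R.
Notation I0 := (@gauss_integral_proof.integral0_gauss R).

Lemma gauss_fun_integrable (a b : itv_bound R) :
  mu.-integrable [set` Interval a b] (EFin \o g).
Proof.
apply: integrableS (@integrableT_gauss R) => //.
Qed.

Lemma gauss_fun_decr (x y : R) : 0 <= x -> x <= y -> g y <= g x.
Proof.
move=> x0 xy; rewrite /gauss_fun ler_expR lerN2 lerXn2r ?nnegrE //.
exact: le_trans xy.
Qed.

Lemma integral0_gauss_bounds (x y : R) : 0 <= x -> x <= y ->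
  g y * (y - x) <= I0 y - I0 x <= g x * (y - x).
Proof.
move=> x0 xy.
have -> : I0 y - I0 x = \int[mu]_(t in `]x, y]) g t.
  by rewrite /gauss_integral_proof.integral0_gauss (@Rintegral_itvB R g (BLeft 0) (BRight y) x) ?bnd_simp //;
    exact: gauss_fun_integrable.
have muE : mu `]x, y]%classic = (y - x)%:E.
  rewrite /mu lebesgue_measure_itv /= lte_fin.
  by case: ltP => //= yx; have -> : x = y; [apply/le_anti; rewrite xy | rewrite subrr].
have cst_int c : \int[mu]_(t in `]x, y]) c = c * (y - x).
  by rewrite Rintegral_cst //; congr (_ * _); exact: (congr1 fine muE).
have cst_i c : mu.-integrable `]x, y]%classic (EFin \o (fun=> c : R)).
  apply: (@integrableS _ _ _ mu `[x, y]%classic) => //.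
    by apply: subset_itvr; rewrite bnd_simp.
  apply: continuous_compact_integrable => //; first exact: segment_compact.
  by apply: continuous_subspaceT => t; exact: cvg_cst.
have gi := @gauss_fun_integrable (BRight x) (BRight y).
apply/andP; split; rewrite -cst_int -subr_ge0 -RintegralB //; apply: Rintegral_ge0 => t /=;
  rewrite in_itv /= subr_ge0 => /andP[xt ty]; apply: gauss_fun_decr => //.
- by apply: le_trans (ltW xt).
- exact: ltW.
Qed.

(** Odd extension of the integral from 0, a primitive of the Gaussian on the whole line. *)
Definition gauss_prim (x : R) := if 0 <= x then I0 x else - I0 (- x).

Lemma I00 : I0 0 = 0.
Proof.
rewrite /gauss_integral_proof.integral0_gauss /Rintegral.
by rewrite set_itv1 integral_set1.
Qed.

(* The variation of the Gaussian on ]-oo, x], which controls the error of its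
   Riemann sums. *)
Definition gauss_var (x : R) := if x <= 0 then g x else 2 - g x.

Lemma gauss_fun0 : g 0 = 1.
Proof. by rewrite /gauss_fun expr0n oppr0 expR0. Qed.

Lemma gauss_funN x : g (- x) = g x.
Proof. by rewrite /gauss_fun sqrrN. Qed.

Lemma gauss_var_bounds x : 0 <= gauss_var x <= 2.
Proof.
have := gauss_fun_ge0 x; have := gauss_fun_le1 x.
by rewrite /gauss_var; case: ifP => _; lra.
Qed.

(** On one cell the rectangle rule errs by at most oscillation times width; expressing the
    oscillation as an increment of [gauss_var] makes the errors telescope. *)
Lemma gauss_prim_osc (x y : R) : x <= y ->
  `|gauss_prim y - gauss_prim x - g x * (y - x)|
    <= (gauss_var y - gauss_var x) * (y - x).
Proof.
move=> xy; rewrite ler_norml /gauss_prim /gauss_var.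
have gx1 := gauss_fun_le1 x; have gy1 := gauss_fun_le1 y.
have gx0 := gauss_fun_ge0 x; have gy0 := gauss_fun_ge0 y.
have [x0|x0] := leP 0 x.
  rewrite (le_trans x0 xy); have := integral0_gauss_bounds x0 xy.
  have [x0'|x0'] := leP x 0; last first.
    have [y0|y0] := leP y 0; first by lra.
    by nra.
  have -> : x = 0 by lra.
  rewrite gauss_fun0; have [y0|y0] := leP y 0; last by nra.
  have -> : y = 0 by lra.
  by rewrite gauss_fun0; lra.
rewrite (ltW x0); have [y0|y0] := leP 0 y.
  have A := integral0_gauss_bounds (lexx 0) y0.
  have x0N : 0 <= - x by lra.
  have B := integral0_gauss_bounds (lexx 0) x0N.
  rewrite I00 gauss_fun0 ?gauss_funN in A B.
  have [y0'|y0'] := leP y 0.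
    have yE : y = 0 by lra.
    rewrite yE I00 gauss_fun0 in A gy1 gy0 *; nra.
  nra.
rewrite (ltW y0).
have a1 : 0 <= - y by lra.
have a2 : - y <= - x by lra.
have := integral0_gauss_bounds a1 a2; rewrite !gauss_funN; nra.
Qed.

(** The bound does not depend on the starting point or the number of cells, since the total
    variation of the Gaussian is 2. *)
Lemma gauss_riemann (s x : R) n : 0 <= s ->
  `|\sum_(j < n) s * g (x + j%:R * s) - (gauss_prim (x + n%:R * s) - gauss_prim x)|
    <= 2 * s.
Proof.
move=> s0.
suff : `|\sum_(j < n) s * g (x + j%:R * s) - (gauss_prim (x + n%:R * s) - gauss_prim x)|
    <= (gauss_var (x + n%:R * s) - gauss_var x) * s.
  move/le_trans; apply; apply: ler_wpM2r => //.
  have := gauss_var_bounds x; have := gauss_var_bounds (x + n%:R * s); lra.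
elim: n => [|n IH]; first by rewrite big_ord0 mul0r addr0 !subrr normr0 mul0r.
have hs : x + n%:R * s <= x + n.+1%:R * s by rewrite -natr1; lra.
have := gauss_prim_osc hs; rewrite big_ord_recr /=.
have -> : x + n.+1%:R * s - (x + n%:R * s) = s by rewrite -natr1; ring.
move: IH; rewrite !ler_norml; set S := \sum_(i < n) _; lra.
Qed.

Lemma gauss_prim_cvg : I0 x @[x --> +oo] --> (Num.sqrt pi / 2 : R).
Proof.
have : Num.sqrt (I0 x ^+ 2) @[x --> +oo] --> Num.sqrt (pi / 4 : R).
  apply: continuous_cvg => //;
    [exact: sqrt_continuous|exact: gauss_integral_proof.cvg_integral0_gauss_sqr].
rewrite sqrtrM ?pi_ge0// sqrtrV// (_ : 4 = 2 ^+ 2); last first.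
  by rewrite expr2 -natrM.
rewrite sqrtr_sqr ger0_norm//.
rewrite (_ : (fun _ => Num.sqrt _) = I0)//.
apply/funext => r; rewrite sqrtr_sqr// ger0_norm//.
exact: gauss_integral_proof.integral0_gauss_ge0.
Qed.

Lemma gauss_prim_tail (e : R) : 0 < e -> exists W, 0 < W /\
  forall x, W <= x -> Num.sqrt pi / 2 - e <= gauss_prim x /\
    gauss_prim (- x) <= - (Num.sqrt pi / 2 - e).
Proof.
move=> e0; have /cvgrPdist_le/(_ e e0)[W [_ hW]] := gauss_prim_cvg.
exists (`|W| + 1); split; first by have := normr_ge0 W; lra.
move=> x Wx; have Wltx : W < x by have := ler_norm W; lra.
have x0 : 0 < x by have := normr_ge0 W; lra.
have := hW x Wltx; rewrite ler_norml => /andP[_ h].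
have xN : (0 <= - x) = false by apply/negbTE; rewrite -ltNge; lra.
rewrite /gauss_prim (ltW x0) xN opprK; lra.
Qed.

Lemma gauss_prim_le x : - (Num.sqrt pi / 2) <= gauss_prim x <= Num.sqrt pi / 2.
Proof.
have H y : 0 <= y -> 0 <= I0 y <= Num.sqrt pi / 2.
  move=> y0; rewrite gauss_integral_proof.integral0_gauss_ge0 /=.
  rewrite leNgt; apply/negP => h.
  pose e := (I0 y - Num.sqrt pi / 2) / 2.
  have e0 : 0 < e by rewrite /e; lra.
  have /cvgrPdist_le/(_ e e0)[W [_ hW]] := gauss_prim_cvg.
  pose z := Num.max y (`|W| + 1).
  have Wz : W < z by rewrite /z lt_max; apply/orP; right; have := ler_norm W; lra.
  have yz : y <= z by rewrite /z le_max lexx.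
  have := hW z Wz; have := integral0_gauss_bounds y0 yz.
  have : 0 <= g z * (z - y) by rewrite mulr_ge0 ?gauss_fun_ge0 // subr_ge0.
  rewrite ler_norml /e; lra.
rewrite /gauss_prim; have [x0|x0] := leP 0 x; first by have := H x x0; lra.
have x0N : 0 <= - x by lra.
by have := H _ x0N; lra.
Qed.

(** The upper bound holds for every shift and every T because a finite sum is below the full
    integral up to the mesh. The lower bound must see most of the mass, hence the condition relating
    the shift to T. [gsum_cvg] depends on this asymmetry. *)
Lemma gauss_sum1 (q e : R) : 0 < q -> 0 < e -> exists W M0 : R,
  [/\ 0 <= W, 1 <= M0 & forall (M a : R) (T : nat), M0 <= M ->
  let S := (Num.sqrt M)^-1 *
    \sum_(j < (2 * T).+1) expR (- (q * (j%:R - T%:R + a) ^+ 2) / M) in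
  S <= Num.sqrt pi / Num.sqrt q + e /\
  (`|a| + W * Num.sqrt M <= T%:R -> Num.sqrt pi / Num.sqrt q - e <= S)].
Proof.
move=> q0 e0; pose k := Num.sqrt q.
have k0 : 0 < k by rewrite sqrtr_gt0.
pose e1 := e * k / 4; have e10 : 0 < e1 by rewrite /e1 divr_gt0 ?mulr_gt0.
have [W [W0 hW]] := gauss_prim_tail e10.
(* With sqrt M at least m, the Riemann error 2 / sqrt M is at most e / 2; the two tails, 2 [e1] / k,
   take the other half. *)
pose m := 1 + 4 / e; have m0 : 0 < m by rewrite /m addr_gt0 // divr_gt0.
exists (W / k), (m ^+ 2); split.
- by rewrite divr_ge0 // ltW.
- by rewrite -[1](expr1n _ 2) lerXn2r ?nnegrE // ?ltW // /m ltrDl divr_gt0.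
move=> M a T hM S.
have M0 : 0 < M by apply: lt_le_trans hM; rewrite exprn_gt0.
have mM : m <= Num.sqrt M by have := ler_wsqrtr hM; rewrite sqrtr_sqr gtr0_norm.
set t := Num.sqrt M in S mM *.
have t0 : 0 < t by rewrite sqrtr_gt0.
pose s := k / t; have s0 : 0 < s by rewrite divr_gt0.
have SE : S = k^-1 * \sum_(j < (2 * T).+1) s * g ((a - T%:R) * s + j%:R * s).
  rewrite /S -!mulr_sumr mulrA /s mulKf ?gt_eqF //; congr (_ * _).
  apply: eq_bigr => j _; rewrite /gauss_fun; congr expR.
  have -> : (a - T%:R) * (k / t) + j%:R * (k / t) = (j%:R - T%:R + a) * (k / t) by ring.
  rewrite exprMn expr_div_n -[M in LHS]sqr_sqrtr ?ltW // -[q in LHS]sqr_sqrtr ?ltW //.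
  by rewrite -/k -/t; field; rewrite gt_eqF.
have := gauss_riemann ((a - T%:R) * s) (2 * T).+1 (ltW s0).
set Sg := \sum_(j < _) _ in SE *; rewrite ler_norml => /andP[hl hu].
have ks : k^-1 * (2 * s) <= e / 2.
  rewrite /s mulrCA mulKf ?gt_eqF // ler_pdivrMr //.
  have : e / 2 * m <= e / 2 * t by rewrite ler_wpM2l // divr_ge0 // ltW.
  apply: le_trans; rewrite /m; have -> : e / 2 * (1 + 4 / e) = e / 2 + 2 by field; rewrite gt_eqF.
  lra.
have Ek : Num.sqrt pi / k = k^-1 * Num.sqrt pi by rewrite mulrC.
split.
  rewrite SE Ek; apply: (@le_trans _ _ (k^-1 * (Num.sqrt pi + 2 * s))).
    rewrite ler_pM2l ?invr_gt0 //.
    have := gauss_prim_le ((a - T%:R) * s).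
    have := gauss_prim_le ((a - T%:R) * s + (2 * T).+1%:R * s); lra.
  by rewrite mulrDr; lra.
move=> hT; rewrite SE Ek.
apply: (@le_trans _ _ (k^-1 * (Num.sqrt pi - 2 * e1 - 2 * s))); last first.
  rewrite ler_pM2l ?invr_gt0 //.
  have Wst : W = W / k * t * s by rewrite /s; field; rewrite !gt_eqF.
  have h1 : W <= (T%:R - a) * s.
    rewrite {1}Wst ler_wpM2r ?(ltW s0) //; have := ler_norm a; lra.
  have h2 : W <= (a - T%:R) * s + (2 * T).+1%:R * s.
    rewrite -mulrDl {1}Wst ler_wpM2r ?(ltW s0) //.
    have := ler_norm (- a); rewrite normrN -natr1 natrM; lra.
  have [_ A] := hW _ h1; have [B _] := hW _ h2.
  rewrite -mulNr opprB in A.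
  by have Tn : (0:R) <= T%:R by []; lra.
rewrite !mulrBr; have -> : k^-1 * (2 * e1) = e / 2 by rewrite /e1; field; rewrite gt_eqF.
lra.
Qed.

End Gauss1.

(** * Positive definite forms and Gaussian sums in dimension d *)

Section QuadraticForm.
Variable R : realType.

Definition qf d (A : 'M[R]_d) (x : 'rV[R]_d) : R := (x *m A *m x^T) 0 0.

Definition posdef d (A : 'M[R]_d) := forall x, x != 0 -> 0 < qf A x.

Definition schur d (A : 'M[R]_(1 + d)) : 'M[R]_d :=
  drsubmx A - (ulsubmx A 0 0)^-1 *: (dlsubmx A *m (dlsubmx A)^T).

Lemma qf_schur d (A : 'M[R]_(1 + d)) (x : 'rV[R]_(1 + d)) :
  A^T = A -> ulsubmx A 0 0 != 0 ->
  qf A x = ulsubmx A 0 0 *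
     (lsubmx x 0 0 + (rsubmx x *m dlsubmx A) 0 0 / ulsubmx A 0 0) ^+ 2
     + qf (schur A) (rsubmx x).
Proof.
move=> symA q0; rewrite /schur; set v := dlsubmx A; set q := ulsubmx A 0 0 in q0 *.
have uE : ursubmx A = v^T by rewrite /v trmx_dlsub symA.
rewrite /qf -{1}[A]submxK -{1 2}[x]hsubmxK uE -/v.
set x0 := lsubmx x; set x1 := rsubmx x; set A' := drsubmx A.
rewrite mul_row_block tr_row_mx mul_row_col.
have -> : ulsubmx A = q%:M by rewrite [LHS]mx11_scalar.
set w := (x1 *m v) 0 0; set t := x0 0 0.
have x0E : x0 = t%:M by rewrite [LHS]mx11_scalar.
have wE : x1 *m v = w%:M by rewrite [LHS]mx11_scalar.
have wE' : v^T *m x1^T = w%:M by rewrite -trmx_mul wE tr_scalar_mx.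
rewrite !mulmxDl wE x0E tr_scalar_mx -!scalar_mxM.
rewrite -[t%:M *m _ *m _]mulmxA wE' -scalar_mxM.
rewrite mulmxBr mulmxBl -!scalemxAr -scalemxAl.
have -> : x1 *m (v *m v^T) *m x1^T = (w * w)%:M.
  by rewrite mulmxA wE -mulmxA wE' -scalar_mxM.
rewrite !mxE eqxx /= !mulr1n; by field.
Qed.

Lemma det_schur d (A : 'M[R]_(1 + d)) : A^T = A -> ulsubmx A 0 0 != 0 ->
  \det A = ulsubmx A 0 0 * \det (schur A).
Proof.
move=> symA q0; rewrite /schur; set v := dlsubmx A; set q := ulsubmx A 0 0 in q0 *.
have uE : ursubmx A = v^T by rewrite /v trmx_dlsub symA.
have qE : ulsubmx A = q%:M by rewrite [LHS]mx11_scalar.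
have AE : A = block_mx 1%:M 0 (q^-1 *: v) 1%:M *m
   block_mx q%:M v^T 0 (drsubmx A - q^-1 *: (v *m v^T)).
  rewrite mulmx_block !mul1mx !mul0mx ?mulmx0 !addr0 -!scalemxAl mul_mx_scalar.
  by rewrite scalerA mulVf // scale1r addrC subrK -qE -uE /v submxK.
by rewrite [X in \det X = _]AE det_mulmx det_lblock det_ublock !det1 !mul1r det_scalar1.
Qed.

Lemma tr_schur d (A : 'M[R]_(1 + d)) : A^T = A -> (schur A)^T = schur A.
Proof.
move=> symA; rewrite /schur linearB linearZ /= trmx_mul trmxK.
by rewrite trmx_drsub symA.
Qed.

Lemma posdef_diag d (A : 'M[R]_(1 + d)) : posdef A -> 0 < ulsubmx A 0 0.
Proof.
move=> pA; pose x : 'rV[R]_(1 + d) := row_mx 1%:M 0.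
have : x != 0.
  apply/eqP => /(congr1 lsubmx); rewrite row_mxKl linear0 => /matrixP/(_ 0 0).
  by rewrite !mxE eqxx => /eqP; rewrite oner_eq0.
move/pA; rewrite /qf -[in X in X -> _](submxK A) /x mul_row_block tr_row_mx.
by rewrite mul_row_col !mul0mx trmx0 mulmx0 !addr0 mul1mx trmx1 mulmx1.
Qed.

(** A vector is extended by the first coordinate that annihilates the square in [qf_schur]. *)
Lemma posdef_schur d (A : 'M[R]_(1 + d)) :
  A^T = A -> posdef A -> posdef (schur A).
Proof.
move=> symA pA x x0; have q0 := posdef_diag pA.
pose y : 'rV[R]_(1 + d) :=
  row_mx (- ((x *m dlsubmx A) 0 0 / ulsubmx A 0 0))%:M x.
have : y != 0.
  apply: contra_neq x0 => /(congr1 rsubmx); by rewrite row_mxKr linear0.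
move/pA; rewrite (qf_schur _ symA) ?gt_eqF // /y row_mxKl row_mxKr.
by rewrite [_%:M 0 0]mxE eqxx mulr1n addNr expr0n mulr0 add0r.
Qed.

Definition lattice_pt d T (a : 'rV[R]_d) (j : {ffun 'I_d -> 'I_(2 * T).+1}) : 'rV[R]_d :=
  \row_i ((j i)%:R - T%:R + a 0 i).

Definition gsum d (A : 'M[R]_d) (a : 'rV[R]_d) T (M : R) : R :=
  \sum_j expR (- qf A (@lattice_pt d T a j) / M).

(** The small box embeds in the large one by shifting indices by T - T'; the remaining terms are
    nonnegative. *)
Lemma lattice_pt_subbox d (T T' : nat) (a : 'rV[R]_d) (h : 'rV[R]_d -> R) :
  (forall x, 0 <= h x) -> (T' <= T)%N ->
  \sum_j h (@lattice_pt d T' a j) <= \sum_j h (@lattice_pt d T a j).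
Proof.
move=> h0 T'T.
pose io (j : {ffun 'I_d -> 'I_(2 * T').+1}) : {ffun 'I_d -> 'I_(2 * T).+1} :=
  [ffun i => inord (j i + (T - T'))].
have ioE j i : val (io j i) = (j i + (T - T'))%N.
  by rewrite ffunE /= inordK //; have := ltn_ord (j i); lia.
have io_inj : injective io.
  move=> j k /ffunP e; apply/ffunP => i; apply: val_inj.
  by have := congr1 val (e i); rewrite !ioE => /addIn.
have lE j : lattice_pt a (io j) = lattice_pt a j.
  apply/rowP => i; rewrite !mxE; congr (_ + _).
  have := ioE j i => /= ->.
  by rewrite natrD natrB //; ring.
rewrite [leRHS](bigID (fun j => j \in [set io k | k : {ffun 'I_d -> 'I_(2 * T').+1}]%SET)) /=.
apply: (@le_trans _ _ (\sum_(j in [set io k | k : {ffun 'I_d -> 'I_(2 * T').+1}]%SET) h (lattice_pt a j)));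
  last by rewrite lerDl sumr_ge0.
rewrite big_imset /=; last by move=> j k _ _ /io_inj.
by rewrite le_eqVlt; apply/orP; left; apply/eqP/eq_bigr => j _; rewrite lE.
Qed.

Lemma lpt_fcons d T (a : 'rV[R]_(1 + d)) j0 (j : {ffun 'I_d -> 'I_(2 * T).+1}) :
  lattice_pt a (fcons (j0, j)) =
  row_mx (j0%:R - T%:R + lsubmx a 0 0)%:M (lattice_pt (rsubmx a) j) :> 'rV[R]_(1 + d).
Proof.
apply/rowP => i; rewrite !mxE /= ffunE.
case: (splitP i) => [i0 ei|k ek].
  have -> : i = ord0 :> 'I_d.+1 by apply: val_inj; rewrite /= ei; case: (i0) => -[].
  rewrite unlift_none [i0]ord1 !mxE eqxx mulr1n; congr (_ + a _ _).
  exact: val_inj.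
have -> : i = lift ord0 k by apply: val_inj; rewrite /= ek.
rewrite liftK !mxE; congr (_ + a _ _); exact: val_inj.
Qed.

(** Induction on d: completing the square in the first coordinate leaves a one-dimensional Gaussian
    sum whose shift depends linearly on the other coordinates, times a Gaussian sum for the Schur
    complement. *)
Lemma gsum_cvg d (A : 'M[R]_d) : A^T = A -> posdef A -> 0 < \det A /\
  forall B e : R, 0 <= B -> 0 < e -> exists W M0 : R,
  [/\ 0 <= W, 1 <= M0 & forall (M : R) T (a : 'rV[R]_d),
    M0 <= M -> W * Num.sqrt M <= T%:R -> (forall i, `|a 0 i| <= B) ->
  `|(Num.sqrt M)^-1 ^+ d * gsum A a T M - Num.sqrt pi ^+ d / Num.sqrt (\det A)|
     <= e].
Proof.
elim: d A => [|d IH] A symA pA.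
  rewrite det_mx00; split => // B e B0 e0; exists 0, 1; split=> // M T a hM hT ha.
  rewrite sqrtr1 !expr0 mul1r divr1 /gsum (eq_bigr (fun=> 1)); last first.
    move=> j _; rewrite /qf.
    suff -> : lattice_pt a j = 0 by rewrite trmx0 mulmx0 mxE oppr0 mul0r expR0.
    by apply/rowP => -[].
  by rewrite sumr_const card_ffun !card_ord expn0 subrr normr0 ltW.
have q0 := @posdef_diag d A pA; set q := ulsubmx _ _ _ in q0.
have [dS0 {}IH] := IH _ (@tr_schur d A symA) (@posdef_schur d A symA pA).
set S := schur _ in dS0 IH.
have dA : \det A = q * \det S by apply: (@det_schur d) => //; rewrite gt_eqF.
split; first by rewrite dA mulr_gt0.
move=> B e B0 e0; rewrite dA sqrtrM ?ltW // exprS.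
pose K := Num.sqrt pi / Num.sqrt q; pose L := Num.sqrt pi ^+ d / Num.sqrt (\det S).
have -> : Num.sqrt pi * Num.sqrt pi ^+ d / (Num.sqrt q * Num.sqrt (\det S)) = K * L.
  by rewrite /K /L invfM; ring.
have K0 : 0 < K by rewrite divr_gt0 // sqrtr_gt0 // pi_gt0.
have L0 : 0 < L by rewrite divr_gt0 // ?exprn_gt0 // sqrtr_gt0 // pi_gt0.
have KL0 : 0 < K + L + 1 by lra.
(* Chosen so that (K + e1)(L + e1) and (K - e1)(L - e1) are within e of K L, with K - e1
   nonnegative. *)
pose e1 := Num.min 1 (Num.min K (e / (K + L + 1))).
have e10 : 0 < e1 by rewrite !lt_min ltr01 K0 divr_gt0.
have e11 : e1 <= 1 by rewrite ge_min lexx.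
have e1K : e1 <= K by rewrite !ge_min lexx orbT.
have e1e : e1 * (K + L + 1) <= e.
  by rewrite -ler_pdivlMr // !ge_min lexx !orbT.
have [W1 [M1 [W10 M11 h1]]] := gauss_sum1 q0 e10.
have [W2 [M2 [W20 M21 h2]]] := IH B e1 B0 e10.
pose v := @dlsubmx R 1 d 1 d A.
pose be := \sum_i `|v i 0| / q.
have be0 : 0 <= be by apply: sumr_ge0 => i _; rewrite divr_ge0 // ltW.
pose k := (Num.truncn (2 * be)).+1.
have kbe : 2 * be <= k%:R by rewrite ltW // truncnS_gt.
have k1 : (1 : R) <= k%:R by rewrite ler1n.
(* The three summands leave room for the inner sum in half of the box, for the small box T' = T / k,
   and for the full box, respectively. *)
exists (2 * (B * (1 + be) + W1) + k%:R * (W2 + 1) + W2), (Num.max M1 M2); split.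
- by rewrite !addr_ge0 ?mulr_ge0 ?addr_ge0 ?mulr_ge0 ?addr_ge0 // (le_trans ler01).
- by rewrite le_max M11.
move=> M T a hM hT ha; rewrite ge_max in hM; case/andP: hM => hM1 hM2.
have M1' : 1 <= M by apply: le_trans hM1.
have t1 : 1 <= Num.sqrt M by rewrite -sqrtr1 ler_wsqrtr.
set t := Num.sqrt M in hT t1 *.
have t0 : 0 < t by lra.
pose a0 := @lsubmx _ 1 1 d a 0 0; pose a' := @rsubmx _ 1 1 d a.
have ha0 : `|a0| <= B by rewrite /a0 mxE ha.
have ha' i : `|a' 0 i| <= B by rewrite /a' mxE ha.
pose sh (x : 'rV[R]_d) := (x *m v) 0 0 / q.
pose F T' (x : 'rV[R]_d) :=
  \sum_(j0 < (2 * T').+1) expR (- (q * (j0%:R - T'%:R + (a0 + sh x)) ^+ 2) / M).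
have gE : gsum A a T M =
    \sum_j expR (- qf S (@lattice_pt d T a' j) / M) * F T (lattice_pt a' j).
  rewrite /gsum big_fcons exchange_big /=; apply: eq_bigr => j _.
  rewrite mulr_sumr; apply: eq_bigr => j0 _.
  rewrite lpt_fcons (@qf_schur d) // ?gt_eqF // row_mxKl row_mxKr.
  rewrite -expRD; congr expR; rewrite [_%:M 0 0]mxE eqxx mulr1n.
  rewrite -/q -/S -/a0 -/a' /sh -/v; ring.
have W2T : W2 * t <= T%:R.
  apply: le_trans hT; rewrite ler_wpM2r ?(ltW t0) // lerDr.
  by rewrite !addr_ge0 ?mulr_ge0 ?addr_ge0 ?mulr_ge0 ?addr_ge0 // (le_trans ler01).
have /h2 := W2T => /(_ a' hM2 ha'); rewrite ler_norml => /andP[_ up].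
have tdE Y : t^-1 ^+ d.+1 * Y = t^-1 ^+ d * (t^-1 * Y) by rewrite exprSr mulrA.
have td0 : 0 < t^-1 ^+ d by rewrite exprn_gt0 // invr_gt0.
rewrite tdE gE mulr_sumr.
set X := (Z in `|Z - _|); rewrite ler_norml; apply/andP; split; last first.
  have : X <= t^-1 ^+ d * (\sum_j expR (- qf S (@lattice_pt d T a' j) / M) * (K + e1)).
    rewrite ler_pM2l //; apply: ler_sum => j _; rewrite mulrCA ler_pM2l ?expR_gt0 //.
    by have [+ _] := h1 M (a0 + sh (lattice_pt a' j)) T hM1.
  rewrite -mulr_suml mulrA -/(gsum S a' T M).
  set G := _ * gsum _ _ _ _ in up *; rewrite -/L -/t in up.
  have GL : G <= L + e1 by lra.
  have Ke : 0 <= K + e1 by lra.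
  have := ler_wpM2r Ke GL; nra.
pose T' := (T %/ k)%N.
have T'T : (T' <= T)%N by rewrite /T' leq_div.
have kT' : k%:R * T'%:R <= T%:R :> R by rewrite -natrM ler_nat mulnC leq_trunc_div.
have T'k : T%:R <= k%:R * (T'%:R + 1) :> R.
  by rewrite natr1 -natrM ler_nat mulnC ltnW // ltn_ceil.
have W2T' : W2 * t <= T'%:R.
  have : k%:R * (W2 + 1) * t <= k%:R * (T'%:R + 1).
    apply: le_trans T'k; apply: le_trans hT; rewrite ler_wpM2r ?(ltW t0) //.
    have : 0 <= B * (1 + be) by rewrite mulr_ge0 // addr_ge0.
    lra.
  rewrite -mulrA ler_pM2l; last by lra.
  lra.
have /h2 := W2T' => /(_ a' hM2 ha'); rewrite ler_norml => /andP[lo _].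
have : t^-1 ^+ d * (\sum_j expR (- qf S (@lattice_pt d T' a' j) / M) * (K - e1)) <= X.
  rewrite ler_pM2l //.
  apply: (@le_trans _ _ (\sum_j expR (- qf S (@lattice_pt d T' a' j) / M)
           * (t^-1 * F T (lattice_pt a' j)))); last first.
    rewrite (eq_bigr (fun j => expR (- qf S (@lattice_pt d T a' j) / M)
           * (t^-1 * F T (lattice_pt a' j)))); last by move=> j _; rewrite mulrCA.
    apply: (@lattice_pt_subbox d T T' a' (fun x => expR (- qf S x / M) * (t^-1 * F T x))) => // x.
    apply: mulr_ge0; first exact: expR_ge0.
    apply: mulr_ge0; first by rewrite invr_ge0 (ltW t0).
    by apply: sumr_ge0 => j _; exact: expR_ge0.
  apply: ler_sum => j _; rewrite ler_pM2l ?expR_gt0 //.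
  have [_ + ] := h1 M (a0 + sh (lattice_pt a' j)) T hM1; apply.
  have shb : `|sh (@lattice_pt d T' a' j)| <= be * (T'%:R + B).
    rewrite /sh normrM normfV (gtr0_norm q0) mxE.
    rewrite /be mulr_suml ler_pdivrMr // mulr_suml.
    apply: le_trans (ler_norm_sum _ _ _) _; apply: ler_sum => i _.
    rewrite mxE normrM mulrC.
    have -> : `|v i 0| / q * (T'%:R + B) * q = `|v i 0| * (T'%:R + B).
      by field; rewrite gt_eqF.
    apply: ler_wpM2l => //; apply: le_trans (ler_normD _ _) _; apply: lerD => //.
    rewrite ler_norml; have := ltn_ord (j i); rewrite ltnS -(ler_nat R) natrM.
    have : 0 <= (j i)%:R :> R by []. lra.
  have := ler_normD a0 (sh (lattice_pt a' j)).
  have Tb : be * T'%:R <= T%:R / 2.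
    have : 2 * be * T'%:R <= k%:R * T'%:R by rewrite ler_wpM2r.
    lra.
  have : 2 * (B * (1 + be) + W1) * t <= T%:R.
    apply: le_trans hT; rewrite ler_wpM2r ?(ltW t0) //.
    have : 0 <= k%:R * (W2 + 1) by rewrite mulr_ge0 ?addr_ge0.
    lra.
  have : B * (1 + be) <= B * (1 + be) * t.
    by rewrite ler_peMr // mulr_ge0 // addr_ge0.
  rewrite -/t; lra.
rewrite -mulr_suml mulrA -/(gsum S a' T' M).
set G := _ * gsum _ _ _ _ in lo *; rewrite -/L -/t in lo.
have GL : L - e1 <= G by lra.
have Ke : 0 <= K - e1 by lra.
have := ler_wpM2r Ke GL; nra.
Qed.

End QuadraticForm.

(** * Stirling's formula *)

Section Logs.
Variable R : realType.
Implicit Types (x : R).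

Lemma ln1D_ge x : -1 < x -> x / (1 + x) <= ln (1 + x).
Proof.
move=> x1; have x0 : 0 < 1 + x by lra.
rewrite -[leRHS]opprK -lnV // lerNr.
have e : (1 + x)^-1 = 1 + (- (x / (1 + x))) by field; rewrite gt_eqF.
have : -1 < - (x / (1 + x)) by rewrite ltrN2 ltr_pdivrMr //; lra.
by move/le_ln1Dx; rewrite -e.
Qed.

Lemma ln1D_quad x : `|x| <= 2^-1 -> `|ln (1 + x) - x| <= 2 * x ^+ 2.
Proof.
rewrite ler_norml => /andP[xl xu].
have x1 : -1 < x by lra.
have := ln1D_ge x1; have := le_ln1Dx x1.
have x0 : 0 < 1 + x by lra.
have : x - 2 * x ^+ 2 <= x / (1 + x).
  by rewrite ler_pdivlMr //; nra.
rewrite ler_norml; nra.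
Qed.

(** The derivative of the remainder is ln (1 + t) - t, which is quadratically small, so the mean
    value theorem gains one more power. *)
Lemma xlnx_cubic x : `|x| <= 2^-1 ->
  `|(1 + x) * ln (1 + x) - x - x ^+ 2 / 2| <= 2 * `|x| ^+ 3.
Proof.
move=> hx; pose h (t : R) := (1 + t) * ln (1 + t) - t - t ^+ 2 / 2.
have h0 : h 0 = 0 by rewrite /h addr0 ln1; ring.
have dh (t : R) : `|t| <= 2^-1 -> is_derive t (1 : R) h (ln (1 + t) - t).
  rewrite ler_norml => /andP[tl tu]; have t0 : 0 < 1 + t by lra.
  have := is_derive1_ln t0 => dl.
  rewrite /h; apply: is_derive_eq.
  rewrite /GRing.scale /=; field; lra.
have E (a b : R) : a <= b -> (forall t, a <= t <= b -> `|t| <= `|x|) ->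
    `|h b - h a| <= 2 * `|x| ^+ 2 * (b - a).
  move=> ab hab; have hab' t : t \in `[a, b] -> `|t| <= 2^-1.
    by rewrite in_itv /= => /hab; move/le_trans; apply.
  have [c cab ->] : exists2 c, c \in `[a, b] & h b - h a = (ln (1 + c) - c) * (b - a).
    apply: (@MVT_segment _ h (fun t => ln (1 + t) - t)) => //.
      move=> t tab; apply: dh; apply: hab'; exact: subset_itv_oo_cc tab.
    apply: derivable_within_continuous => t tab.
    by have := dh t (hab' t tab); case.
  rewrite normrM (@ger0_norm _ (b - a)) ?subr_ge0 // ler_wpM2r ?subr_ge0 //.
  apply: le_trans (ln1D_quad (hab' _ cab)) _.
  rewrite ler_pM2l // -(real_normK (num_real c)) lerXn2r ?nnegrE //.
  by apply: hab; rewrite in_itv in cab.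
rewrite -/(h x); have [x0|x0] := leP 0 x.
  have := E 0 x x0; rewrite h0 !subr0 [in X in _ -> X](ger0_norm x0) => E'.
  apply: le_trans (E' _) _; last by rewrite exprS; rewrite (ger0_norm x0); lra.
  by move=> t /andP[t0 tx]; rewrite !ger0_norm //; lra.
have := E x 0 (ltW x0); rewrite h0 !sub0r normrN => E'.
apply: le_trans (E' _) _; last by rewrite exprS (ltr0_norm x0); lra.
by move=> t /andP[t0 tx]; rewrite !ler0_norm //; lra.
Qed.

Definition xlnx x := x * ln x.

Lemma xlnx0 : xlnx 0 = 0. Proof. by rewrite /xlnx mul0r. Qed.

Lemma xlnxM (a b : R) : 0 < a -> 0 <= b -> xlnx (a * b) = a * xlnx b + b * xlnx a.
Proof.
move=> a0; rewrite le_eqVlt => /predU1P[<-|b0]; first by rewrite mulr0 xlnx0; ring.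
by rewrite /xlnx lnM //; ring.
Qed.

Lemma xlnx_expand (p d : R) : 0 < p -> `|d| <= p / 2 ->
  `|xlnx (p + d) - (xlnx p + d * (ln p + 1) + d ^+ 2 / (2 * p))|
    <= 2 / p ^+ 2 * `|d| ^+ 3.
Proof.
move=> p0 hd.
have [x dE hx] : exists2 x, d = p * x & `|x| <= 2^-1.
  exists (d / p); first by rewrite mulrC divfK // gt_eqF.
  by rewrite normrM normfV (gtr0_norm p0) ler_pdivrMr // mulrC.
have x1 : 0 < 1 + x by move: hx; rewrite ler_norml; lra.
have -> : p + d = p * (1 + x) by rewrite dE; ring.
rewrite xlnxM // ?(ltW x1) // /xlnx.
have := xlnx_cubic hx; set u := ln (1 + x).
rewrite dE normrM (gtr0_norm p0) => h.
have -> : p * ((1 + x) * u) + (1 + x) * (p * ln p) -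
   (p * ln p + p * x * (ln p + 1) + (p * x) ^+ 2 / (2 * p)) =
   p * ((1 + x) * u - x - x ^+ 2 / 2) by field; rewrite gt_eqF.
have -> : 2 / p ^+ 2 * (p * `|x|) ^+ 3 = p * (2 * `|x| ^+ 3).
  by field; rewrite gt_eqF.
by rewrite [X in X <= _]normrM (gtr0_norm p0) ler_pM2l.
Qed.

Lemma xlnx_convex (a b : R) : 0 < a -> 0 <= b ->
  (ln a + 1) * (b - a) <= xlnx b - xlnx a.
Proof.
move=> a0; rewrite le_eqVlt => /predU1P[<-|b0].
  by rewrite xlnx0 /xlnx; lra.
have : ln (a / b) <= a / b - 1.
  have -> : a / b = 1 + (a / b - 1) by ring.
  rewrite [in leRHS]addrAC subrr add0r; apply: le_ln1Dx.
  have : 0 < a / b by rewrite divr_gt0. lra.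
rewrite ln_div // => h.
have : b * (ln a - ln b) <= b * (a / b - 1) by rewrite ler_pM2l.
have -> : b * (a / b - 1) = a - b by field; rewrite gt_eqF.
rewrite /xlnx; lra.
Qed.

Lemma xlnx_le0 x : x <= 0 -> xlnx x = 0.
Proof. by rewrite /xlnx => /ln0 ->; rewrite mulr0. Qed.

Lemma xlnx_continuous : continuous xlnx.
Proof.
move=> x; have [x0|x0|->] := ltgtP x 0.
- apply/cvgrPdist_le => e e0; near=> y.
  have y0 : y <= 0 by apply: ltW; near: y; exact: lt_nbhsl.
  by rewrite !xlnx_le0 ?(ltW x0) // subrr normr0 (ltW e0).
- by apply: cvgM; [exact: cvg_id | exact: continuous_ln].
rewrite /prop_for /continuous_at xlnx0; apply/cvgrPdist_le => e e0.
(* At 0, the bound ln u < u for u = 1 / sqrt y gives |y ln y| <= 2 sqrt y, which is at most e when y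
   <= (e / 2)^2. *)
pose d := Num.min 1 ((e / 2) ^+ 2).
have d0 : 0 < d by rewrite lt_min ltr01 exprn_gt0 // divr_gt0.
near=> y; have yd : `|y| <= d.
  near: y; apply/nbhs_ballP; exists d => // z; rewrite /ball /= sub0r normrN.
  exact: ltW.
rewrite sub0r normrN; have [y0|y0] := leP y 0; first by rewrite xlnx_le0 // normr0 ltW.
rewrite (gtr0_norm y0) /d le_min in yd; case/andP: yd => y1 ye.
have sy0 : 0 < Num.sqrt y by rewrite sqrtr_gt0.
have sye : Num.sqrt y <= e / 2.
  by have := ler_wsqrtr ye; rewrite sqrtr_sqr ger0_norm // divr_ge0 // ltW.
have lny : ln y <= 0 by apply: ln_le0.
rewrite normrM (gtr0_norm y0) ler0_norm //.
have : ln ((Num.sqrt y)^-1) <= (Num.sqrt y)^-1 by rewrite ltW // ln_sublinear ?invr_gt0.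
rewrite lnV ?posrE // => h.
have lnE : ln y = 2 * ln (Num.sqrt y).
  by rewrite -[in LHS](sqr_sqrtr (ltW y0)) lnXn // mulr_natl.
rewrite lnE -[y in y * _](sqr_sqrtr (ltW y0)).
have : Num.sqrt y ^+ 2 * (- (2 * ln (Num.sqrt y))) <= Num.sqrt y ^+ 2 * (2 * (Num.sqrt y)^-1).
  by rewrite ler_pM2l ?exprn_gt0 //; lra.
have -> : Num.sqrt y ^+ 2 * (2 * (Num.sqrt y)^-1) = 2 * Num.sqrt y by field; rewrite gt_eqF.
lra.
Unshelve. all: by end_near. Qed.

End Logs.

Section Stirling.
Variable R : realType.

Definition stirling_seq (k : nat) : R :=
  ln k`!%:R - (xlnx k%:R - k%:R) - ln k%:R / 2.

(** With x = 1 / k the increment is 1 - (1/x + 1/2) ln (1 + x), and expanding the logarithm cancels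
    everything up to order x^2. *)
Lemma stirling_seq_step (k : nat) : (2 <= k)%N ->
  `|stirling_seq k.+1 - stirling_seq k| <= 8 / (k%:R ^+ 2).
Proof.
move=> k2; have k0 : 0 < k%:R :> R by rewrite ltr0n; lia.
have k2' : 2 <= k%:R :> R by rewrite ler_nat.
pose x : R := k%:R^-1.
have x0 : 0 < x by rewrite invr_gt0.
have xh : x <= 2^-1 by rewrite lef_pV2 ?posrE.
have kx : k%:R = x^-1 by rewrite invrK.
have k1E : k.+1%:R = k%:R * (1 + x) :> R.
  by rewrite mulrDr mulr1 divff ?gt_eqF // natr1.
have x10 : 0 < 1 + x by lra.
have -> : stirling_seq k.+1 - stirling_seq k = 1 - (k%:R + 2^-1) * ln (1 + x).
  rewrite /stirling_seq factS natrM lnM ?posrE ?ltr0n ?fact_gt0 // /xlnx k1E lnM ?posrE //.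
  set u := ln (1 + x); set w := ln k%:R; set z := ln _.
  by rewrite kx; field; rewrite gt_eqF.
have xn : `|x| <= 2^-1 by rewrite gtr0_norm.
have := xlnx_cubic xn; rewrite (gtr0_norm x0); set u := ln (1 + x).
have -> : 8 / k%:R ^+ 2 = 8 * x ^+ 2 by rewrite kx exprVn invrK.
rewrite kx !ler_norml => /andP[h1 h2].
have E : x^-1 * x = 1 by rewrite mulVf // gt_eqF.
(* The quadratic part of (1 + x) ln (1 + x) leaves exactly -(x^2 / 4) / (1 + x); the cubic remainder
   is multiplied by a / (1 + x), of order 1 / x. *)
pose a : R := x^-1 + 2^-1.
have aE : 1 - a * u = (1 - a * ((x + x ^+ 2 / 2) / (1 + x)))
    - a / (1 + x) * ((1 + x) * u - x - x ^+ 2 / 2).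
  by rewrite /a; field; rewrite !gt_eqF.
have e1 : 1 - a * ((x + x ^+ 2 / 2) / (1 + x)) = - (x ^+ 2 / 4) / (1 + x).
  by rewrite /a; field; rewrite !gt_eqF.
have a0 : 0 <= a / (1 + x) by rewrite divr_ge0 ?addr_ge0 ?invr_ge0 // ltW.
have b1 : a / (1 + x) * (2 * x ^+ 3) <= 7 * x ^+ 2.
  have -> : a / (1 + x) * (2 * x ^+ 3) = (2 * x ^+ 2 + x ^+ 3) / (1 + x).
    by rewrite /a; field; rewrite !gt_eqF.
  by rewrite ler_pdivrMr //; nra.
have b2 : (x ^+ 2 / 4) / (1 + x) <= x ^+ 2 by rewrite ler_pdivrMr //; nra.
have b3 : 0 <= (x ^+ 2 / 4) / (1 + x) by rewrite !divr_ge0 ?sqr_ge0 ?ltW.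
set v := (1 + x) * u - x - x ^+ 2 / 2 in h1 h2 aE.
have m1 := ler_wpM2l a0 h1; have m2 := ler_wpM2l a0 h2.
rewrite -/a aE e1 mulrN mulNr in m1 *; apply/andP; split; lra.
Qed.

(** The steps telescope, since 8 / n^2 <= 8 / (n - 1) - 8 / n. *)
Lemma stir_dist (k n : nat) : (2 <= k)%N -> (k <= n)%N ->
  `|stirling_seq n - stirling_seq k| <= 8 / (k.-1)%:R - 8 / (n.-1)%:R.
Proof.
move=> k2; elim: n => [|n IH]; first by rewrite leqn0 => /eqP ek; rewrite ek in k2.
rewrite leq_eqVlt => /predU1P[->|]; first by rewrite !subrr normr0.
rewrite ltnS => kn.
have -> : stirling_seq n.+1 - stirling_seq k = (stirling_seq n.+1 - stirling_seq n) + (stirling_seq n - stirling_seq k) by ring.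
have n2 : (2 <= n)%N by apply: leq_trans kn.
apply: le_trans (ler_normD _ _) _.
have := IH kn; have := stirling_seq_step n2; rewrite /=.
have n0 : 1 <= n.-1%:R :> R by rewrite ler1n; lia.
have -> : n%:R = n.-1%:R + 1 :> R by rewrite natr1 prednK //; lia.
set y : R := n.-1%:R in n0 *.
have : 8 / (y + 1) ^+ 2 <= 8 / y - 8 / (y + 1).
  have -> : 8 / y - 8 / (y + 1) = 8 / (y * (y + 1)) by field; rewrite !gt_eqF //; lra.
  have y1 : 0 < y + 1 by lra.
  rewrite ler_pM2l // lef_pV2 ?posrE ?exprn_gt0 ?mulr_gt0 //; last by lra.
  by rewrite expr2 ler_pM2r //; lra.
lra.
Qed.

Lemma stirling : exists c : R, forall e : R, 0 < e ->
  exists K : nat, forall k, (K <= k)%N ->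
  `|ln k`!%:R - (xlnx k%:R - k%:R) - ln k%:R / 2 - c| <= e.
Proof.
have : cauchy (stirling_seq @ \oo).
  apply/cauchy_ballP => e e0; rewrite near_map2.
  pose K := (Num.truncn (16 / e)).+3.
  have hK k n : (K <= k)%N -> (k <= n)%N -> `|stirling_seq n - stirling_seq k| < e.
    move=> Kk kn; have k2 : (2 <= k)%N by rewrite (leq_trans _ Kk).
    apply: le_lt_trans (stir_dist k2 kn) _.
    have : 8 / k.-1%:R <= e / 2.
      rewrite ler_pdivrMr ?ltr0n; last by lia.
      have : 16 / e < k.-1%:R.
        apply: lt_le_trans (truncnS_gt _) _; rewrite ler_nat.
        move: Kk; rewrite /K; set tt := Num.truncn (16 / e).
        lia.
      by rewrite ltr_pdivrMr //; lra.
    have : 0 <= 8 / n.-1%:R :> R by rewrite divr_ge0.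
    lra.
  exists ([set k | (K <= k)%N], [set k | (K <= k)%N]).
    by split; exists K.
  move=> [a b] /= [Ka Kb]; rewrite /ball /=.
  have [ab|ba] := leqP a b; first by rewrite distrC; exact: hK.
  exact/hK/ltnW.
move/cauchy_cvg => hc; exists (lim (stirling_seq @ \oo)) => e e0.
have /cvgrPdist_le/(_ e e0)[K _ hK] := hc.
by exists K => k Kk; have := hK k Kk; rewrite distrC.
Qed.

(** Holds for every k, 0 included, as required for types on the boundary of the simplex. *)
Lemma stirling_rough : exists C : R, 0 <= C /\ forall k : nat,
  `|ln k`!%:R - (xlnx k%:R - k%:R)| <= C + ln (k%:R + 1).
Proof.
exists (`|stirling_seq 2| + 9); split; first by rewrite addr_ge0.
move=> [|[|k]].
- rewrite fact0 ln1 xlnx0 !subr0 normr0 add0r ln1 addr0.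
  by rewrite addr_ge0.
- rewrite /xlnx ln1 mulr0 !sub0r opprK normr1.
  have : 0 <= ln (1 + 1 : R) by rewrite ln_ge0 // lerDl.
  have := normr_ge0 (stirling_seq 2); lra.
have := @stir_dist 2 k.+2 isT isT; rewrite /=.
have k0 : 0 < k.+2%:R :> R by rewrite ltr0n.
have : 0 <= 8 / k.+1%:R :> R by rewrite divr_ge0.
have l1 : ln (k.+2%:R : R) <= ln (k.+2%:R + 1) by rewrite ler_ln ?posrE ?addr_gt0 // lerDl.
have l0 : 0 <= ln (k.+2%:R : R) by rewrite ln_ge0 // ler1n.
rewrite divr1 => h0; set y := ln _ - _.
have -> : stirling_seq k.+2 = y - ln k.+2%:R / 2 by [].
set w := ln k.+2%:R in l0 l1 *; rewrite !ler_norml => /andP[h1 h2].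
have := ler_norm (stirling_seq 2); have := ler_norm (- stirling_seq 2); rewrite normrN.
move: l0 l1 h0 h1 h2; clearbody w y; move: (ln (_ + 1)) (8 / _) (stirling_seq 2) => a b c l0 l1 h0 h1 h2 h3 h4.
apply/andP; split; lra.
Qed.

End Stirling.

(** * The variational problem near its maximizer *)

(** Both sides are the determinant of the block matrix with identity diagonal blocks, factored in
    two ways. *)
Lemma det_1subM (R : comPzRingType) m n (M : 'M[R]_(m, n)) (N : 'M[R]_(n, m)) :
  \det (1%:M - M *m N) = \det (1%:M - N *m M).
Proof.
have E1 : block_mx 1%:M M N 1%:M =
    block_mx 1%:M 0 N 1%:M *m block_mx 1%:M M 0 (1%:M - N *m M).
  rewrite mulmx_block ?mul1mx ?mul0mx ?mulmx0 ?mulmx1 !addr0.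
  by rewrite addrC subrK.
have E2 : block_mx 1%:M M N 1%:M =
    block_mx (1%:M - M *m N) M 0 1%:M *m block_mx 1%:M 0 N 1%:M.
  rewrite mulmx_block ?mul1mx ?mul0mx ?mulmx0 ?mulmx1 !add0r.
  by rewrite subrK.
have := congr1 determinant E1; rewrite E2 !det_mulmx !det_lblock !det_ublock.
by rewrite !det1 !mul1r !mulr1.
Qed.

Section PosDef.
Variables (R : realType) (d : nat) (A : 'M[R]_d).
Hypothesis symA : A^T = A.

Definition bilin (x y : 'rV[R]_d) : R := (x *m A *m y^T) 0 0.

Lemma bilinC x y : bilin x y = bilin y x.
Proof.
rewrite /bilin -[LHS]/((x *m A *m y^T) 0 0) -[in LHS](trmxK (x *m A *m y^T)).
by rewrite [LHS]mxE !trmx_mul trmxK symA mulmxA.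
Qed.

Lemma qf_lin (t : R) x y : qf A (x + t *: y) = qf A x + 2 * t * bilin y x + t ^+ 2 * qf A y.
Proof.
have -> : 2 * t * bilin y x = t * bilin x y + t * bilin y x by rewrite (bilinC x y); ring.
rewrite /qf /bilin linearD linearZ /= !mulmxDl !mulmxDr -!scalemxAl -!scalemxAr.
by rewrite !mxE; ring.
Qed.

(** A vector where a semidefinite form vanishes is orthogonal, for the form, to every vector, hence
    lies in the kernel of A. *)
Lemma posdef_psd : (forall x, 0 <= qf A x) -> \det A != 0 -> posdef A.
Proof.
move=> psd dA x x0; rewrite lt_neqAle psd andbT eq_sym; apply: contra_neq x0 => qx.
have bx y : bilin y x = 0.
  have q0 := psd y; pose b := bilin y x; pose q := qf A y; rewrite -/b.
  (* The minimum in t would be at -b / q; the denominator q + 1 also covers q = 0. *)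
  have := psd (x + (- b / (q + 1)) *: y); rewrite qf_lin qx add0r -/b -/q => h.
  have q1 : 0 < q + 1 by rewrite ltr_wpDl.
  have e : 2 * (- b / (q + 1)) * b + (- b / (q + 1)) ^+ 2 * q =
     - (b ^+ 2 * (q + 2) / (q + 1) ^+ 2) by field; rewrite gt_eqF.
  rewrite e oppr_ge0 in h.
  have : b ^+ 2 * (q + 2) <= 0.
    by move: h; rewrite pmulr_lle0 // invr_gt0 exprn_gt0.
  rewrite pmulr_lle0; last by rewrite /q in q1 *; lra.
  by move=> h2; apply/eqP; rewrite -sqrf_eq0 eq_le h2 sqr_ge0.
have AxT : A *m x^T = 0.
  apply/matrixP => i j; rewrite [j]ord1 [RHS]mxE.
  have := bx (delta_mx 0 i); rewrite /bilin -mulmxA -rowE => <-.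
  by rewrite [RHS]mxE.
have uA : A \in unitmx by rewrite unitmxE unitfE.
by rewrite -[x]trmxK -[x^T](mulKmx uA) AxT mulmx0 trmx0.
Qed.

(** Cauchy-Schwarz for the form A: with w = e_i A^-1, the pairing of w with x is the coordinate
    x_i. *)
Lemma posdef_coord : posdef A -> \det A != 0 ->
  forall i, exists2 c : R, 0 < c & forall x : 'rV[R]_d, c * x 0 i ^+ 2 <= qf A x.
Proof.
move=> pA dA i; have uA : A \in unitmx by rewrite unitmxE unitfE.
pose w : 'rV[R]_d := delta_mx 0 i *m invmx A.
have bw x : bilin w x = x 0 i.
  by rewrite /bilin /w mulmxKV // -rowE !mxE.
have w0 : w != 0.
  apply/eqP => w0; have := bw (delta_mx 0 i); rewrite w0 /bilin !mul0mx !mxE !eqxx.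
  by move/eqP; rewrite eq_sym oner_eq0.
have qw := pA _ w0; exists (qf A w)^-1; first by rewrite invr_gt0.
move=> x; have : 0 <= qf A (x + (- x 0 i / qf A w) *: w).
  case: (eqVneq (x + (- x 0 i / qf A w) *: w) 0) => [->|/pA/ltW //].
  by rewrite /qf !mul0mx mxE.
rewrite qf_lin bw => h.
have e : 2 * (- x 0 i / qf A w) * x 0 i + (- x 0 i / qf A w) ^+ 2 * qf A w =
   - ((qf A w)^-1 * x 0 i ^+ 2) by field; rewrite gt_eqF.
lra.
Qed.

End PosDef.

(** * The Hessian of the objective and its determinant *)

Section Hessian.
Variables (R : realType) (X : finType) (l r : nat).
Hypotheses (hl : (0 < l)%N) (hr : (0 < r)%N).
Notation Xr := {ffun 'I_r -> X}.
Variables (S : {set Xr}) (y0 : Xr).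
Hypothesis Sy0 : y0 \in S.
Notation d := #|S :\ y0|.
Definition supp_enum (i : 'I_d) : Xr := enum_val i.
Notation yy := supp_enum.

Lemma big_supp (U : nmodType) (F : Xr -> U) :
  \sum_(y in S) F y = F y0 + \sum_(i < d) F (yy i).
Proof. by rewrite (big_setD1 y0) //= big_enum_val. Qed.

Variables (mu : {ffun Xr -> R}).
Hypotheses (mu_supp : forall y, y \notin S -> mu y = 0)
  (mu_gt0 : forall y, y \in S -> 0 < mu y) (mu1 : \sum_y mu y = 1).

Lemma sum_supp (U : nmodType) (F : Xr -> U) : (forall y, y \notin S -> F y = 0) ->
  \sum_y F y = F y0 + \sum_(i < d) F (yy i).
Proof.
move=> F0; rewrite -big_supp [LHS](bigID (mem S)) /= [X in _ + X]big1 ?addr0 //.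
Qed.

(** Left-hand side of the marginal constraint, with the occurrences of z in y counted by [typ]; see
    [marg_sum]. *)
Definition marg (q : Xr -> R) (z : X) : R := r%:R^-1 * \sum_y q y * (typ y z)%:R.

(* The direction in the simplex with coordinates v along S :\ y0; the
   coordinate at y0 is minus their sum. *)
Definition tang (v : 'rV[R]_d) (y : Xr) : R :=
  \sum_(i < d) v 0 i * (((yy i == y)%:R : R) - (y0 == y)%:R).

Lemma yyS i : yy i \in S.
Proof. by have := enum_valP i; rewrite !inE => /andP[]. Qed.

Lemma yyN0 i : y0 == yy i = false.
Proof. by have := enum_valP i; rewrite !inE eq_sym => /andP[/negPf]. Qed.

Lemma yyE i j : (yy i == yy j) = (i == j).
Proof. by apply/eqP/eqP => [/enum_val_inj|->]. Qed.

Lemma tang_yy v i : tang v (yy i) = v 0 i.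
Proof.
rewrite /tang (bigD1 i) //= eqxx yyN0 subr0 mulr1 big1 ?addr0 // => j /negPf ji.
by rewrite yyE ji subrr mulr0.
Qed.

Lemma tang_y0 v : tang v y0 = - \sum_i v 0 i.
Proof.
rewrite /tang -sumrN; apply: eq_bigr => i _.
by rewrite [yy i == y0]eq_sym yyN0 eqxx sub0r mulrN1.
Qed.

Lemma tang_supp v y : y \notin S -> tang v y = 0.
Proof.
move=> yS; rewrite /tang big1 // => i _.
have -> : (yy i == y) = false by apply: contraNF yS => /eqP <-; exact: yyS.
have -> : (y0 == y) = false by apply: contraNF yS => /eqP <-.
by rewrite subrr mulr0.
Qed.

Lemma sum_tang v : \sum_y tang v y = 0.
Proof.
rewrite sum_supp; last exact: tang_supp.
rewrite tang_y0 [X in _ + X](eq_bigr (fun i => v 0 i)) ?addNr // => i _.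
exact: tang_yy.
Qed.

Definition nuM : {ffun X -> R} := [ffun z => marg mu z].
Hypothesis nu_gt0 : forall z, 0 < nuM z.

(** Second derivative at mu of the negative entropy in the coordinates along [S :\ y0]; the constant
    term comes from the eliminated coordinate. *)
Definition hess0 : 'M[R]_d :=
  \matrix_(i, j) ((i == j)%:R / mu (yy i) + (mu y0)^-1).

(** Jacobian of the marginal map in the same coordinates. *)
Definition hessU : 'M[R]_(#|X|, d) :=
  \matrix_(z, i) (r%:R^-1 * ((typ (yy i) (enum_val z))%:R - (typ y0 (enum_val z))%:R)).

(* Minus r / l times the second derivative of the objective, the part
   coming from the entropy of nu being expressed through the matrix C. *)
Definition hess : 'M[R]_d := hess0 - hessU^T *m C_mx l r nuM *m hessU.

Lemma tr_hess : hess^T = hess.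
Proof.
have e0 : hess0^T = hess0.
  by apply/matrixP => i j; rewrite !mxE eq_sym; case: eqP => [->|] //; rewrite !mul0r.
have eC : (C_mx l r nuM)^T = C_mx l r nuM.
  by apply/matrixP => i j; rewrite !mxE eq_sym; case: eqP => [->|].
by rewrite /hess linearB /= !trmx_mul trmxK mulmxA e0 eC.
Qed.

Lemma marg_tang v z :
  marg (tang v) (enum_val z) = (hessU *m v^T) z 0.
Proof.
rewrite /marg sum_supp => [|y yS]; last by rewrite tang_supp ?mul0r.
rewrite tang_y0 mxE mulNr mulr_suml -sumrN -big_split mulr_sumr /=.
by apply: eq_bigr => i _; rewrite tang_yy !mxE; ring.
Qed.

Lemma qf_hess v : qf hess v =
  \sum_(y in S) tang v y ^+ 2 / mu y
  - r%:R * (l%:R - 1) / l%:R * \sum_z marg (tang v) z ^+ 2 / nuM z.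
Proof.
rewrite /qf /hess mulmxBr mulmxBl [LHS]mxE [X in _ + X]mxE; congr (_ - _).
  rewrite !mxE big_supp tang_y0; under [X in _ = _ + X]eq_bigr do rewrite tang_yy.
  transitivity (\sum_j (v 0 j ^+ 2 / mu (yy j) + (\sum_i v 0 i) * v 0 j / mu y0)).
    apply: eq_bigr => j _; rewrite !mxE mulr_suml.
    under eq_bigr do rewrite !mxE mulrDr mulrDl.
    rewrite big_split /=; congr (_ + _).
      rewrite (bigD1 j) //= eqxx big1 ?addr0 => [|i /negPf ->]; first by rewrite [true%:R]mulr1n; ring.
      by rewrite mul0r mulr0 mul0r.
    by rewrite -mulr_suml -mulr_suml; ring.
  by rewrite big_split /= addrC sqrrN expr2 -!mulr_suml -mulr_sumr.
have -> : v *m (hessU^T *m C_mx l r nuM *m hessU) *m v^T =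
   (hessU *m v^T)^T *m (C_mx l r nuM) *m (hessU *m v^T).
  by rewrite trmx_mul trmxK !mulmxA.
rewrite mxE mulr_sumr (reindex (fun i : 'I_#|X| => enum_val i)) /=; last first.
  exact/onW_bij/enum_val_bij.
apply: eq_bigr => z _; rewrite marg_tang.
rewrite mxE (bigD1 z) //= big1 => [|k /negPf kz]; last first.
  by rewrite [C_mx _ _ _ _ _]mxE (inj_eq enum_val_inj) kz mulr0.
rewrite addr0 [C_mx _ _ _ _ _]mxE eqxx [_^T _ _]mxE; field.
by rewrite pnatr_eq0 -lt0n hl gt_eqF.
Qed.

(** Covariance matrix, under mu, of the indicators of the points [yy i]. *)
Definition cov0 : 'M[R]_d :=
  \matrix_(i, j) ((i == j)%:R * mu (yy i) - mu (yy i) * mu (yy j)).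

Lemma sum_mu_yy : \sum_(i < d) mu (yy i) = 1 - mu y0.
Proof. by have := sum_supp mu_supp; rewrite mu1 => ->; rewrite [mu y0 + _]addrC addrK. Qed.

Lemma hess0_cov0 : cov0 *m hess0 = 1%:M.
Proof.
have m0 : mu y0 != 0 by rewrite gt_eqF // mu_gt0.
apply/matrixP => i j; rewrite !mxE.
have mi k : mu (yy k) != 0 by rewrite gt_eqF // mu_gt0 // yyS.
transitivity (\sum_k ((i == k)%:R * (mu (yy i) * ((k == j)%:R / mu (yy k) + (mu y0)^-1))
   - mu (yy i) * ((k == j)%:R + mu (yy k) / mu y0))).
  by apply: eq_bigr => k _; rewrite !mxE; field; rewrite m0 mi.
rewrite sumrB (bigD1 i) //= eqxx big1 ?addr0 => [|k]; last first.
  by rewrite eq_sym => /negPf ->; rewrite mul0r.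
rewrite -mulr_sumr big_split /= -mulr_suml sum_mu_yy.
rewrite (bigD1 j) //= eqxx big1 ?addr0 => [|k /negPf -> //].
by case: (i == j); rewrite /=; field; rewrite m0 mi.
Qed.

(** [hess0] is a diagonal matrix times a rank-one perturbation of the identity, whose determinant
    [det_1subM] reduces to size 1. *)
Lemma det_hess0 : \det hess0 * (mu y0 * \prod_(i < d) mu (yy i)) = 1.
Proof.
have m0 : mu y0 != 0 by rewrite gt_eqF // mu_gt0.
have mi k : mu (yy k) != 0 by rewrite gt_eqF // mu_gt0 // yyS.
pose D : 'rV[R]_d := \row_i (mu (yy i))^-1.
pose N : 'rV[R]_d := \row_i 1.
pose M : 'cV[R]_d := \col_i (- (mu (yy i) / mu y0)).
have -> : hess0 = diag_mx D *m (1%:M - M *m N).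
  apply/matrixP => i j; rewrite mul_diag_mx !mxE big_ord1 !mxE mulr1 opprK.
  by field; rewrite m0 mi.
rewrite det_mulmx det_diag det_1subM.
have -> : 1%:M - N *m M = ((mu y0)^-1)%:M.
  apply/matrixP => i j; rewrite !mxE [i]ord1 [j]ord1 eqxx !mulr1n.
  under eq_bigr do rewrite !mxE mul1r.
  by rewrite sumrN -mulr_suml sum_mu_yy opprK; field.
rewrite det_scalar1; under eq_bigr do rewrite mxE.
rewrite prodfV; field; rewrite m0 /=; apply/prodf_neq0 => i _; exact: mi.
Qed.

(** Both sides are the covariance matrix, under mu, of the letter frequencies of y: V' holds the
    second moments, V the products of the means. *)
Lemma cov_hessU :
  hessU *m cov0 *m hessU^T = V'_mx mu - V_mx nuM.
Proof.
apply/matrixP => z z'; rewrite !mxE.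
set x := enum_val z; set x' := enum_val z'.
pose a (y : Xr) : R := (typ y x)%:R; pose b (y : Xr) : R := (typ y x')%:R.
have r0 : r%:R != 0 :> R by rewrite pnatr_eq0 -lt0n.
transitivity ((r%:R ^+ 2)^-1 * (\sum_y mu y * (a y * b y) - (\sum_y mu y * a y) * \sum_y mu y * b y)).
  have mE (F : Xr -> R) : \sum_y mu y * F y = F y0 + \sum_i mu (yy i) * (F (yy i) - F y0).
    rewrite sum_supp => [|y yS]; last by rewrite mu_supp ?mul0r.
    under [in RHS]eq_bigr do rewrite mulrBr.
    by rewrite sumrB -mulr_suml sum_mu_yy; ring.
  rewrite !mE; set Sa := \sum_i mu _ * (a _ - _); set Sb := \sum_i mu _ * (b _ - _).
  transitivity ((r%:R ^+ 2)^-1 * (\sum_i mu (yy i) * ((a (yy i) - a y0) * (b (yy i) - b y0)) - Sa * Sb)).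
    under eq_bigr do rewrite !mxE mulr_suml.
    transitivity (\sum_j ((r%:R ^+ 2)^-1 * (mu (yy j) * ((a (yy j) - a y0) * (b (yy j) - b y0))) -
       (r%:R ^+ 2)^-1 * (Sa * (mu (yy j) * (b (yy j) - b y0))))).
      apply: eq_bigr => j _.
      transitivity (\sum_i ((i == j)%:R * ((r%:R ^+ 2)^-1 * (mu (yy i) * ((a (yy i) - a y0) * (b (yy j) - b y0)))) -
         (r%:R ^+ 2)^-1 * (mu (yy i) * (a (yy i) - a y0)) * (mu (yy j) * (b (yy j) - b y0)))).
        by apply: eq_bigr => i _; rewrite !mxE -/x -/x' -/(a _) -/(a _) -/(b _) -/(b _); field.
      rewrite sumrB (bigD1 j) //= eqxx mul1r big1 ?addr0 => [|i /negPf ->]; last by rewrite mul0r.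
      by rewrite -mulr_suml -mulr_sumr -/Sa -mulrA.
    by rewrite sumrB -!mulr_sumr mulrBr.
  congr (_ * _).
  have -> : \sum_i mu (yy i) * ((a (yy i) - a y0) * (b (yy i) - b y0)) =
     \sum_i mu (yy i) * (a (yy i) * b (yy i) - a y0 * b y0) - a y0 * Sb - b y0 * Sa.
    by rewrite /Sa /Sb !mulr_sumr -!sumrB; apply: eq_bigr => i _; ring.
  ring.
rewrite mulrBr; congr (_ - _); last first.
  by rewrite !ffunE /marg -/x -/x'; field.
congr (_ * _).
transitivity (\sum_k \sum_k' \sum_y mu y * ((y k == x)%:R * (y k' == x')%:R)); last first.
  apply: eq_bigr => k _; apply: eq_bigr => k' _; rewrite [RHS]big_mkcond.
  by apply: eq_bigr => y _; case: (y k == x); case: (y k' == x'); rewrite /= ?mulr1 ?mulr0.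
under [RHS]eq_bigr do rewrite exchange_big.
rewrite [RHS]exchange_big /=; apply: eq_bigr => y _.
rewrite /a /b !ffunE !natr_sum mulr_suml mulr_sumr.
by apply: eq_bigr => k _; rewrite !mulr_sumr.
Qed.

(** Factoring [hess0] out leaves 1 - (cov0 U^T)(C U), where U stands for [hessU]; exchanging the two
    factors by [det_1subM] produces [cov_hessU]. *)
Lemma det_hess :
  \det hess * (mu y0 * \prod_(i < d) mu (yy i)) =
  \det (1%:M - C_mx l r nuM *m (V'_mx mu - V_mx nuM)).
Proof.
rewrite -cov_hessU.
have -> : hess = hess0 *m (1%:M - cov0 *m hessU^T *m C_mx l r nuM *m hessU).
  rewrite mulmxBr mulmx1 /hess; congr (_ - _).
  by rewrite !mulmxA (mulmx1C hess0_cov0) mul1mx.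
rewrite det_mulmx mulrAC det_hess0 mul1r.
by rewrite -[_ *m C_mx _ _ _ *m _]mulmxA det_1subM !mulmxA.
Qed.

End Hessian.

Lemma continuous_bigsum (R : realType) (T : topologicalType) (I : Type)
    (s : seq I) (F : I -> T -> R) : (forall i, continuous (F i)) ->
  continuous (fun x => \sum_(i <- s) F i x).
Proof.
move=> cF; elim: s => [|i s IH].
  rewrite (_ : (fun _ => _) = fun=> 0); first by move=> x; exact: cvg_cst.
  by apply/funext => x; rewrite big_nil.
rewrite (_ : (fun _ => _) = fun x => F i x + \sum_(j <- s) F j x).
  by move=> x; apply: cvgD; [exact: cF | exact: IH].
by apply/funext => x; rewrite big_cons.
Qed.

Lemma continuous_addf (R : realType) (T : topologicalType) (F G : T -> R) :
  continuous F -> continuous G -> continuous (fun x => F x + G x).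
Proof. by move=> cF cG x; apply: cvgD; [exact: cF | exact: cG]. Qed.

Lemma continuous_mulf (R : realType) (T : topologicalType) (F G : T -> R) :
  continuous F -> continuous G -> continuous (fun x => F x * G x).
Proof. by move=> cF cG x; apply: cvgM; [exact: cF | exact: cG]. Qed.

Lemma continuous_oppf (R : realType) (T : topologicalType) (F : T -> R) :
  continuous F -> continuous (fun x => - F x).
Proof. by move=> cF x; apply: cvgN; exact: cF. Qed.

Lemma continuous_normf (R : realType) (T : topologicalType) (F : T -> R) :
  continuous F -> continuous (fun x => `|F x|).
Proof. by move=> cF x; apply: cvg_norm; exact: cF. Qed.

Lemma continuous_compf (R : realType) (T : topologicalType) (g : R -> R) (F : T -> R) :
  continuous g -> continuous F -> continuous (fun x => g (F x)).
Proof. by move=> cg cF x; apply: continuous_comp; [exact: cF | exact: cg]. Qed.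

(** First and second order conditions at a maximum, for a function known only through an expansion
    with cubic error. A nonzero a, or else a negative b, would dominate for small t. *)
Lemma taylor2_nonpos (R : realType) (a b K t0 : R) : 0 < t0 -> 0 <= K ->
  (forall t, `|t| <= t0 -> t * a - t ^+ 2 * b <= K * `|t| ^+ 3) ->
  a = 0 /\ 0 <= b.
Proof.
move=> t00 K0 h.
have a0 (a' : R) : (forall t, 0 <= t -> t <= t0 -> t * a' - t ^+ 2 * b <= K * t ^+ 3) -> a' <= 0.
  move=> h'; rewrite leNgt; apply/negP => a'0.
  pose c := `|b| + K * t0 + 1; have c0 : 0 < c by rewrite /c ltr_wpDl // addr_ge0 // mulr_ge0 // ltW.
  pose t := Num.min t0 (a' / (2 * c)).
  have t1 : 0 < t by rewrite lt_min t00 divr_gt0 // mulr_gt0.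
  have tt0 : t <= t0 by rewrite ge_min lexx.
  have ta : t * (2 * c) <= a' by rewrite -ler_pdivlMr ?mulr_gt0 // ge_min lexx orbT.
  have := h' t (ltW t1) tt0.
  have -> : t * a' - t ^+ 2 * b = t * (a' - t * b) by ring.
  have -> : K * t ^+ 3 = t * (K * t * t) by ring.
  rewrite ler_pM2l // => h2.
  have : t * b <= t * `|b| by rewrite ler_pM2l // ler_norm.
  have : K * t * t <= K * t0 * t by rewrite ler_wpM2r ?(ltW t1) // ler_wpM2l.
  rewrite /c in ta; lra.
have aE : a = 0.
  apply/le_anti/andP; split.
    by apply: a0 => t t1 tt; have := h t; rewrite !ger0_norm //; apply.
  rewrite -oppr_le0; apply: a0 => t t1 tt.
  have := h (- t); rewrite normrN !ger0_norm // => /(_ tt).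
  by rewrite sqrrN; lra.
split=> //; rewrite -oppr_le0 leNgt; apply/negP => b0.
pose t := Num.min t0 (- b / (2 * (K + 1))).
have K1 : 0 < K + 1 by lra.
have t1 : 0 < t by rewrite lt_min t00 divr_gt0 // mulr_gt0.
have tt0 : t <= t0 by rewrite ge_min lexx.
have tb : t * (2 * (K + 1)) <= - b by rewrite -ler_pdivlMr ?mulr_gt0 // ge_min lexx orbT.
have := h t; rewrite (gtr0_norm t1) aE mulr0 sub0r => /(_ tt0).
have -> : - (t ^+ 2 * b) = t ^+ 2 * (- b) by ring.
have -> : K * t ^+ 3 = t ^+ 2 * (K * t) by ring.
rewrite ler_pM2l ?exprn_gt0 // => h2; nra.
Qed.

(** * The objective on the simplex and its maximizer *)

Section Objective.
Variables (R : realType) (X : finType) (l r : nat).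
Hypotheses (hl : (0 < l)%N) (hr : (0 < r)%N).
Notation Xr := {ffun 'I_r -> X}.
Variable f : Xr -> R.
Hypothesis f_ge0 : forall y, 0 <= f y.

Let S : {set Xr} := [set y | 0 < f y]%SET.

(** The objective as a real function of q alone, since the constraint determines nu. It agrees with
    [objective] when q vanishes off S. *)
Definition obj (q : Xr -> R) : R :=
  l%:R / r%:R * (\sum_y q y * ln (f y) - \sum_y xlnx (q y))
  + (l%:R - 1) * \sum_z xlnx (marg q z).

Let r0 : r%:R != 0 :> R. Proof. by rewrite pnatr_eq0 -lt0n. Qed.

Lemma f_supp0 y : y \notin S -> f y = 0.
Proof. by rewrite inE -leNgt => fy; apply/le_anti; rewrite fy f_ge0. Qed.

Lemma marg_sum (q : Xr -> R) z :
  r%:R^-1 * \sum_(i < r) \sum_(y : Xr | y i == z) q y = marg q z.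
Proof.
rewrite /marg; congr (_ * _).
under eq_bigr do rewrite big_mkcond.
rewrite exchange_big /=; apply: eq_bigr => y _.
rewrite ffunE natr_sum mulr_sumr; apply: eq_bigr => i _.
by case: (y i == z); rewrite ?mulr1 ?mulr0.
Qed.

Lemma sum_marg (q : Xr -> R) : \sum_z marg q z = \sum_y q y.
Proof.
rewrite -mulr_sumr exchange_big mulr_sumr /=; apply: eq_bigr => y _.
by rewrite -mulr_sumr -natr_sum sum_typ card_ord mulrCA mulVf ?mulr1.
Qed.

Lemma marg_ge0 (q : Xr -> R) z : (forall y, 0 <= q y) -> 0 <= marg q z.
Proof.
move=> q0; rewrite /marg mulr_ge0 ?invr_ge0 // sumr_ge0 // => y _.
exact: mulr_ge0.
Qed.

Lemma eq_marg (q q' : Xr -> R) : q =1 q' -> marg q =1 marg q'.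
Proof. by move=> e z; congr (_ * _); apply: eq_bigr => y _; rewrite e. Qed.

Lemma margD (q q' : Xr -> R) (a : R) z :
  marg (fun y => q y + a * q' y) z = marg q z + a * marg q' z.
Proof.
rewrite /marg [a * _]mulrCA -mulrDr; congr (_ * _).
rewrite mulr_sumr -big_split; apply: eq_bigr => y _ /=.
by rewrite mulrDl mulrA.
Qed.

Lemma feasible_marg (q : {ffun Xr -> R}) : is_dist q ->
  feasible ([ffun z => marg q z], q).
Proof.
move=> dq; split => //=; last by move=> z; rewrite ffunE marg_sum.
case: dq => q0 q1; split; first by move=> z; rewrite ffunE marg_ge0.
by rewrite -q1 -sum_marg; apply: eq_bigr => z _; rewrite ffunE.
Qed.

Lemma feasible_fst (p : {ffun X -> R} * {ffun Xr -> R}) : feasible p ->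
  p.1 = [ffun z => marg p.2 z].
Proof. by case=> _ _ h; apply/ffunP => z; rewrite ffunE -h marg_sum. Qed.

Lemma eq_obj (q q' : Xr -> R) : q =1 q' -> obj q = obj q'.
Proof.
move=> e; rewrite /obj; congr (_ * (_ - _) + _ * _); apply: eq_bigr => y _;
  by rewrite ?e ?(eq_marg e).
Qed.

Lemma objective_obj (q : {ffun Xr -> R}) : (forall y, y \notin S -> q y = 0) ->
  objective l f ([ffun z => marg q z], q) = (obj q)%:E.
Proof.
move=> qS; rewrite /objective /=.
have -> : (\sum_y (q y)%:E * lne (f y)%:E = (\sum_y q y * ln (f y))%:E)%E.
  rewrite -sumEFin; apply: eq_bigr => y _.
  have [yS|yS] := boolP (y \in S); last by rewrite qS // mul0e mul0r.
  by rewrite lne_EFin //; rewrite inE in yS.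
rewrite -EFinM -EFinD; congr (_%:E); rewrite /obj /entropy /xlnx.
under [\sum_x [ffun z => marg q z] x * _]eq_bigr do rewrite ffunE.
by ring.
Qed.

Variables (nu : {ffun X -> R}) (mu : {ffun Xr -> R}).
Hypotheses (hmax : maximizer l f (nu, mu))
  (huniq : forall q, maximizer l f q -> q = (nu, mu))
  (nu_gt0 : forall x, 0 < nu x).
Variable y0 : Xr.
Hypothesis Sy0 : y0 \in S.

Lemma nu_marg : nu = [ffun z => marg mu z].
Proof. by have [/feasible_fst] := hmax. Qed.

Lemma mu_dist : is_dist mu.
Proof. by have [[]] := hmax. Qed.

(** Mass off the support makes the objective -oo, whereas the point mass at y0 has a finite
    value. *)
Lemma maximizer_supp y : y \notin S -> mu y = 0.
Proof.
move=> yS; have [mu0 _] := mu_dist.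
apply/eqP; case: (ltgtP (mu y) 0) (mu0 y) => // muy _; exfalso.
pose q : {ffun Xr -> R} := [ffun y' => (y' == y0)%:R].
have dq : is_dist q.
  split; first by move=> y'; rewrite ffunE.
  rewrite (bigD1 y0) //= ffunE eqxx big1 ?addr0 // => y' /negPf h.
  by rewrite ffunE h.
have qS y' : y' \notin S -> q y' = 0.
  by move=> y'S; rewrite ffunE; case: eqP => // e; rewrite e Sy0 in y'S.
have := hmax.2 _ (feasible_marg dq); rewrite objective_obj //.
rewrite /objective (bigD1 y) // -[(nu, mu).2]/mu.
rewrite f_supp0 // [lne _]le0_lneNy ?lexx //.
rewrite gt0_muleNy ?lte_fin // /= addNye gt0_muleNy ?addeNy ?leeNy_eq //.
by rewrite lte_fin divr_gt0 // ltr0n.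
Qed.

Lemma obj_max (q : {ffun Xr -> R}) : is_dist q ->
  (forall y, y \notin S -> q y = 0) -> obj q <= obj mu.
Proof.
move=> dq qS; rewrite -lee_fin -!objective_obj //; last exact: maximizer_supp.
by rewrite -nu_marg; apply: hmax.2; exact: feasible_marg.
Qed.

Lemma objective_mu : objective l f (nu, mu) = (obj mu)%:E.
Proof. by rewrite nu_marg objective_obj //; exact: maximizer_supp. Qed.

Lemma obj_uniq (q : {ffun Xr -> R}) : is_dist q ->
  (forall y, y \notin S -> q y = 0) -> obj q = obj mu -> q = mu.
Proof.
move=> dq qS e.
have /huniq[] // : maximizer l f ([ffun z => marg q z], q).
split; first exact: feasible_marg.
by move=> p fp; rewrite objective_obj // e -objective_mu; exact: hmax.2.
Qed.

(* The entropy of the hyperedge measure has infinite slope at the boundary of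
   the simplex, so the maximizer charges all of the support of f. *)
Lemma maximizer_gt0 y : y \in S -> 0 < mu y.
Proof.
move=> yS; have [mu0 mu1] := mu_dist.
rewrite lt_neqAle mu0 andbT eq_sym; apply/negP => /eqP muy.
pose Ld := \sum_y' mu y' * ln (f y'); pose H := \sum_y' xlnx (mu y').
pose e (y' : Xr) : R := (y' == y)%:R.
(* Moving mass t towards y changes the objective by at least t (C - (l / r) ln t). The t below makes
   the bracket at least l / r > 0, contradicting maximality. *)
pose C := l%:R / r%:R * (ln (f y) - Ld + H)
  + (l%:R - 1) * \sum_z (ln (nu z) + 1) * (marg e z - nu z).
have lr0 : 0 < l%:R / r%:R :> R by rewrite divr_gt0 // ltr0n.
pose t := Num.min 2^-1 (expR (C / (l%:R / r%:R) - 1)).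
have t0 : 0 < t by rewrite lt_min invr_gt0 ltr0n expR_gt0.
have t1 : t <= 2^-1 by rewrite ge_min lexx.
have lt : ln t <= C / (l%:R / r%:R) - 1.
  by rewrite -[leRHS]expRK ler_ln ?posrE ?expR_gt0 // ge_min lexx orbT.
pose q : {ffun Xr -> R} := [ffun y' => (1 - t) * mu y' + t * e y'].
have e1 (F : Xr -> R) : \sum_y' e y' * F y' = F y.
  rewrite (bigD1 y) //= /e eqxx mul1r big1 ?addr0 // => y' /negPf ->.
  by rewrite mul0r.
have dq : is_dist q.
  split; first by move=> y'; rewrite ffunE addr_ge0 ?mulr_ge0 //; lra.
  under eq_bigr do rewrite ffunE -[e _]mulr1.
  by rewrite big_split /= -!mulr_sumr mu1 e1; ring.
have qS y' : y' \notin S -> q y' = 0.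
  move=> y'S; rewrite ffunE maximizer_supp // /e.
  by case: eqP => [ey|_]; [rewrite -ey (negPf y'S) in yS | rewrite mulr0n !mulr0 addr0].
have := obj_max dq qS.
have A1 : \sum_y' q y' * ln (f y') = (1 - t) * Ld + t * ln (f y).
  rewrite -[in RHS](e1 (fun y' => ln (f y'))) !mulr_sumr -big_split.
  by apply: eq_bigr => y' _; rewrite ffunE /=; ring.
have A2 : \sum_y' xlnx (q y') <= (1 - t) * H + xlnx t.
  rewrite /H (bigD1 y) //= [X in _ <= _ * X + _](bigD1 y) //=.
  rewrite muy xlnx0 add0r ffunE muy mulr0 add0r /e eqxx mulr1 addrC lerD2r.
  rewrite mulr_sumr; apply: ler_sum => y' /negPf y'y; rewrite ffunE /e y'y mulr0 addr0.
  rewrite xlnxM //; last by lra.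
  have : xlnx (1 - t) <= 0.
    by rewrite /xlnx mulr_ge0_le0 ?ln_le0 //; lra.
  by move/(ler_wpM2l (mu0 y')); rewrite mulr0; lra.
have mq z : marg q z = nu z + t * (marg e z - nu z).
  rewrite [nu in RHS]nu_marg ffunE.
  rewrite (@eq_marg _ (fun y' => (mu y' + t * (e y' + (-1) * mu y')))); last first.
    by move=> y'; rewrite ffunE; ring.
  by rewrite margD margD; ring.
have A3 : \sum_z xlnx (nu z) + t * \sum_z (ln (nu z) + 1) * (marg e z - nu z)
    <= \sum_z xlnx (marg q z).
  rewrite mulr_sumr -big_split /=; apply: ler_sum => z _.
  have : 0 <= marg q z by apply: marg_ge0 => y'; have [] := dq.
  move/(xlnx_convex (nu_gt0 z)); rewrite mq.
  have -> : nu z + t * (marg e z - nu z) - nu z = t * (marg e z - nu z) by ring.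
  lra.
have N3 : \sum_z xlnx (marg mu z) = \sum_z xlnx (nu z).
  by apply: eq_bigr => z _; rewrite nu_marg ffunE.
rewrite /obj A1 N3 -/Ld -/H; set Q3 := \sum_z xlnx (marg q z) in A3 *.
set Q2 := \sum_y' xlnx (q y') in A2 *.
pose D := \sum_z (ln (nu z) + 1) * (marg e z - nu z); rewrite -/D in A3.
have CE : C = l%:R / r%:R * (ln (f y) - Ld + H) + (l%:R - 1) * D by [].
set N := \sum_z xlnx (nu z) in A3 *.
have l1 : 0 <= l%:R - 1 :> R by rewrite subr_ge0 ler1n.
have B2 := ler_wpM2l (ltW lr0) A2; have B3 := ler_wpM2l l1 A3.
have lnt : t * (l%:R / r%:R * ln t) <= t * (C - l%:R / r%:R).
  by rewrite ler_pM2l // mulrC -ler_pdivlMr // mulrBl divff ?gt_eqF.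
have ta := mulr_gt0 t0 lr0; rewrite CE in lnt; rewrite /xlnx -/H in B2.
move: lnt ta lr0 B2 B3; set a := l%:R / r%:R.
move: (ln t) (ln (f y)) => u w lnt ta lr0 B2 B3.
lra.
Qed.

Notation d := #|S :\ y0|.
Notation yy := (@supp_enum X r S y0).
Notation hessM := (@hess R X l r S y0 mu).
Implicit Types v : 'rV[R]_d.

Let mu1 : \sum_y mu y = 1. Proof. by have [] := mu_dist. Qed.
Let nuM_gt0 z : 0 < nuM mu z. Proof. by rewrite /nuM -nu_marg. Qed.

Lemma finite_pos (I : finType) (P : I -> R -> Prop) :
  (forall i c c', P i c -> 0 < c' -> c' <= c -> P i c') ->
  (forall i, exists2 c, 0 < c & P i c) -> exists2 c, 0 < c & forall i, P i c.
Proof.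
move=> mono ex; have /boolp.choice[g hg] : forall i, exists c, 0 < c /\ P i c.
  by move=> i; have [c] := ex i; exists c.
exists (\big[Num.min/1]_i g i).
  by apply: (big_ind (fun x => 0 < x)) => // [x y x0 y0'|i _]; [rewrite lt_min x0 | have [] := hg i].
move=> i; have [g0 gP] := hg i; apply: (mono _ _ _ gP).
  by apply: (big_ind (fun x => 0 < x)) => // [x y x0 y0'|j _]; [rewrite lt_min x0 | have [] := hg j].
by rewrite (bigD1 i) //= ge_min lexx.
Qed.

(** First derivative of [obj] at mu in the direction [tang v]. *)
Definition lin (v : 'rV[R]_d) : R :=
  l%:R / r%:R * \sum_y tang v y * (ln (f y) - ln (mu y) - 1)
  + (l%:R - 1) * \sum_z marg (tang v) z * (ln (nu z) + 1).

Definition perturb (v : 'rV[R]_d) (y : Xr) : R := mu y + tang v y.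

Lemma tang_bound (v : 'rV[R]_d) D y : (forall i, `|v 0 i| <= D) ->
  `|tang v y| <= d%:R * D.
Proof.
move=> vD; apply: le_trans (ler_norm_sum _ _ _) _.
have -> : d%:R * D = \sum_(i < d) D by rewrite sumr_const card_ord mulr_natl.
apply: ler_sum => i _; rewrite normrM -[D]mulr1 ler_pM //.
by case: (yy i == y); case: (y0 == y); rewrite /= ?subrr ?subr0 ?sub0r ?normrN ?normr1 ?normr0.
Qed.

Lemma typ_le (y : Xr) z : (typ y z)%:R <= r%:R :> R.
Proof.
rewrite ler_nat -[X in (_ <= X)%N](card_ord r) -(sum_typ y) (bigD1 z) //=.
exact: leq_addr.
Qed.

Lemma marg_bound (q : Xr -> R) D z : (forall y, `|q y| <= D) ->
  `|marg q z| <= #|Xr|%:R * D.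
Proof.
move=> qD; rewrite /marg normrM normfV (@ger0_norm _ r%:R) // ler_pdivrMl ?ltr0n //.
apply: le_trans (ler_norm_sum _ _ _) _.
have -> : r%:R * (#|Xr|%:R * D) = \sum_(y : Xr) D * r%:R.
  by rewrite sumr_const -[RHS]mulr_natl; ring.
apply: ler_sum => y _; rewrite normrM ler_pM // ger0_norm //; exact: typ_le.
Qed.

(** [xlnx_expand] is applied to each coordinate of mu in S and to each nu z; t0 keeps every
    perturbation below half of the value it perturbs. *)
Lemma obj_expand : exists2 t0 : R, 0 < t0 & exists2 K : R, 0 <= K &
  forall (v : 'rV[R]_d) D, D <= t0 -> (forall i, `|v 0 i| <= D) ->
  `|obj (perturb v) - obj mu - lin v + l%:R / (2 * r%:R) * qf hessM v| <= K * D ^+ 3.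
Proof.
have [t1 t10 ht1] : exists2 t, 0 < t & forall y, y \in S -> d%:R * t <= mu y / 2.
  apply: finite_pos => [y c c' h c'0 cc' yS|y].
    by apply: le_trans (h yS); rewrite ler_wpM2l.
  exists (if y \in S then mu y / 2 / (d%:R + 1) else 1).
    by case: ifP => // yS; rewrite !divr_gt0 ?maximizer_gt0 // ltr_wpDl.
  move=> yS; rewrite yS mulrCA; apply: ler_piMr.
    by rewrite divr_ge0 // ltW // maximizer_gt0.
  by rewrite ler_pdivrMr ?ltr_wpDl // mul1r lerDl.
have [t2 t20 ht2] : exists2 t, 0 < t & forall z, #|Xr|%:R * (d%:R * t) <= nu z / 2.
  apply: finite_pos => [z c c' h c'0 cc'|z].
    by apply: le_trans h; rewrite ler_wpM2l // ler_wpM2l.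
  exists (nu z / 2 / (#|Xr|%:R * d%:R + 1)).
    by rewrite !divr_gt0 // ltr_wpDl // mulr_ge0.
  rewrite mulrA mulrCA; apply: ler_piMr; first by rewrite divr_ge0 // ltW.
  by rewrite ler_pdivrMr ?ltr_wpDl ?mulr_ge0 // mul1r lerDl.
exists (Num.min t1 t2); first by rewrite lt_min t10.
pose K1 := \sum_(y in S) 2 / mu y ^+ 2 * d%:R ^+ 3.
pose K2 := \sum_z 2 / nu z ^+ 2 * (#|Xr|%:R * d%:R) ^+ 3.
have l1 : 0 <= l%:R - 1 :> R by rewrite subr_ge0 ler1n.
have lr0 : 0 <= l%:R / r%:R :> R by rewrite divr_ge0.
exists (l%:R / r%:R * K1 + (l%:R - 1) * K2).
  apply: addr_ge0; apply: mulr_ge0 => //; apply: sumr_ge0 => ? _;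
    by rewrite mulr_ge0 ?exprn_ge0 ?mulr_ge0 ?invr_ge0 ?exprn_even_ge0.
move=> v D; rewrite le_min => /andP[Dt1 Dt2] vD.
pose del := tang v; pose B := marg del.
have delD y : `|del y| <= d%:R * D by exact: tang_bound.
have BD z : `|B z| <= #|Xr|%:R * (d%:R * D) by apply: marg_bound => y; exact: delD.
pose rho y := xlnx (mu y + del y) -
  (xlnx (mu y) + del y * (ln (mu y) + 1) + del y ^+ 2 / (2 * mu y)).
pose sig z := xlnx (nu z + B z) -
  (xlnx (nu z) + B z * (ln (nu z) + 1) + B z ^+ 2 / (2 * nu z)).
have rho0 y : y \notin S -> rho y = 0.
  move=> yS; rewrite /rho /del tang_supp // maximizer_supp // addr0 xlnx0.
  by rewrite mul0r expr0n mul0r !addr0 subrr.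
have rhoB : `|\sum_y rho y| <= K1 * D ^+ 3.
  rewrite (bigID (mem S)) /= [X in _ + X]big1 ?addr0; last by move=> y /rho0.
  apply: le_trans (ler_norm_sum _ _ _) _; rewrite /K1 mulr_suml.
  apply: ler_sum => y yS.
  have hd : `|del y| <= mu y / 2.
    by apply: le_trans (delD y) _; apply: le_trans (ht1 y yS); rewrite ler_wpM2l.
  apply: le_trans (xlnx_expand (maximizer_gt0 yS) hd) _.
  rewrite -[leRHS]mulrA -exprMn; apply: ler_wpM2l; first by rewrite divr_ge0 // sqr_ge0.
  by apply: lerXn2r; rewrite ?nnegrE // (le_trans _ (delD y)).
have sigB : `|\sum_z sig z| <= K2 * D ^+ 3.
  apply: le_trans (ler_norm_sum _ _ _) _; rewrite /K2 mulr_suml.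
  apply: ler_sum => z _.
  have hd : `|B z| <= nu z / 2.
    apply: le_trans (BD z) _; apply: le_trans (ht2 z).
    by rewrite ler_wpM2l // ler_wpM2l.
  apply: le_trans (xlnx_expand (nu_gt0 z) hd) _.
  rewrite -[leRHS]mulrA -exprMn -(mulrA #|Xr|%:R d%:R D); apply: ler_wpM2l; first by rewrite divr_ge0 // sqr_ge0.
  by apply: lerXn2r; rewrite ?nnegrE // (le_trans _ (BD z)).
have E1 : \sum_y xlnx (perturb v y) = \sum_y xlnx (mu y)
   + \sum_y del y * (ln (mu y) + 1) + (\sum_(y in S) del y ^+ 2 / mu y) / 2 + \sum_y rho y.
  have -> : (\sum_(y in S) del y ^+ 2 / mu y) / 2 = \sum_y del y ^+ 2 / (2 * mu y).
    rewrite [RHS](bigID (mem S)) /= [X in _ + X]big1 ?addr0; last first.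
      by move=> y yS; rewrite /del tang_supp // expr0n mul0r.
    rewrite mulr_suml; apply: eq_bigr => y yS.
    by field; rewrite gt_eqF ?maximizer_gt0.
  by rewrite -!big_split; apply: eq_bigr => y _; rewrite /rho /perturb -/(del y) /=; ring.
have E2 : \sum_z xlnx (marg (perturb v) z) = \sum_z xlnx (marg mu z)
   + \sum_z B z * (ln (nu z) + 1) + (\sum_z B z ^+ 2 / nuM mu z) / 2 + \sum_z sig z.
  rewrite mulr_suml -!big_split; apply: eq_bigr => z _.
  have nE : nu z = marg mu z by rewrite nu_marg ffunE.
  rewrite (@eq_marg _ (fun y => mu y + 1 * del y)); last by move=> y; rewrite mul1r.
  rewrite margD mul1r -nE -/(B z) /sig /nuM -nu_marg /=.
  by field; rewrite gt_eqF.
have E3 : \sum_y perturb v y * ln (f y) = \sum_y mu y * ln (f y) + \sum_y del y * ln (f y).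
  by rewrite -big_split; apply: eq_bigr => y _; rewrite /perturb mulrDl.
have E4 : \sum_y tang v y * (ln (f y) - ln (mu y) - 1) =
   \sum_y del y * ln (f y) - \sum_y del y * (ln (mu y) + 1).
  by rewrite -sumrB; apply: eq_bigr => y _; rewrite /del; ring.
rewrite /obj E1 E2 E3 /lin E4 (qf_hess hl Sy0 nuM_gt0).
rewrite -/del -/B; set Q1 := \sum_(y in S) _; set Q2 := \sum_z _ / _.
set s1 := \sum_y rho y in rhoB *; set s2 := \sum_z sig z in sigB *.
rewrite [X in `|X|](_ : _ = - (l%:R / r%:R * s1) + (l%:R - 1) * s2); last first.
  by field; rewrite r0 pnatr_eq0 -lt0n hl.
apply: le_trans (ler_normD _ _) _.
rewrite normrN (normrM (l%:R / r%:R)) (normrM (l%:R - 1)) (ger0_norm lr0) (ger0_norm l1).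
by rewrite [leRHS]mulrDl; apply: lerD; rewrite -[leRHS]mulrA; apply: ler_wpM2l.
Qed.


Lemma tangZ t v y : tang (t *: v) y = t * @tang R X r S y0 v y.
Proof. by rewrite mulr_sumr; apply: eq_bigr => i _; rewrite mxE mulrA. Qed.

Lemma margZ t (q : Xr -> R) z : marg (fun y => t * q y) z = t * marg q z.
Proof.
by rewrite /marg mulrCA; congr (_ * _); rewrite mulr_sumr; apply: eq_bigr => y _; rewrite mulrA.
Qed.

Lemma linZ t v : lin (t *: v) = t * lin v.
Proof.
rewrite /lin mulrDr; congr (_ + _); rewrite [RHS]mulrCA; congr (_ * _);
  rewrite mulr_sumr; apply: eq_bigr => z _; first by rewrite tangZ mulrA.
by rewrite (eq_marg (tangZ t v)) margZ -mulrA.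
Qed.

Lemma qfZ n (A : 'M[R]_n) t (v : 'rV[R]_n) : qf A (t *: v) = t ^+ 2 * qf A v.
Proof. by rewrite /qf linearZ /= -!scalemxAl -scalemxAr !mxE mulrA. Qed.

Lemma perturb_dist v : (forall y, 0 <= perturb v y) ->
  is_dist [ffun y => perturb v y] /\ (forall y, y \notin S -> [ffun y => perturb v y] y = 0).
Proof.
move=> v0; split; first split=> [y|]; first by rewrite ffunE.
  under eq_bigr do rewrite ffunE.
  by rewrite big_split /= mu1 sum_tang // addr0.
by move=> y yS; rewrite ffunE /perturb maximizer_supp // tang_supp // addr0.
Qed.

Lemma perturb_obj_le v : (forall y, 0 <= perturb v y) -> obj (perturb v) <= obj mu.
Proof.
move=> /perturb_dist[v1 v2]; have := obj_max v1 v2.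
by rewrite (@eq_obj _ (perturb v)) // => y; rewrite ffunE.
Qed.

Lemma perturb_obj_eq v : (forall y, 0 <= perturb v y) ->
  obj (perturb v) = obj mu -> v = 0.
Proof.
move=> /perturb_dist[v1 v2] e; have := obj_uniq v1 v2.
rewrite (@eq_obj _ (perturb v)) => [/(_ e)/ffunP h|y]; last by rewrite ffunE.
apply/rowP => i; have := h (yy i); rewrite ffunE /perturb tang_yy // mxE; lra.
Qed.

Lemma perturb_ge0 : exists2 t : R, 0 < t &
  forall v, (forall i, `|v 0 i| <= t) -> forall y, 0 <= perturb v y.
Proof.
have [t t0 ht] : exists2 t, 0 < t & forall y, y \in S -> d%:R * t <= mu y.
  apply: finite_pos => [y c c' h c'0 cc' yS|y].
    by apply: le_trans (h yS); rewrite ler_wpM2l.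
  exists (if y \in S then mu y / (d%:R + 1) else 1).
    by case: ifP => // yS; rewrite divr_gt0 ?maximizer_gt0 // ltr_wpDl.
  move=> yS; rewrite yS mulrCA; apply: ler_piMr.
    by rewrite ltW // maximizer_gt0.
  by rewrite ler_pdivrMr ?ltr_wpDl // mul1r lerDl.
exists t => // v hv y; rewrite /perturb.
have [yS|yS] := boolP (y \in S); last by rewrite maximizer_supp // tang_supp // addr0.
have := tang_bound y hv; rewrite ler_norml; have := ht y yS; lra.
Qed.

(** Maximality along the line t v, fed to [taylor2_nonpos]. The hypotheses for all small t come from
    rescaling by a bound V of the coordinates. *)
Lemma stationary v : lin v = 0 /\ 0 <= qf hessM v.
Proof.
have [t0 t00 [K K0 hK]] := obj_expand; have [t1 t10 ht1] := perturb_ge0.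
pose V := \sum_i `|v 0 i| + 1.
have V0 : 0 < V by rewrite ltr_wpDl // sumr_ge0.
have vV i : `|v 0 i| <= V.
  by rewrite /V (bigD1 i) //= -addrA lerDl addr_ge0 // sumr_ge0.
have lr : 0 < l%:R / (2 * r%:R) :> R by rewrite divr_gt0 ?mulr_gt0 ?ltr0n.
have [] := @taylor2_nonpos R (lin v) (l%:R / (2 * r%:R) * qf hessM v)
  (K * V ^+ 3) (Num.min t0 t1 / V).
- by rewrite divr_gt0 // lt_min t00.
- by rewrite mulr_ge0 // exprn_ge0 // ltW.
- move=> t; rewrite ler_pdivlMr // le_min => /andP[h0 h1].
  have tv i : `|(t *: v) 0 i| <= `|t| * V by rewrite mxE normrM ler_wpM2l.
  have := hK (t *: v) _ h0 tv; have := perturb_obj_le (ht1 (t *: v) (fun i => le_trans (tv i) h1)).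
  rewrite linZ qfZ ler_norml exprMn; lra.
- by move=> ->; rewrite pmulr_rge0.
Qed.

Hypothesis hdet : 0 < det_factor l (nu, mu).

Lemma det_hess_factor :
  \det hessM * (mu y0 * \prod_(i < d) mu (yy i)) = det_factor l (nu, mu).
Proof.
rewrite det_hess //; [|exact: maximizer_supp|exact: maximizer_gt0].
by rewrite /nuM -nu_marg.
Qed.

Lemma prod_mu_gt0 : 0 < mu y0 * \prod_(i < d) mu (yy i).
Proof.
rewrite mulr_gt0 ?maximizer_gt0 // prodr_gt0 // => i _.
by rewrite maximizer_gt0 // yyS.
Qed.

Lemma det_hess_gt0 : 0 < \det hessM.
Proof.
have := hdet; rewrite -det_hess_factor pmulr_lgt0 //; exact: prod_mu_gt0.
Qed.

(** Maximality alone gives semidefiniteness; the determinant hypothesis excludes a kernel. *)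
Lemma hess_posdef : posdef hessM.
Proof.
apply: posdef_psd; first exact: tr_hess.
  by move=> v; have [] := stationary v.
by rewrite gt_eqF // det_hess_gt0.
Qed.

Lemma obj_expand0 : exists2 t0 : R, 0 < t0 & exists2 K : R, 0 <= K &
  forall (v : 'rV[R]_d) D, D <= t0 -> (forall i, `|v 0 i| <= D) ->
  `|obj (perturb v) - obj mu + l%:R / (2 * r%:R) * qf hessM v| <= K * D ^+ 3.
Proof.
have [t0 t00 [K K0 hK]] := obj_expand; exists t0 => //; exists K => // v D Dt vD.
by have := hK v D Dt vD; have [-> _] := stationary v; rewrite subr0.
Qed.

Lemma perturb_continuous y : continuous (fun v : 'rV[R]_d => perturb v y).
Proof.
apply: continuous_addf; first exact: cst_continuous.
apply: continuous_bigsum => i; apply: continuous_mulf; last exact: cst_continuous.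
exact: coord_continuous.
Qed.

Lemma obj_perturb_continuous : continuous (fun v : 'rV[R]_d => obj (perturb v)).
Proof.
have cm z : continuous (fun v : 'rV[R]_d => marg (perturb v) z).
  apply: continuous_mulf; first exact: cst_continuous.
  apply: continuous_bigsum => y; apply: continuous_mulf; last exact: cst_continuous.
  exact: perturb_continuous.
apply: continuous_addf; apply: continuous_mulf; try exact: cst_continuous.
  apply: continuous_addf; last apply: continuous_oppf; apply: continuous_bigsum => y.
    by apply: continuous_mulf; [exact: perturb_continuous | exact: cst_continuous].
  by apply: continuous_compf; [exact: xlnx_continuous | exact: perturb_continuous].
apply: continuous_bigsum => z.
by apply: continuous_compf; [exact: xlnx_continuous | exact: cm].
Qed.

Lemma perturb_coord_le1 v : (forall y, 0 <= perturb v y) -> forall i, `|v 0 i| <= 1.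
Proof.
move=> v0 i; have [mu0 _] := mu_dist; have [[_ s1] _] := perturb_dist v0.
have le1 (q : Xr -> R) : (forall y, 0 <= q y) -> \sum_y q y = 1 -> q (yy i) <= 1.
  by move=> q0 <-; rewrite (bigD1 (yy i)) //= lerDl sumr_ge0.
have := le1 _ mu0 mu1; have := le1 _ v0.
under eq_bigr do rewrite -[perturb v _](ffunE (fun y => perturb v y)).
move=> /(_ s1); have := v0 (yy i); have := mu0 (yy i); rewrite /perturb tang_yy //.
rewrite ler_norml; lra.
Qed.

(* Near mu this is the expansion; away from mu the objective is bounded away
   from its maximum by compactness and uniqueness. *)
Lemma obj_quad : exists2 c : R, 0 < c & forall v, (forall y, 0 <= perturb v y) ->
  forall i, obj (perturb v) <= obj mu - c * v 0 i ^+ 2.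
Proof.
have [t0 t00 [K K0 hK]] := obj_expand0.
have dn0 : \det hessM != 0 by rewrite gt_eqF // det_hess_gt0.
have [q q0 hq] : exists2 c : R, 0 < c & forall i (v : 'rV[R]_d), c * v 0 i ^+ 2 <= qf hessM v.
  apply: finite_pos => [i c c' h c'0 cc' v|i].
    by apply: le_trans (h v); rewrite ler_wpM2r // sqr_ge0.
  by apply: (posdef_coord _ hess_posdef dn0); exact: tr_hess.
have lr : 0 < l%:R / (2 * r%:R) :> R by rewrite divr_gt0 ?mulr_gt0 ?ltr0n.
set a := l%:R / (2 * r%:R) in hK lr.
(* Below this radius the cubic error is at most half of the quadratic gain a q D^2, where D is the
   largest coordinate in absolute value. *)
pose t1 := Num.min t0 (a * q / (2 * (K + 1))).
have K1 : 0 < K + 1 by lra.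
have t10 : 0 < t1 by rewrite lt_min t00 divr_gt0 // mulr_gt0.
have loc v : (forall i, `|v 0 i| <= t1) -> forall i,
    obj (perturb v) <= obj mu - a * q / 2 * v 0 i ^+ 2.
  move=> vt i; pose j := [arg max_(k > i) `|v 0 k|]%O.
  have [k _ hk] : exists2 k, true & forall i', `|v 0 i'| <= `|v 0 k|.
    by case: (@arg_maxP _ _ _ i xpredT (fun k => `|v 0 k|) isT) => k _ hk; exists k => // i'; exact: hk.
  have kt : `|v 0 k| <= t0 by apply: le_trans (vt k) _; rewrite ge_min lexx.
  have := hK v _ kt hk; rewrite ler_norml => /andP[_ h1].
  have h2 := hq k v; have h3 := vt k.
  set D := `|v 0 k| in h1 h3 hk; have D0 : 0 <= D := normr_ge0 _.
  have vD : v 0 k ^+ 2 = D ^+ 2 by rewrite /D real_normK // num_real.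
  have viD : v 0 i ^+ 2 <= D ^+ 2.
    rewrite -[v 0 i ^+ 2]real_normK ?num_real //.
    by apply: lerXn2r; rewrite ?nnegrE //; exact: hk.
  have h4 : K * D ^+ 3 <= a * q / 2 * D ^+ 2.
    have -> : K * D ^+ 3 = K * D * D ^+ 2 by ring.
    apply: ler_wpM2r; first exact: sqr_ge0.
    have : D * (2 * (K + 1)) <= a * q.
      rewrite -ler_pdivlMr ?mulr_gt0 //; apply: le_trans h3 _.
      by rewrite ge_min lexx orbT.
    nra.
  have h5 : a * (q * D ^+ 2) <= a * qf hessM v by rewrite ler_pM2l // -vD.
  have h6 : a * q / 2 * v 0 i ^+ 2 <= a * q / 2 * D ^+ 2.
    by rewrite ler_wpM2l // divr_ge0 // mulr_ge0 // ltW.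
  lra.
have [e e0 he] : exists2 e : R, 0 < e & forall i v, (forall y, 0 <= perturb v y) ->
    t1 <= `|v 0 i| -> obj (perturb v) <= obj mu - e.
  apply: finite_pos => [i c c' h c'0 cc' v v0 vi|i].
    by have := h v v0 vi; lra.
  pose B : set 'rV[R]_d := [set v | (forall y, 0 <= perturb v y) /\ t1 <= `|v 0 i|].
  have [B0|B0] := pselect (B !=set0); last first.
    exists 1 => // v v0 vi; exfalso; apply: B0; by exists v.
  have cB : compact B.
    apply: (@subclosed_compact _ _
      [set v : 'rV[R]_d | forall i, `[-1, 1]%classic (v ord0 i)]).
    - have -> : B = (\bigcap_(y in [set: Xr]) ((fun v : 'rV[R]_d => perturb v y) @^-1` [set x | 0 <= x]))
         `&` ((fun v : 'rV[R]_d => `|v 0 i|) @^-1` [set x | t1 <= x]).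
        apply/seteqP; split => v /=; first by move=> [v0 vi]; split=> // y _; exact: v0.
        by move=> [v0 vi]; split => // y; exact: v0.
      apply: closedI.
        apply: closed_bigI => y _; apply: ((continuous_closedP (fun v : 'rV[R]_d => perturb v y)).1 _ _ (@closed_ge R 0)).
        exact: perturb_continuous.
      apply: ((continuous_closedP (fun v : 'rV[R]_d => `|v 0 i|)).1 _ _ (@closed_ge R t1)).
      by apply: continuous_normf; exact: coord_continuous.
    - by apply: (@rV_compact R^o _ (fun=> `[-1, 1]%classic)) => _; exact: segment_compact.
    - move=> v [v0 _] j; rewrite /= in_itv /= -ler_norml.
      exact: perturb_coord_le1.
  have [|w wB wmax] := compact_EVT_max B0 cB (f := fun v => obj (perturb v)).
    by apply: continuous_subspaceT; exact: obj_perturb_continuous.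
  have [w0 wi] := set_mem wB.
  exists (obj mu - obj (perturb w)).
    rewrite subr_gt0 lt_neqAle perturb_obj_le // andbT; apply/eqP => /(perturb_obj_eq w0) we.
    by move: wi; rewrite we mxE normr0 leNgt t10.
  by move=> v v0 vi; rewrite opprB addrC subrK; apply: wmax; apply/mem_set.
exists (Num.min (a * q / 2) e).
  by rewrite lt_min e0 divr_gt0 // mulr_gt0.
move=> v v0 i.
(* Far from mu the gap e is already quadratic, because admissible coordinates are at most 1 in
   absolute value. *)
have [/existsP[j vj]|] := boolP [exists j, t1 < `|v 0 j|].
  apply: le_trans (he j v v0 (ltW vj)) _; rewrite lerD2l lerN2.
  apply: (@le_trans _ _ (e * 1)); last by rewrite mulr1.
  apply: ler_pM; rewrite ?sqr_ge0 ?ge_min ?lexx ?orbT //.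
    by rewrite le_min !ltW // divr_gt0 // mulr_gt0.
  by rewrite -[v 0 i ^+ 2]real_normK ?num_real // exprn_ile1 // perturb_coord_le1.
rewrite negb_exists => /forallP h.
apply: le_trans (loc v _ i) _; first by move=> j; have := h j; rewrite -leNgt.
by rewrite lerD2l lerN2 ler_wpM2r ?sqr_ge0 // ge_min lexx.
Qed.

Lemma max_objectiveE : max_objective l f = (obj mu)%:E.
Proof.
apply/le_anti/andP; split.
  apply: ge_ereal_sup => _ [p fp <-].
  by rewrite -objective_mu; exact: hmax.2.
by apply: ereal_sup_ubound; exists (nu, mu); [exact: hmax.1 | exact: objective_mu].
Qed.

End Objective.

(** * The divisibility condition *)

Section Residues.
Variables (X : finType) (l' r : nat).
Notation l := l'.+1.
Notation Xr := {ffun 'I_r -> X}.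
Variables (S : {set Xr}) (y0 : Xr).
Hypothesis Sy0 : y0 \in S.
Notation d := #|S :\ y0|.
Notation yy := (@supp_enum X r S y0).

(** The homomorphism of the divisibility condition: raising coordinate i by one moves a factor node
    from y0 to [yy i]. Writing l as [l'.+1] makes 'I_l the group Z/l. *)
Definition marg_residue (rho : {ffun 'I_d -> 'I_l}) : {ffun X -> 'I_l} :=
  [ffun z => \sum_i (rho i *+ typ (yy i) z - rho i *+ typ y0 z)].

Definition lattice_index : nat := #|[set marg_residue rho | rho : {ffun 'I_d -> 'I_l}]%SET|.

Lemma marg_residueD a b : marg_residue (a + b) = marg_residue a + marg_residue b.
Proof.
apply/ffunP => z; rewrite !ffunE -big_split; apply: eq_bigr => i _ /=.
by rewrite !ffunE !mulrnDl opprD addrACA.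
Qed.

Lemma lattice_index_gt0 : (0 < lattice_index)%N.
Proof. by apply/card_gt0P; exists (marg_residue 0); apply: imset_f. Qed.

(** Nonempty fibers are cosets of the kernel, so all have the same size. *)
Lemma card_fiber rho0 :
  (#|[set rho | marg_residue rho == marg_residue rho0]%SET| * lattice_index = l ^ d)%N.
Proof.
pose fib c := #|[set rho | marg_residue rho == c]%SET|.
have fib_le a b : (fib (marg_residue a) <= fib (marg_residue b))%N.
  have inj : injective (fun rho => rho + (b - a) : {ffun 'I_d -> 'I_l}).
    by move=> x y /addIr.
  rewrite /fib -(card_imset _ inj); apply/subset_leq_card/fintype.subsetP => x.
  case/imsetP => y; rewrite !inE => /eqP e ->.
  by rewrite marg_residueD e -marg_residueD addrC subrK.
have -> : (l ^ d = \sum_(rho : {ffun 'I_d -> 'I_l}) 1)%N.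
  by rewrite sum1_card card_ffun !card_ord.
rewrite (partition_big marg_residue (mem [set marg_residue rho | rho : {ffun 'I_d -> 'I_l}]%SET)) /=; last first.
  by move=> rho _; apply: imset_f.
rewrite /lattice_index mulnC -sum_nat_const; apply: eq_bigr => c /imsetP[a _ ->].
rewrite sum1_card; transitivity (fib (marg_residue a)).
  by apply/eqP; rewrite eqn_leq !fib_le.
by apply: eq_card => rho; rewrite inE.
Qed.

(** The type with coordinates k and total M; the count at y0 is meaningful only when the coordinates
    sum to at most M. *)
Definition full_type (M : nat) (k : 'I_d -> nat) : {ffun Xr -> nat} :=
  [ffun y => \sum_i (yy i == y) * k i + (y0 == y) * (M - \sum_i k i)]%N.

Lemma full_type_yy M k i : full_type M k (yy i) = k i.
Proof.
rewrite ffunE (bigD1 i) //= eqxx mul1n big1 ?addn0 => [|j /negPf ji].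
  by rewrite yyN0 mul0n addn0.
by rewrite yyE ji.
Qed.

Lemma full_type_y0 M k : full_type M k y0 = (M - \sum_i k i)%N.
Proof.
rewrite ffunE eqxx mul1n big1 ?add0n // => i _.
by rewrite eq_sym yyN0.
Qed.

Lemma full_type_supp M k y : y \notin S -> full_type M k y = 0%N.
Proof.
move=> yS; rewrite ffunE big1 => [|i _].
  by case: eqP => // e; rewrite -e Sy0 in yS.
by case: eqP => // e; rewrite -e yyS in yS.
Qed.

Lemma sum_suppN (F : Xr -> nat) : (forall y, y \notin S -> F y = 0%N) ->
  (\sum_y F y = F y0 + \sum_(i < d) F (yy i))%N.
Proof.
move=> F0; rewrite (bigID (mem S)) /= [X in (_ + X)%N]big1 ?addn0 //.
by rewrite (big_setD1 y0) //= big_enum_val.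
Qed.

Lemma sum_full_type M k : (\sum_i k i <= M)%N -> (\sum_y full_type M k y = M)%N.
Proof.
move=> kM; rewrite sum_suppN; last exact: full_type_supp.
by rewrite full_type_y0 [X in (_ + X)%N](eq_bigr k) ?subnK // => i _; rewrite full_type_yy.
Qed.

Definition residue (k : 'I_d -> nat) : {ffun 'I_d -> 'I_l} := [ffun i => inZp (k i)].

Definition target M : {ffun X -> 'I_l} := [ffun z => - ((inZp M : 'I_l) *+ typ y0 z)].

Lemma inZpD a b : inZp (a + b) = inZp a + inZp b :> 'I_l.
Proof. by apply: val_inj; rewrite /= modnDm. Qed.

Lemma inZpM a b : inZp (a * b) = (inZp a : 'I_l) *+ b.
Proof.
elim: b => [|b IH]; last by rewrite mulnS inZpD IH mulrS.
by rewrite muln0 mulr0n; apply: val_inj; rewrite /= mod0n.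
Qed.

Lemma inZp_sum (I : finType) (F : I -> nat) :
  inZp (\sum_i F i)%N = \sum_i (inZp (F i) : 'I_l).
Proof. by apply: (big_morph (fun n => inZp n : 'I_l)) => [a b|]; [exact: inZpD | by apply: val_inj; rewrite /= mod0n]. Qed.

Lemma dvdn_inZp n : (l %| n)%N = ((inZp n : 'I_l) == 0).
Proof. by rewrite -val_eqE /=. Qed.

Lemma marg_residueE k z : marg_residue (residue k) z =
  \sum_i (inZp (k i) : 'I_l) *+ typ (yy i) z
  - \sum_i (inZp (k i) : 'I_l) *+ typ y0 z.
Proof. by rewrite -sumrB ffunE; apply: eq_bigr => i _; rewrite [residue k i]ffunE. Qed.

Lemma targetE M z : target M z = - ((inZp M : 'I_l) *+ typ y0 z).
Proof. by rewrite ffunE. Qed.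

Lemma socket_counts_full_type M k : (\sum_i k i <= M)%N ->
  [forall z, l %| socket_counts (full_type M k) z]%N = (marg_residue (residue k) == target M).
Proof.
move=> kM.
have scE z : (inZp (socket_counts (full_type M k) z) : 'I_l) =
    marg_residue (residue k) z - target M z.
  (* Stated additively, so that the truncated subtraction at y0 disappears before passing to
     residues. *)
  have e : (socket_counts (full_type M k) z + \sum_i k i * typ y0 z =
            \sum_i k i * typ (yy i) z + M * typ y0 z)%N.
    rewrite ffunE sum_suppN => [|y yS]; last by rewrite full_type_supp.
    rewrite full_type_y0 [X in (_ + X + _)%N](eq_bigr (fun i => k i * typ (yy i) z)%N).
      by rewrite -big_distrl /= addnAC -mulnDl subnK // addnC.
    by move=> i _; rewrite full_type_yy.
  have := congr1 (fun n => inZp n : 'I_l) e; rewrite /= !inZpD !inZp_sum !inZpM.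
  rewrite (eq_bigr _ (fun i _ => inZpM (k i) (typ y0 z))).
  rewrite (eq_bigr _ (fun i _ => inZpM (k i) (typ (yy i) z))).
  move/(canRL (addrK _)) => ->; rewrite marg_residueE targetE opprK.
  by rewrite addrAC.
apply/forallP/eqP => [h|h z]; last by rewrite dvdn_inZp scE h subrr.
by apply/ffunP => z; apply/eqP; rewrite -subr_eq0 -scE -dvdn_inZp.
Qed.

Variables (R : realType) (f : Xr -> R).
Hypotheses (hr : (0 < r)%N) (f0 : forall y, y \notin S -> f y = 0).

Lemma weight_supp (m : {ffun Xr -> nat}) y : y \notin S -> m y != 0%N ->
  weight l f m = 0.
Proof.
move=> yS my; rewrite /weight (bigD1 y) //= f0 //.
by rewrite expr0n (negPf my) mul0r mulr0 mul0r.
Qed.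

(** Types charging a point off S have weight 0; the others are determined by their d coordinates. *)
Lemma expected_Z_supp N : (r %| l * N)%N ->
  expected_Z l f N = \sum_(k : {ffun 'I_d -> 'I_(nfactor l r N).+1}
     | (\sum_i k i <= nfactor l r N)%N
       && (marg_residue (residue (fun i => val (k i))) == target (nfactor l r N)))
    weight l f (full_type (nfactor l r N) (fun i => val (k i))).
Proof.
move=> hN; rewrite expected_Z_types //; set M := nfactor l r N.
rewrite (bigID (fun m : {ffun Xr -> 'I_M.+1} =>
  [forall y, (y \notin S) ==> (val (m y) == 0%N)])) /=.
rewrite [X in _ + X]big1 ?addr0 => [|m /andP[_]]; last first.
  rewrite negb_forall => /existsP[y]; rewrite negb_imply => /andP[yS my].
  by apply: (weight_supp yS); rewrite ffunE.
pose h (k : {ffun 'I_d -> 'I_M.+1}) : {ffun Xr -> 'I_M.+1} :=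
  [ffun y => inord (full_type M (fun i => val (k i)) y)].
pose g (m : {ffun Xr -> 'I_M.+1}) : {ffun 'I_d -> 'I_M.+1} := [ffun i => m (yy i)].
have hE (k : {ffun 'I_d -> 'I_M.+1}) : (\sum_i k i <= M)%N -> forall y, val (h k y) = full_type M (fun i => val (k i)) y.
  move=> kM y; rewrite ffunE /= inordK // ltnS -[leqRHS](sum_full_type kM).
  by rewrite (bigD1 y) //= leq_addr.
have sg (m : {ffun Xr -> 'I_M.+1}) : (\sum_y m y == M)%N ->
    [forall y, (y \notin S) ==> (val (m y) == 0%N)] -> (m y0 + \sum_i g m i = M)%N.
  move=> /eqP sm /forallP sS; rewrite -[RHS]sm sum_suppN.
    by congr (_ + _)%N; apply: eq_bigr => i _; rewrite ffunE.
  by move=> y yS; have := sS y; rewrite yS => /eqP.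
rewrite (reindex_onto h g) /=; last first.
  move=> m /andP[/andP[sm _] sS]; have e := sg m sm sS.
  have aux a b c : (a + b = c -> c - b = a)%N by lia.
  have gM : (\sum_i g m i <= M)%N by exact: leq_trans (leq_addl _ _) (eq_leq e).
  apply/ffunP => y; apply: val_inj; rewrite hE //.
  have [yS|yS] := boolP (y \in S); last first.
    by rewrite full_type_supp //; move/forallP: sS => /(_ y); rewrite yS => /eqP.
  have [->|yy0] := eqVneq y y0; first by rewrite full_type_y0; apply: aux e.
  have yd : y \in S :\ y0 by rewrite !inE yy0.
  have -> : y = yy (enum_rank_in yd y) by rewrite /supp_enum enum_rankK_in.
  by rewrite full_type_yy ffunE.
have kM_of (k : {ffun 'I_d -> 'I_M.+1}) : (\sum_y h k y == M)%N ->
    [forall y, (y \notin S) ==> (val (h k y) == 0%N)] -> g (h k) == k -> (\sum_i k i <= M)%N.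
  move=> sm sS /eqP gk; have := sg _ sm sS; rewrite gk => e;
    exact: leq_trans (leq_addl _ _) (eq_leq e).
have scE (k : {ffun 'I_d -> 'I_M.+1}) : (\sum_i k i <= M)%N ->
    socket_counts (fun y => val (h k y)) = socket_counts (full_type M (fun i => val (k i))).
  move=> kM; apply/ffunP => z; rewrite [LHS]ffunE [RHS]ffunE.
  by apply: eq_bigr => y _; rewrite hE.
apply: eq_big => [k|k /andP[/andP[/andP[sm _] sS] gk]]; last first.
  congr (weight l f _); apply/ffunP => y; rewrite ffunE hE //; exact: kM_of.
have [kM|kM] := leqP (\sum_i k i)%N M; last first.
  apply/negP => /andP[/andP[/andP[sm _] sS] gk].
  by have := kM_of _ sm sS gk; rewrite leqNgt kM.
have gh : g (h k) = k.
  by apply/ffunP => i; apply: val_inj; rewrite ffunE hE // full_type_yy.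
rewrite gh eqxx andbT (eq_bigr (full_type M (fun i => val (k i)))) => [|y _]; last exact: hE.
rewrite sum_full_type // eqxx /= scE // socket_counts_full_type //.
have -> : [forall y, (y \notin S) ==> (val (h k y) == 0%N)].
  by apply/forallP => y; apply/implyP => yS; rewrite hE // full_type_supp.
by rewrite andbT.
Qed.

End Residues.

(** * Asymptotics up to the constant in Stirling's formula *)

Section LogWeight.
Variables (R : realType) (X : finType) (l r : nat).
Hypotheses (hl : (0 < l)%N) (hr : (0 < r)%N).
Notation Xr := {ffun 'I_r -> X}.
Variables (f : Xr -> R) (S : {set Xr}).
Hypothesis fS : forall y, y \in S -> 0 < f y.

(** Keeps the half-logarithm and the constant in the error, so that it is exactly 0 at k = 0. *)
Definition stirling_err (k : nat) : R := ln k`!%:R - (xlnx k%:R - k%:R).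

Lemma fact_expR k : k`!%:R = expR (stirling_err k + (xlnx k%:R - k%:R)) :> R.
Proof. by rewrite /stirling_err subrK lnK // posrE ltr0n fact_gt0. Qed.

Lemma prod_fact_expR (T : finType) (n : {ffun T -> nat}) :
  \prod_z (n z)`!%:R = expR (\sum_z (stirling_err (n z) + (xlnx (n z)%:R - (n z)%:R))) :> R.
Proof. by rewrite expR_sum; apply: eq_bigr => z _; rewrite fact_expR. Qed.

Lemma mult_expR (T : finType) (n : {ffun T -> nat}) N : (\sum_z n z = N)%N ->
  mult R n = expR (stirling_err N - \sum_z stirling_err (n z) + (xlnx N%:R - \sum_z xlnx (n z)%:R)).
Proof.
move=> nN; rewrite /mult nN fact_expR prod_fact_expR -expRB; congr expR.
rewrite big_split /=.
have -> : \sum_z (xlnx (n z)%:R - (n z)%:R) = \sum_z xlnx (n z)%:R - N%:R :> R.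
  by rewrite -nN natr_sum -sumrB.
by ring.
Qed.

Lemma sum_xlnx_scale (T : finType) (n : T -> nat) (a : R) : 0 < a ->
  \sum_z (n z)%:R = a ->
  \sum_z xlnx (n z)%:R = a * \sum_z xlnx ((n z)%:R / a) + xlnx a.
Proof.
move=> a0 na; transitivity (\sum_z (a * xlnx ((n z)%:R / a) + (n z)%:R * (xlnx a / a))).
  apply: eq_bigr => z _; rewrite -{1}[(n z)%:R](divfK (lt0r_neq0 a0)) mulrC.
  by rewrite xlnxM ?divr_ge0 ?(ltW a0) //; congr (_ + _); field; rewrite gt_eqF.
rewrite big_split /= -mulr_sumr -mulr_suml na; congr (_ + _).
by field; rewrite gt_eqF.
Qed.

Variables (m : {ffun Xr -> nat}) (M N : nat) (n : {ffun X -> nat}).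
Hypotheses (sm : (\sum_y m y = M)%N) (mS : forall y, y \notin S -> m y = 0%N)
  (scm : forall z, socket_counts m z = (l * n z)%N) (lN : (l * N = r * M)%N)
  (M0 : (0 < M)%N).

Definition log_corr : R := stirling_err M - \sum_y stirling_err (m y) + stirling_err N
  - \sum_z stirling_err (n z) - stirling_err (l * N) + \sum_z stirling_err (l * n z).

Lemma sum_n : (\sum_z n z = N)%N.
Proof.
apply/eqP; rewrite -(eqn_pmul2l hl) big_distrr /= lN mulnC -sm -sum_socket_counts.
by apply/eqP/eq_bigr => z _; rewrite scm.
Qed.

Lemma N_gt0 : (0 < N)%N.
Proof. by rewrite -(ltn_pmul2l hl) muln0 lN muln_gt0 hr. Qed.

Lemma marg_types z : marg (fun y => (m y)%:R / M%:R) z = (n z)%:R / N%:R :> R.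
Proof.
have r0 : r%:R != 0 :> R by rewrite pnatr_eq0 -lt0n.
have l0 : l%:R != 0 :> R by rewrite pnatr_eq0 -lt0n.
have m0 : M%:R != 0 :> R by rewrite pnatr_eq0 -lt0n.
have n0 : N%:R != 0 :> R by rewrite pnatr_eq0 -lt0n N_gt0.
rewrite /marg; under eq_bigr do rewrite mulrAC -natrM.
rewrite -mulr_suml -natr_sum.
have -> : (\sum_y m y * typ y z = l * n z)%N by rewrite -scm ffunE.
have e : l%:R * N%:R = r%:R * M%:R :> R by rewrite -!natrM lN.
rewrite natrM; apply: (mulfI l0); apply: (mulIf n0); apply: (mulfI r0); apply: (mulIf m0).
transitivity (l%:R * l%:R * (n z)%:R * N%:R : R); first by field; rewrite r0 m0.
by transitivity (l%:R * (n z)%:R * (r%:R * M%:R) : R); [rewrite -e; ring | field].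
Qed.

(** An exact identity: in the leading parts x ln x - x of the factorials the linear terms cancel,
    and by homogeneity of x ln x the rest is N times the objective at m / M. All errors are
    collected in [log_corr]. *)
Lemma weight_expR : weight l f m =
  expR (N%:R * obj l f (fun y => (m y)%:R / M%:R) + log_corr).
Proof.
have m0 : 0 < M%:R :> R by rewrite ltr0n.
have n0 : 0 < N%:R :> R by rewrite ltr0n N_gt0.
have l0 : 0 < l%:R :> R by rewrite ltr0n.
have r0 : 0 < r%:R :> R by rewrite ltr0n.
have nE : [ffun z => socket_counts m z %/ l]%N = n.
  by apply/ffunP => z; rewrite ffunE scm mulKn.
have scE : socket_counts m = [ffun z => l * n z]%N.
  by apply/ffunP => z; rewrite scm ffunE.
rewrite /weight nE scE (mult_expR sm) (mult_expR sum_n).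
rewrite (@mult_expR _ [ffun z => l * n z]%N (l * N)); last first.
  by under eq_bigr do rewrite ffunE; rewrite -big_distrr sum_n.
have -> : \prod_y f y ^+ m y = expR (\sum_y (m y)%:R * ln (f y)).
  rewrite expR_sum; apply: eq_bigr => y _.
  have [yS|yS] := boolP (y \in S); last by rewrite mS // mul0r expR0.
  by rewrite expRM_natl lnK // posrE fS.
rewrite -expRB -!expRD; congr expR.
under [\sum_z stirling_err ([ffun _ => _] _)]eq_bigr do rewrite ffunE.
under [\sum_z xlnx ([ffun _ => _] _)%:R]eq_bigr do rewrite ffunE natrM.
have snR : \sum_z (n z)%:R = N%:R :> R by rewrite -natr_sum sum_n.
have smR : \sum_y (m y)%:R = M%:R :> R by rewrite -natr_sum sm.
have -> : \sum_z xlnx (l%:R * (n z)%:R) = l%:R * \sum_z xlnx (n z)%:R + N%:R * xlnx l%:R :> R.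
  rewrite -snR mulr_sumr mulr_suml -big_split; apply: eq_bigr => z _ /=.
  by rewrite xlnxM.
rewrite natrM xlnxM // (sum_xlnx_scale m0 smR) (sum_xlnx_scale n0 snR).
rewrite /obj /log_corr.
rewrite [\sum_z xlnx (marg _ z)](eq_bigr (fun z => xlnx ((n z)%:R / N%:R))); last first.
  by move=> z _; rewrite marg_types.
have -> : \sum_y (m y)%:R * ln (f y) = M%:R * \sum_y (m y)%:R / M%:R * ln (f y).
  rewrite mulr_sumr; apply: eq_bigr => y _; field; exact: lt0r_neq0.
have e : M%:R = l%:R * N%:R / r%:R :> R.
  by rewrite -natrM lN natrM mulrAC divff ?mul1r // gt_eqF.
set P := \sum_y xlnx ((m y)%:R / M%:R); set Q := \sum_z xlnx (_ / N%:R).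
set F := \sum_y (m y)%:R / M%:R * ln (f y).
set s1 := \sum_y stirling_err (m y); set s2 := \sum_z stirling_err (n z); set s3 := \sum_z stirling_err _.
have e2 : N%:R * (l%:R / r%:R * (F - P) + (l%:R - 1) * Q) =
  M%:R * (F - P) + N%:R * (l%:R - 1) * Q by rewrite e; field; exact: lt0r_neq0.
by rewrite e2; ring.
Qed.

Lemma sum_sterr_supp : \sum_y stirling_err (m y) = \sum_(y in S) stirling_err (m y).
Proof.
rewrite (bigID (mem S)) /= [X in _ + X]big1 ?addr0 // => y yS.
by rewrite mS // /stirling_err fact0 ln1 xlnx0 !subr0.
Qed.

(** Each of the 3 + |X^r| + 2 |X| errors involves a count of at most r M; the bound is only
    polynomial in M after exponentiation, but it holds for every type. *)
Lemma log_corr_rough (C : R) : 0 <= C -> (forall k, `|stirling_err k| <= C + ln (k%:R + 1)) ->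
  log_corr <= (3 + #|Xr| + 2 * #|X|)%:R * (C + ln (r.+1%:R) + ln M%:R + 1).
Proof.
move=> C0 hC.
pose B := C + ln (r.+1%:R) + ln M%:R + 1.
have m0 : 1 <= M%:R :> R by rewrite ler1n.
have hB k : (k <= r * M)%N || (k <= M)%N -> `|stirling_err k| <= B.
  move=> hk; apply: le_trans (hC k) _; rewrite /B -!addrA lerD2l addrA.
  have -> : ln r.+1%:R + ln M%:R = ln (r.+1%:R * M%:R) :> R.
    by rewrite lnM // posrE ?ltr0n //.
  have : ln (k%:R + 1) <= ln (r.+1%:R * M%:R) :> R.
    rewrite ler_ln ?posrE ?ltr_wpDl ?mulr_gt0 ?ltr0n // natr1 -natrM ler_nat.
    by case/orP: hk; rewrite mulSn; nia.
  lra.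
have nN z : (n z <= N)%N by rewrite -sum_n (bigD1 z) //= leq_addr.
have NlN : (N <= r * M)%N by rewrite -lN leq_pmull.
have mM y : (m y <= M)%N by rewrite -sm (bigD1 y) //= leq_addr.
have b1 : stirling_err M <= B by apply: le_trans (ler_norm _) (hB _ _); rewrite leqnn orbT.
have b2 : - \sum_y stirling_err (m y) <= #|Xr|%:R * B.
  rewrite -sumrN; apply: (@le_trans _ _ (\sum_(y : Xr) B)).
    by apply: ler_sum => y _; apply: le_trans (ler_norm _) _; rewrite normrN hB // mM orbT.
  by rewrite sumr_const mulr_natl.
have b3 : stirling_err N <= B by apply: le_trans (ler_norm _) (hB _ _); rewrite NlN.
have b4 : - \sum_z stirling_err (n z) <= #|X|%:R * B.
  rewrite -sumrN; apply: (@le_trans _ _ (\sum_(z : X) B)).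
    apply: ler_sum => z _; apply: le_trans (ler_norm _) _.
    by rewrite normrN hB // (leq_trans (nN z)).
  by rewrite sumr_const mulr_natl.
have b5 : - stirling_err (l * N) <= B.
  by apply: le_trans (ler_norm _) _; rewrite normrN hB // lN leqnn.
have b6 : \sum_z stirling_err (l * n z) <= #|X|%:R * B.
  apply: (@le_trans _ _ (\sum_(z : X) B)).
    apply: ler_sum => z _; apply: le_trans (ler_norm _) (hB _ _).
    by rewrite -lN leq_mul.
  by rewrite sumr_const mulr_natl.
rewrite -/B /log_corr 2!natrD natrM; lra.
Qed.

(** The half-logarithms of N and of the n z cancel against those of l N and the l n z, up to |X| - 1
    copies of ln l: this is the origin of the power of l in the theorem. *)
Lemma log_corr_fine (c e : R) (K : nat) : 0 <= e -> (0 < K)%N ->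
  (forall k, (K <= k)%N -> `|stirling_err k - ln k%:R / 2 - c| <= e) ->
  (forall y, y \in S -> (K <= m y)%N) -> (forall z, (K <= n z)%N) ->
  (K <= M)%N -> (K <= N)%N ->
  `|log_corr - (((#|X|%:R - 1) * ln l%:R + ln M%:R - \sum_(y in S) ln (m y)%:R) / 2
     + c * (1 - #|S|%:R))| <= (3 + #|S| + 2 * #|X|)%:R * e.
Proof.
move=> e0 K0 hK' mK nK MK NK.
have [h hE hK] : exists2 h : nat -> R, forall k, stirling_err k = h k + (ln k%:R / 2 + c) &
    forall k, (K <= k)%N -> `|h k| <= e.
  by exists (fun k => stirling_err k - ln k%:R / 2 - c) => // k; ring.
have lnl z : ln (l * n z)%:R = ln l%:R + ln (n z)%:R :> R.
  by rewrite natrM lnM // posrE ltr0n // (leq_trans K0).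
have lnN : ln (l * N)%:R = ln l%:R + ln N%:R :> R.
  by rewrite natrM lnM // posrE ltr0n // (leq_trans K0).
have s1 : \sum_(y in S) stirling_err (m y) = \sum_(y in S) h (m y) + (\sum_(y in S) ln (m y)%:R) / 2 + c * #|S|%:R.
  rewrite (eq_bigr _ (fun y _ => hE (m y))) !big_split /= -mulr_suml sumr_const.
  by rewrite -[c *+ _]mulr_natr addrA.
have s2 : \sum_z stirling_err (n z) = \sum_z h (n z) + (\sum_z ln (n z)%:R) / 2 + c * #|X|%:R.
  rewrite (eq_bigr _ (fun y _ => hE (n y))) !big_split /= -mulr_suml sumr_const.
  by rewrite -[c *+ _]mulr_natr addrA.
have s3 : \sum_z stirling_err (l * n z) = \sum_z h (l * n z) + (\sum_z ln (n z)%:R + #|X|%:R * ln l%:R) / 2 + c * #|X|%:R.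
  rewrite (eq_bigr _ (fun y _ => hE (l * n y)%N)) !big_split /= -mulr_suml sumr_const.
  rewrite (eq_bigr _ (fun z _ => lnl z)) big_split /= sumr_const.
  rewrite -[c *+ _]mulr_natr -[ln l%:R *+ _]mulr_natl; ring.
have b1 := hK _ MK; have b2 := hK _ NK.
have b3 : `|h (l * N)| <= e by apply: hK; apply: leq_trans NK _; rewrite leq_pmull.
have b4 : `|\sum_(y in S) h (m y)| <= #|S|%:R * e.
  apply: le_trans (ler_norm_sum _ _ _) _; rewrite mulr_natl -sumr_const.
  by apply: ler_sum => y yS; apply: hK; exact: mK.
have b5 : `|\sum_z h (n z)| <= #|X|%:R * e.
  apply: le_trans (ler_norm_sum _ _ _) _; rewrite mulr_natl -sumr_const.
  by apply: ler_sum => y yS; apply: hK.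
have b6 : `|\sum_z h (l * n z)| <= #|X|%:R * e.
  apply: le_trans (ler_norm_sum _ _ _) _; rewrite mulr_natl -sumr_const.
  apply: ler_sum => y yS; apply: hK; apply: leq_trans (nK y) _; exact: leq_pmull.
rewrite /log_corr sum_sterr_supp s1 s2 s3 (hE M) (hE N) (hE (l * N)%N) lnN.
move: b1 b2 b3 b4 b5 b6; rewrite 2!natrD natrM !ler_norml.
set x1 := h M; set x2 := h N; set x3 := h _; set x4 := \sum_(y in S) h _.
set x5 := \sum_z h (n z); set x6 := \sum_z h (l * n z)%N.
move=> /andP[? ?] /andP[? ?] /andP[? ?] /andP[? ?] /andP[? ?] /andP[? ?].
apply/andP; split; lra.
Qed.

End LogWeight.

Section Scale.
Variable R : realType.

Definition window (M : nat) : nat :=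
  (Num.truncn (ln M%:R * Num.sqrt M%:R : R)).+1.

(** With T about sqrt M ln M, the box contains the bulk of the Gaussian, deviations D of order T / M
    tend to 0, M D^3 (the cubic error times N, up to a constant) tends to 0, and T^2 / M is at least
    (ln M)^2, which controls the tail. *)
Lemma window_scale (a W e : R) : 0 < a -> 0 < e -> exists2 La : R, 1 <= La &
  forall M : nat, La <= ln M%:R ->
  (0 < M)%N /\ [/\ W <= M%:R, W * Num.sqrt M%:R <= (window M)%:R,
      a * ((window M)%:R + 2) / M%:R <= e,
      M%:R * (a * ((window M)%:R + 2) / M%:R) ^+ 3 <= e &
      ln M%:R ^+ 2 * M%:R <= (window M)%:R ^+ 2 :> R].
Proof.
move=> a0 e0.
(* Everything reduces to (ln M)^4 <= b sqrt M, from the fourth-order term of the exponential series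
   for sqrt M = exp (ln M / 2). *)
have [b b0 hb] : exists2 b : R, 0 < b & forall x : R, (x / 2) ^+ 4 / 24 = x ^+ 4 / b.
  by exists (16 * 24) => [|x]; [rewrite mulr_gt0 | field].
pose La := 1 + `|W| + 4 * b * a / e + 64 * b * a ^+ 3 / e.
have a3 : 0 < a ^+ 3 by rewrite exprn_gt0.
have p1 : 0 <= 4 * b * a / e by rewrite ltW // divr_gt0 // !mulr_gt0.
have p2 : 0 <= 64 * b * a ^+ 3 / e by rewrite ltW // divr_gt0 // !mulr_gt0.
have W0 := normr_ge0 W.
exists La => [|M hM]; first by rewrite /La; lra.
set x := ln M%:R in hM *.
have x1 : 1 <= x by rewrite /La in hM; lra.
have xW : W <= x by have := ler_norm W; rewrite /La in hM; lra.
have xa : 4 * b * a <= e * x by rewrite -ler_pdivrMl // mulrC; rewrite /La in hM; lra.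
have xa3 : 64 * b * a ^+ 3 <= e * x by rewrite -ler_pdivrMl // mulrC; rewrite /La in hM; lra.
have M0 : (0 < M)%N.
  rewrite lt0n; apply/eqP => M0; move: x1; rewrite /x M0 ln0 //; lra.
have M0R : 0 < M%:R :> R by rewrite ltr0n.
pose s := expR (x / 2).
have Ms : M%:R = s ^+ 2.
  by rewrite -expRM_natl mulrCA divff ?mulr1 ?pnatr_eq0 // /x lnK.
have s0 : 0 < s by exact: expR_gt0.
have sqE : Num.sqrt M%:R = s by rewrite Ms sqrtr_sqr gtr0_norm.
have x0 : 0 <= x by lra.
have sx : x ^+ 4 <= b * s.
  have x2 : 0 <= x / 2 by rewrite divr_ge0.
  have := @expR_ge1Dxn R (x / 2) 3 x2; rewrite -/s (_ : 4`! = 24)%N //.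
  rewrite hb => h; rewrite mulrC -ler_pdivrMr //; lra.
have s1 : 1 <= s by rewrite -expR0 ler_expR divr_ge0.
have xs0 : 0 <= x * s by rewrite mulr_ge0 // ltW.
have T1 : x * s <= (window M)%:R by rewrite /window -/x sqE ltW // truncnS_gt.
have T2 : (window M)%:R <= x * s + 1.
  by rewrite /window -/x sqE -natr1 lerD2r truncn_le.
set T : R := (window M)%:R in T1 T2 *.
have xs1 : 1 <= x * s by rewrite -[1]mulr1 ler_pM.
have T4 : T + 2 <= 4 * (x * s) by lra.
pose w := x ^+ 3 / s.
have w0 : 0 <= w by rewrite divr_ge0 ?exprn_ge0 // ltW.
have wx : w * x <= b.
  by rewrite /w mulrAC ler_pdivrMr // -exprSr.
have xE : x / s <= w.
  by rewrite /w ler_pM2r ?invr_gt0 // exprS ler_peMr // exprn_ege1.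
have D4 : a * (T + 2) / M%:R <= 4 * a * (x / s).
  rewrite ler_pdivrMr // Ms.
  have -> : 4 * a * (x / s) * s ^+ 2 = a * (4 * (x * s)) by field; rewrite gt_eqF.
  by rewrite ler_pM2l.
set D := a * (T + 2) / M%:R in D4 *.
have D0 : 0 <= D by rewrite /D divr_ge0 // mulr_ge0 ?addr_ge0 // ltW.
have xp : 0 < x by lra.
split=> //; split.
- by apply: le_trans xW _; rewrite ltW // ln_sublinear.
- by rewrite sqE; apply: le_trans T1; rewrite ler_pM2r.
- apply: le_trans D4 _; apply: (@le_trans _ _ (4 * a * w)).
    by rewrite ler_pM2l // mulr_gt0.
  rewrite -(ler_pM2r xp) -mulrA.
  have : 4 * a * (w * x) <= 4 * a * b by rewrite ler_pM2l // mulr_gt0.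
  lra.
- apply: (@le_trans _ _ (s ^+ 2 * (4 * a * (x / s)) ^+ 3)).
    rewrite Ms ler_pM2l ?exprn_gt0 //; apply: lerXn2r; rewrite ?nnegrE //.
    exact: le_trans D4.
  have -> : s ^+ 2 * (4 * a * (x / s)) ^+ 3 = 64 * a ^+ 3 * w.
    by rewrite /w; field; rewrite gt_eqF.
  rewrite -(ler_pM2r xp) -mulrA.
  have : 64 * a ^+ 3 * (w * x) <= 64 * a ^+ 3 * b by rewrite ler_pM2l // mulr_gt0.
  lra.
- by rewrite Ms -exprMn lerXn2r ?nnegrE.
Qed.

End Scale.

Lemma ratio_cancel (R : fieldType) (a b x : R) : a != 0 -> b != 0 ->
  b / a * (x * (a / b)) = x.
Proof. by move=> a0 b0; field; rewrite a0 b0. Qed.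

Lemma scale_cancel (R : numFieldType) (a b m q : R) : a != 0 -> b != 0 -> m != 0 ->
  b / a * m * (a / (2 * b) * ((a / m) ^+ 2 * q)) = a ^+ 2 / 2 * q / m.
Proof. by move=> a0 b0 m0; field; rewrite a0 b0 m0. Qed.

(** * Weights far from the maximizer and near it *)

Section Local.
Variables (R : realType) (X : finType) (l' r : nat).
Notation l := l'.+1.
Hypothesis hr : (0 < r)%N.
Notation Xr := {ffun 'I_r -> X}.
Variable f : Xr -> R.
Hypothesis f_ge0 : forall y, 0 <= f y.
Let S : {set Xr} := [set y | 0 < f y]%SET.
Variables (nu : {ffun X -> R}) (mu : {ffun Xr -> R}).
Hypotheses (hmax : maximizer l f (nu, mu))
  (huniq : forall q, maximizer l f q -> q = (nu, mu))
  (nu_gt0 : forall x, 0 < nu x).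
Variable y0 : Xr.
Hypothesis Sy0 : y0 \in S.
Hypothesis hdet : 0 < det_factor l (nu, mu).
Notation d := #|S :\ y0|.
Notation yy := (@supp_enum X r S y0).
Notation hessM := (@hess R X l r S y0 mu).
Notation perturbM := (@perturb R X r f mu y0).
Notation fullM := (@full_type X r S y0).

Let mu_supp := maximizer_supp (isT : (0 < l)%N) hr f_ge0 hmax Sy0.
Let mu_gt0 := maximizer_gt0 (isT : (0 < l)%N) hr f_ge0 hmax nu_gt0 Sy0.
Let mu1 : \sum_y mu y = 1. Proof. by have [] := mu_dist hmax. Qed.

Definition deviation (M : nat) (k : 'I_d -> nat) : 'rV[R]_d :=
  \row_i ((k i)%:R / M%:R - mu (yy i)).

Lemma full_type_deviation M (k : 'I_d -> nat) y : (0 < M)%N -> (\sum_i k i <= M)%N ->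
  (fullM M k y)%:R / M%:R = perturbM (deviation M k) y.
Proof.
move=> M0 kM; have M0R : M%:R != 0 :> R by rewrite pnatr_eq0 -lt0n.
rewrite /perturb; have [yS|yS] := boolP (y \in S); last first.
  by rewrite (full_type_supp Sy0) // mu_supp // (tang_supp Sy0) // addr0 mul0r.
have [->|yy0] := eqVneq y y0.
  rewrite full_type_y0 tang_y0 natrB // mulrBl divff //.
  under [X in _ = _ - X]eq_bigr do rewrite mxE.
  rewrite sumrB (sum_mu_yy Sy0 mu_supp mu1) -mulr_suml natr_sum; ring.
have yd : y \in S :\ y0 by rewrite in_setD1 yy0 yS.
have -> : y = yy (enum_rank_in yd y) by rewrite /supp_enum enum_rankK_in.
by rewrite full_type_yy tang_yy mxE; ring.
Qed.

(* The types of residue rho modulo l near M mu are parametrized by j, as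
   rho + l (floor (M mu / l) + j - T). *)
Definition cell_center M (i : 'I_d) : nat := Num.truncn (M%:R * mu (yy i) / l%:R).

Definition cell_point M (rho : 'I_d -> nat) T (j : 'I_d -> nat) (i : 'I_d) : nat :=
  (rho i + l * (cell_center M i + j i - T))%N.

(** The displacement of the lattice of residue rho from M mu, in units of the mesh l. *)
Definition cell_offset M (rho : 'I_d -> nat) : 'rV[R]_d :=
  \row_i (((rho i)%:R + l%:R * (cell_center M i)%:R - M%:R * mu (yy i)) / l%:R).

Lemma cell_offset_le1 M (rho : {ffun 'I_d -> 'I_l}) i : `|cell_offset M (fun i => val (rho i)) 0 i| <= 1.
Proof.
have l0 : 0 < l%:R :> R by rewrite ltr0n.
have m0 : 0 < mu (yy i) by apply: mu_gt0; exact: yyS.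
have p0 : 0 <= M%:R * mu (yy i) / l%:R by rewrite divr_ge0 // mulr_ge0 // ltW.
rewrite mxE normrM normfV (gtr0_norm l0) ler_pdivrMr // mul1r.
have h1 := truncn_le (M%:R * mu (yy i) / l%:R).
rewrite p0 in h1.
have h2 := truncnS_gt (M%:R * mu (yy i) / l%:R).
rewrite -/(cell_center M i) ler_pdivlMr // in h1; rewrite -/(cell_center M i) ltr_pdivrMr // -natr1 in h2.
have h3 : (rho i)%:R + 1 <= l%:R :> R by rewrite natr1 ler_nat.
have h4 : 0 <= (rho i)%:R :> R by [].
rewrite ler_norml; apply/andP; split; lra.
Qed.

(** The assumption on T makes the subtraction in [cell_point] exact. *)
Lemma deviation_cell_point M (rho : {ffun 'I_d -> 'I_l}) T (j : {ffun 'I_d -> 'I_(2 * T).+1}) :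
  (0 < M)%N -> (forall i, (T <= cell_center M i)%N) ->
  deviation M (cell_point M (fun i => val (rho i)) T (fun i => val (j i))) =
  (l%:R / M%:R) *: lattice_pt (cell_offset M (fun i => val (rho i))) j.
Proof.
move=> M0 hT; have M0R : M%:R != 0 :> R by rewrite pnatr_eq0 -lt0n.
apply/rowP => i; rewrite !mxE /cell_point natrD natrM natrB; last exact: leq_trans (leq_addr _ _).
rewrite natrD.
by field; rewrite M0R andbT nat1r pnatr_eq0.
Qed.

Lemma lattice_pt_bound T (a : 'rV[R]_d) (j : {ffun 'I_d -> 'I_(2 * T).+1}) i :
  (forall i, `|a 0 i| <= 1) -> `|lattice_pt a j 0 i| <= T%:R + 2.
Proof.
move=> ha; rewrite mxE; apply: le_trans (ler_normD _ _) _.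
have : `|(j i)%:R - T%:R| <= T%:R :> R.
  have := ltn_ord (j i); rewrite ltnS -(ler_nat R) natrM ler_norml.
  have : 0 <= (j i)%:R :> R by [].
  by move=> *; apply/andP; split; lra.
have := ha i; lra.
Qed.

Lemma residue_cell_point M (rho : {ffun 'I_d -> 'I_l}) T j :
  residue l' (cell_point M (fun i => val (rho i)) T j) = rho.
Proof.
apply/ffunP => i; rewrite ffunE; apply: val_inj; rewrite /= /cell_point.
by rewrite addnC mulnC modnMDl modn_small.
Qed.


Lemma ln_perturb (p x : R) : 0 < p -> `|x| <= p / 2 -> `|ln (p + x) - ln p| <= 2 * `|x| / p.
Proof.
move=> p0 hx; have hz : `|x / p| <= 2^-1.
  by rewrite normrM normfV (gtr0_norm p0) ler_pdivrMr // mulrC.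
have z1 : 0 < 1 + x / p by move: hz; rewrite ler_norml; lra.
have -> : p + x = p * (1 + x / p) by field; rewrite gt_eqF.
rewrite lnM // addrAC subrr add0r.
have -> : 2 * `|x| / p = 2 * `|x / p| by rewrite normrM normfV (gtr0_norm p0) mulrA.
have := ln1D_quad hz; move: hz; set z := x / p => hz.
have -> : z ^+ 2 = `|z| ^+ 2 by rewrite real_normK // num_real.
have : 2 * `|z| ^+ 2 <= `|z|.
  rewrite expr2 mulrA ler_piMl //; lra.
have := ler_normD (ln (1 + z) - z) z; rewrite subrK; lra.
Qed.

Definition type_avg M (k : 'I_d -> nat) : {ffun X -> nat} :=
  [ffun z => socket_counts (fullM M k) z %/ l]%N.

Lemma type_avgE M k : (\sum_i k i <= M)%N ->
  marg_residue (residue l' k) == target l' y0 M ->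
  forall z, socket_counts (fullM M k) z = (l * type_avg M k z)%N.
Proof.
move=> kM; rewrite -(socket_counts_full_type l' Sy0) // => /forallP h z.
by rewrite [type_avg _ _ _]ffunE mulnC divnK.
Qed.

Let fS y : y \in S -> 0 < f y. Proof. by rewrite inE. Qed.

Lemma cardS : #|S| = d.+1.
Proof. by rewrite (cardsD1 y0 S) Sy0. Qed.

(** The loss N c2 (T / M)^2 from [obj_quad] is at least of order (ln M)^2, against a correction
    linear in ln M from [log_corr_rough]. *)
Lemma tail_weight : exists C1 C2 c3 : R, [/\ 0 <= C1, 0 <= C2, 0 < c3 &
  forall N M (k : 'I_d -> nat), (l * N = r * M)%N -> (0 < M)%N ->
  ln M%:R ^+ 2 * M%:R <= (window R M)%:R ^+ 2 :> R ->
  (\sum_i k i <= M)%N -> marg_residue (residue l' k) == target l' y0 M ->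
  forall i, (window R M)%:R / M%:R <= `|deviation M k 0 i| ->
  weight l f (fullM M k) <=
    expR (N%:R * obj l f mu) * expR (C1 + C2 * ln M%:R - c3 * ln M%:R ^+ 2)].
Proof.
have [c2 c20 hc2] := obj_quad (isT : (0 < l)%N) hr f_ge0 hmax huniq nu_gt0 Sy0 hdet.
have [C [C0 hC]] := stirling_rough R.
have l0 : 0 < l%:R :> R by rewrite ltr0n.
have r0 : 0 < r%:R :> R by rewrite ltr0n.
pose P : R := (3 + #|Xr| + 2 * #|X|)%:R.
have P0 : 0 <= P by [].
have lr0 : 0 <= ln r.+1%:R :> R by rewrite ln_ge0 // ler1n.
exists (P * (C + ln r.+1%:R + 1)), P, (c2 * (r%:R / l%:R)); split => //.
- by rewrite mulr_ge0 // !addr_ge0.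
- by rewrite mulr_gt0 // divr_gt0.
move=> N M k lN M0 hT kM good i hi.
have M0R : 0 < M%:R :> R by rewrite ltr0n.
have sm := sum_full_type Sy0 kM.
have mS y : y \notin S -> fullM M k y = 0%N by exact: (full_type_supp Sy0).
rewrite (weight_expR (isT : (0 < l)%N) hr fS sm mS (type_avgE kM good) lN M0).
rewrite -expRD ler_expR.
have := log_corr_rough (isT : (0 < l)%N) hr sm (type_avgE kM good) lN M0 C0 hC.
set lc := log_corr _ _ _ _ _ _ => hlc.
have e : (fun y => (fullM M k y)%:R / M%:R) =1 perturbM (deviation M k).
  by move=> y; exact: full_type_deviation.
rewrite (eq_obj _ _ e).
have v0 y : 0 <= perturbM (deviation M k) y by rewrite -e divr_ge0.
have hq := hc2 _ v0 i.
have NE : N%:R = r%:R / l%:R * M%:R :> R.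
  apply: (mulfI (lt0r_neq0 l0)); rewrite -natrM lN natrM; field; exact: lt0r_neq0.
have N0 : 0 <= N%:R :> R by [].
have h1 := ler_wpM2l N0 hq.
have h2 : (r%:R / l%:R) * ln M%:R ^+ 2 <= N%:R * deviation M k 0 i ^+ 2.
  rewrite NE -[leRHS]mulrA ler_pM2l ?divr_gt0 //.
  have : ((window R M)%:R / M%:R) ^+ 2 <= deviation M k 0 i ^+ 2.
    rewrite -[deviation M k 0 i ^+ 2]real_normK ?num_real //.
    by apply: lerXn2r; rewrite ?nnegrE // divr_ge0.
  move/(ler_wpM2l (ltW M0R)); apply: le_trans.
  have -> : M%:R * ((window R M)%:R / M%:R) ^+ 2 = (window R M)%:R ^+ 2 / M%:R :> R.
    by field; exact: lt0r_neq0.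
  by rewrite ler_pdivlMr.
have h3 := ler_wpM2l (ltW c20) h2.
rewrite -/P in hlc; move: hlc h1 h3.
set x := ln M%:R; set ob := obj l f mu; set w := deviation M k 0 i ^+ 2; set a := r%:R / l%:R.
lra.
Qed.

Variable c : R.
Hypothesis hc : forall e : R, 0 < e -> exists K : nat, forall k, (K <= k)%N ->
  `|stirling_err R k - ln k%:R / 2 - c| <= e.

(** The limit of exp [log_corr] near mu, without the factor sqrt M to the power -d. *)
Definition pref : R :=
  expR (((#|X|%:R - 1) * ln l%:R - \sum_(y in S) ln (mu y)) / 2 - c * d%:R).

(** With deviation (l / M) x and N = r M / l, the quadratic loss N l / (2 r) q(l x / M) equals (l^2
    / 2) q(x) / M. *)
Definition gmat : 'M[R]_d := (l%:R ^+ 2 / 2) *: hessM.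

Lemma qf_gmat v : qf gmat v = l%:R ^+ 2 / 2 * qf hessM v.
Proof. by rewrite /qf /gmat -scalemxAr -scalemxAl mxE. Qed.

Local Ltac clear_local :=
  clear - R X l' r hr f f_ge0 S nu mu hmax huniq nu_gt0 y0 Sy0 hdet mu_supp mu_gt0 mu1 fS c hc.

(** The error in the exponent has three sources, each given e / 3: the Taylor remainder of the
    objective, the remainders in Stirling's formula, and the replacement of ln m(y) by ln (M
    mu(y)). *)
Lemma central_weight (e : R) : 0 < e -> exists2 La : R, 1 <= La &
  forall N M, (l * N = r * M)%N -> La <= ln M%:R ->
  (forall i, (window R M <= cell_center M i)%N) /\
  forall (rho : {ffun 'I_d -> 'I_l}) (j : {ffun 'I_d -> 'I_(2 * window R M).+1}),
  let k := cell_point M (fun i => val (rho i)) (window R M) (fun i => val (j i)) in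
  (\sum_i k i <= M)%N /\
  (marg_residue rho == target l' y0 M -> exists2 x : R, `|x| <= e &
    weight l f (fullM M k) = expR (N%:R * obj l f mu) * pref
      * (Num.sqrt M%:R)^-1 ^+ d
      * expR (- qf gmat (lattice_pt (cell_offset M (fun i => val (rho i))) j) / M%:R) * expR x).
Proof.
move=> e0.
have l0 : 0 < l%:R :> R by rewrite ltr0n.
have r0 : 0 < r%:R :> R by rewrite ltr0n.
have [t0 t00 [Kx Kx0 hKx]] := obj_expand0 (isT : (0 < l)%N) hr f_ge0 hmax nu_gt0 Sy0.
pose P : R := (3 + #|S| + 2 * #|X|)%:R.
have P0 : 0 < P + 1 by rewrite ltr_wpDl.
have e30 : 0 < e / 3 by rewrite divr_gt0.
have e20 : 0 < e / 3 / (P + 1) by rewrite divr_gt0.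
have [K' hK'] := hc e20; pose K := K'.+1.
have hK k : (K <= k)%N -> `|stirling_err R k - ln k%:R / 2 - c| <= e / 3 / (P + 1).
  by move=> Kk; apply: hK'; apply: ltnW.
pose G : R := \sum_(y in S) 2 * d%:R / mu y.
have G0 : 0 < G + 1.
  by rewrite ltr_wpDl // sumr_ge0 // => y yS; rewrite divr_ge0 ?mulr_ge0 // ltW // mu_gt0.
have [t1 t10 ht1] : exists2 t, 0 < t & forall y, y \in S -> d%:R * t <= mu y / 2 /\ t <= mu y.
  apply: finite_pos => [y b b' h b'0 bb' yS|y].
    have [h1 h2] := h yS; split; last exact: le_trans h2.
    by apply: le_trans h1; rewrite ler_wpM2l.
  exists (if y \in S then mu y / 2 / (d%:R + 1) else 1).
    by case: ifP => // yS; rewrite !divr_gt0 ?mu_gt0 // ltr_wpDl.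
  move=> yS; rewrite yS; have m0 := mu_gt0 yS.
  have d0 : 0 <= d%:R :> R by [].
  split.
    rewrite mulrCA; apply: ler_piMr; first by rewrite divr_ge0 // ltW.
    by rewrite ler_pdivrMr ?ltr_wpDl // mul1r lerDl.
  by rewrite ler_pdivrMr ?ltr_wpDl //; nra.
have [t2 t20 ht2] : exists2 t, 0 < t & forall z, #|Xr|%:R * (d%:R * t) <= nu z / 2.
  apply: finite_pos => [z b b' h b'0 bb'|z].
    by apply: le_trans h; rewrite ler_wpM2l // ler_wpM2l.
  exists (nu z / 2 / (#|Xr|%:R * d%:R + 1)).
    by rewrite !divr_gt0 // ltr_wpDl // mulr_ge0.
  rewrite mulrA mulrCA; apply: ler_piMr; first by rewrite divr_ge0 // ltW.
  by rewrite ler_pdivrMr ?ltr_wpDl ?mulr_ge0 // mul1r lerDl.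
pose es := Num.min (Num.min t0 (Num.min t1 t2))
  (Num.min (e / 3 / (r%:R / l%:R * Kx + 1)) (e / 3 / (G + 1))).
have rK0 : 0 < r%:R / l%:R * Kx + 1 by rewrite ltr_wpDl // mulr_ge0 // divr_ge0.
have es0 : 0 < es by rewrite !lt_min t00 t10 t20 !divr_gt0.
(* When M is at least W, all counts on S, all n z, M and N itself exceed the Stirling threshold
   K. *)
pose W : R := \sum_(y in S) 2 * K%:R / mu y + \sum_z 2 * K%:R * (l%:R / r%:R) / nu z
  + K%:R * (l%:R / r%:R) + K%:R.
have [La La1 hLa] := window_scale W l0 es0.
exists La => // N M lN /hLa[M0 [MW _ DE MD3 _]].
set T := window R M in DE MD3 *; set D := l%:R * (T%:R + 2) / M%:R in DE MD3.
have M0R : 0 < M%:R :> R by rewrite ltr0n.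
have D0 : 0 <= D by rewrite divr_ge0 // mulr_ge0 // addr_ge0.
have [Dt0 Dt1 Dt2 MDe DG] : [/\ D <= t0, D <= t1, D <= t2,
    M%:R * D ^+ 3 <= e / 3 / (r%:R / l%:R * Kx + 1) & D <= e / 3 / (G + 1)].
  by move: DE MD3; rewrite !le_min -!andbA => /and5P[-> -> -> _ ->] /and5P[_ _ _ -> _].
have DM : D * M%:R = l%:R * (T%:R + 2) by rewrite divfK // gt_eqF.
have Tk i : (T <= cell_center M i)%N.
  rewrite -ltnS -(ltr_nat R); apply: (@lt_le_trans _ _ (T%:R + 2)); first by rewrite ltrDl.
  have -> : (cell_center M i).+1 = (Num.truncn (M%:R * mu (yy i) / l%:R)).+1 by [].
  apply: le_trans (ltW (truncnS_gt _)); rewrite ler_pdivlMr // mulrC -DM mulrC ler_pM2l //.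
  by apply: le_trans Dt1 _; have [] := ht1 (yy i) (yyS i).
split=> // rho j; set k := cell_point _ _ _ _ => /=.
pose v := deviation M k; pose a := cell_offset M (fun i => val (rho i)).
have vE : v = (l%:R / M%:R) *: lattice_pt a j by exact: deviation_cell_point.
have vD i : `|v 0 i| <= D.
  rewrite vE mxE normrM (@ger0_norm _ (l%:R / M%:R)) ?divr_ge0 // /D mulrAC.
  rewrite ler_pM2r ?invr_gt0 // ler_pM2l //; apply: lattice_pt_bound => i'; exact: cell_offset_le1.
have tD y : `|tang v y| <= d%:R * D by exact: tang_bound.
have tmu y : y \in S -> `|tang v y| <= mu y / 2.
  move=> yS; apply: le_trans (tD y) _; have [h _] := ht1 y yS.
  by apply: le_trans h; rewrite ler_wpM2l.
have kE i : (k i)%:R = M%:R * (mu (yy i) + v 0 i).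
  by rewrite mxE; field; exact: lt0r_neq0.
have kM : (\sum_i k i <= M)%N.
  rewrite -(ler_nat R) natr_sum (eq_bigr _ (fun i _ => kE i)) -mulr_sumr big_split /=.
  rewrite (sum_mu_yy Sy0 mu_supp mu1) -[leRHS]mulr1 ler_pM2l //.
  have := tmu y0 Sy0; rewrite tang_y0 normrN ler_norml => /andP[_].
  by move: (mu_gt0 Sy0); clear_local; lra.
split=> // good.
have good' : marg_residue (residue l' k) == target l' y0 M by rewrite residue_cell_point.
have sm := sum_full_type Sy0 kM.
have mS y : y \notin S -> fullM M k y = 0%N by exact: (full_type_supp Sy0).
have pE : (fun y => (fullM M k y)%:R / M%:R) =1 perturbM v by move=> y; exact: full_type_deviation.
rewrite (weight_expR (isT : (0 < l)%N) hr fS sm mS (type_avgE kM good') lN M0).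
rewrite (eq_obj _ _ pE).
have K0 : 0 <= K%:R :> R by [].
have W1 y : y \in S -> 2 * K%:R / mu y <= W.
  move=> yS; rewrite /W (bigD1 y) //= -!addrA lerDl !addr_ge0 ?mulr_ge0 ?divr_ge0 //.
    by apply: sumr_ge0 => y' /andP[y'S _]; rewrite divr_ge0 ?mulr_ge0 // ltW // mu_gt0.
  by apply: sumr_ge0 => z _; rewrite !mulr_ge0 ?invr_ge0 // ltW.
have pos1 : 0 <= \sum_(y in S) 2 * K%:R / mu y.
  by apply: sumr_ge0 => y' y'S; rewrite divr_ge0 ?mulr_ge0 // ltW // mu_gt0.
have pos2 : 0 <= \sum_z 2 * K%:R * (l%:R / r%:R) / nu z.
  by apply: sumr_ge0 => z _; rewrite !mulr_ge0 ?invr_ge0 // ltW.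
have pos3 : 0 <= K%:R * (l%:R / r%:R) :> R by rewrite mulr_ge0 // divr_ge0.
have W2 z : 2 * K%:R * (l%:R / r%:R) / nu z <= W.
  have : 2 * K%:R * (l%:R / r%:R) / nu z <= \sum_z 2 * K%:R * (l%:R / r%:R) / nu z.
    rewrite (bigD1 z) //= lerDl; apply: sumr_ge0 => z' _.
    by rewrite !mulr_ge0 ?invr_ge0 // ltW.
  by rewrite /W; move: pos1 pos3 K0; clear_local; lra.
have W3 : K%:R * (l%:R / r%:R) <= W by rewrite /W; move: pos1 pos2 K0; clear_local; lra.
have W4 : K%:R <= W by rewrite /W; move: pos1 pos2 pos3; clear_local; lra.
have NE : N%:R = r%:R / l%:R * M%:R :> R.
  apply: (mulfI (lt0r_neq0 l0)); rewrite -natrM lN natrM; field; exact: lt0r_neq0.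
have mE y : (fullM M k y)%:R = M%:R * perturbM v y.
  by rewrite -pE; field; exact: lt0r_neq0.
have pmu y : y \in S -> mu y / 2 <= perturbM v y.
  by move=> yS; move: (tmu y yS); rewrite ler_norml /perturb; clear_local; lra.
have mK y : y \in S -> (K <= fullM M k y)%N.
  move=> yS; rewrite -(ler_nat R) mE.
  have h : M%:R * (mu y / 2) <= M%:R * perturbM v y by rewrite ler_pM2l // pmu.
  apply: le_trans h; have := le_trans (W1 y yS) MW.
  rewrite ler_pdivrMr ?mu_gt0 //; clear_local; lra.
have N0 := N_gt0 (isT : (0 < l)%N) hr lN M0.
have N0R : 0 < N%:R :> R by rewrite ltr0n.
have nE z : (type_avg M k z)%:R = N%:R * marg (perturbM v) z.
  have := marg_types R (isT : (0 < l)%N) hr (type_avgE kM good') lN M0 z.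
  rewrite (eq_marg pE) => ->; field; exact: lt0r_neq0.
have nuE z : nu z = marg mu z by rewrite (nu_marg hmax) ffunE.
have margE z : marg (perturbM v) z = nu z + marg (tang v) z.
  rewrite (@eq_marg _ _ _ _ (fun y => mu y + 1 * tang v y)); last by move=> y; rewrite mul1r.
  by rewrite margD mul1r -nuE.
have nK z : (K <= type_avg M k z)%N.
  rewrite -(ler_nat R) nE margE.
  have hm : `|marg (tang v) z| <= nu z / 2.
    apply: le_trans (marg_bound hr z tD) _; apply: le_trans (ht2 z).
    by rewrite ler_wpM2l // ler_wpM2l.
  have h : N%:R * (nu z / 2) <= N%:R * (nu z + marg (tang v) z).
    by rewrite ler_pM2l //; move: hm; rewrite ler_norml; clear_local; lra.
  apply: le_trans h; have := le_trans (W2 z) MW.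
  rewrite ler_pdivrMr // NE => h.
  have : r%:R / l%:R * (2 * K%:R * (l%:R / r%:R)) <= r%:R / l%:R * (M%:R * nu z).
    by rewrite ler_pM2l // divr_gt0.
  rewrite (ratio_cancel _ (lt0r_neq0 l0) (lt0r_neq0 r0)).
  by move: (r%:R / l%:R) (nu z) (K%:R : R) => A B Kr; clear_local; lra.
have MK : (K <= M)%N by rewrite -(ler_nat R); apply: le_trans W4 MW.
have NK : (K <= N)%N.
  rewrite -(ler_nat R) NE; have := le_trans W3 MW => h.
  have : r%:R / l%:R * (K%:R * (l%:R / r%:R)) <= r%:R / l%:R * M%:R :> R.
    by rewrite ler_pM2l // divr_gt0.
  by rewrite (ratio_cancel _ (lt0r_neq0 l0) (lt0r_neq0 r0)).
have := log_corr_fine (isT : (0 < l)%N) mS (ltW e20) (ltn0Sn _) hK mK nK MK NK.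
set lc := log_corr _ _ _ _ _ _; rewrite -/P => hlc.
have hob := hKx v D Dt0 vD.
pose u y := ln (perturbM v y) - ln (mu y).
have huG : `|\sum_(y in S) u y| <= D * G.
  apply: le_trans (ler_norm_sum _ _ _) _; rewrite /G mulr_sumr; apply: ler_sum => y yS.
  apply: le_trans (ln_perturb (mu_gt0 yS) (tmu y yS)) _.
  rewrite mulrA ler_pM2r ?invr_gt0 ?mu_gt0 //; move: (tD y); clear_local; lra.
have lnm : \sum_(y in S) ln (fullM M k y)%:R = d.+1%:R * ln M%:R + \sum_(y in S) ln (mu y)
    + \sum_(y in S) u y :> R.
  have -> : d.+1%:R * ln M%:R = \sum_(y in S) ln M%:R :> R.
    by rewrite sumr_const cardS mulr_natl.
  rewrite -!big_split; apply: eq_bigr => y yS /=; rewrite mE lnM ?posrE //; last first.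
    by apply: lt_le_trans (pmu y yS); rewrite divr_gt0 ?mu_gt0.
  by rewrite /u; ring.
rewrite lnm cardS in hlc.
have sqE : (Num.sqrt M%:R)^-1 ^+ d = expR (- (d%:R / 2 * ln M%:R)) :> R.
  rewrite expRN exprVn; congr (_^-1).
  rewrite -mulrA expRM_natl; congr (_ ^+ _).
  have -> : Num.sqrt M%:R = Num.sqrt (expR (2^-1 * ln M%:R) ^+ 2) :> R.
    by rewrite -expRM_natl mulrA divff ?mul1r ?pnatr_eq0 // lnK.
  by rewrite sqrtr_sqr gtr0_norm // expR_gt0.
pose x := N%:R * obj l f (perturbM v) + lc - (N%:R * obj l f mu
  + (((#|X|%:R - 1) * ln l%:R - \sum_(y in S) ln (mu y)) / 2 - c * d%:R)
  - d%:R / 2 * ln M%:R - qf gmat (lattice_pt a j) / M%:R).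
exists x; last first.
  by rewrite sqE /pref -!expRD; congr expR; rewrite /x -/a; ring.
have qE : N%:R * (l%:R / (2 * r%:R) * qf hessM v) = qf gmat (lattice_pt a j) / M%:R.
  rewrite qf_gmat vE qfZ NE; apply: scale_cancel; exact: lt0r_neq0.
have h1 : `|N%:R * (obj l f (perturbM v) - obj l f mu + l%:R / (2 * r%:R) * qf hessM v)| <= e / 3.
  rewrite normrM (gtr0_norm N0R).
  apply: (@le_trans _ _ (N%:R * (Kx * D ^+ 3))); first by rewrite ler_pM2l.
  have -> : N%:R * (Kx * D ^+ 3) = r%:R / l%:R * Kx * (M%:R * D ^+ 3) by rewrite NE; ring.
  apply: (@le_trans _ _ ((r%:R / l%:R * Kx + 1) * (M%:R * D ^+ 3))).
    by rewrite ler_wpM2r ?lerDl // mulr_ge0 // exprn_ge0.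
  by rewrite mulrC -ler_pdivlMr.
have h2 : P * (e / 3 / (P + 1)) <= e / 3.
  by rewrite mulrCA ler_piMr ?(ltW e30) // ler_pdivrMr // mul1r lerDl.
have h3 : D * G <= e / 3.
  apply: (@le_trans _ _ (D * (G + 1))); first by rewrite ler_wpM2l // lerDl.
  by rewrite -ler_pdivlMr.
rewrite mulrDr mulrBr qE in h1.
move: h1 h2 h3 hlc huG; rewrite /x -/a -[d.+1%:R]natr1 !ler_norml.
set o1 := N%:R * obj l f (perturbM v); set o2 := N%:R * obj l f mu.
set q := qf _ _ / _; set lX := (#|X|%:R - 1) * ln l%:R; set sl := \sum_(y in S) ln (mu y).
set su := \sum_(y in S) u y; set pe := P * _; set lM := ln M%:R; set DGv := D * G.
clear_local; move=> /andP[? ?] ? ? /andP[? ?] /andP[? ?]; apply/andP; split; lra.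
Qed.

End Local.

Lemma weight_ge0 (R : realType) (X : finType) (l r : nat)
  (f : {ffun 'I_r -> X} -> R) m : (forall y, 0 <= f y) -> 0 <= weight l f m.
Proof.
move=> f0; have m0 (T : finType) (n : {ffun T -> nat}) : 0 <= mult R n.
  by rewrite /mult divr_ge0 // prodr_ge0.
rewrite /weight; apply: mulr_ge0; last exact: divr_ge0.
by apply: mulr_ge0 => //; apply: prodr_ge0 => y _; exact: exprn_ge0.
Qed.

Lemma expR_small (R : realType) (x e : R) : 0 <= e -> e <= 2^-1 -> `|x| <= e ->
  1 - e <= expR x <= 1 + 2 * e.
Proof.
move=> e0 e1; rewrite ler_norml => /andP[xl xu]; apply/andP; split.
  by apply: le_trans (expR_ge1Dx x); lra.
have h := expR_ge1Dx (- e); have p := expR_gt0 e.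
have : expR x <= expR e by rewrite ler_expR.
have : expR e * expR (- e) = 1 by rewrite -expRD subrr expR0.
nra.
Qed.

Lemma mul_rearrange (R : comRingType) (a b g h x e : R) :
  a * b * g * h * x * e = a * (x * (b * g * h)) * e.
Proof. by ring. Qed.

(** * Summation over the types *)

Section Asymptotics.
Variables (R : realType) (X : finType) (l' r : nat).
Notation l := l'.+1.
Hypothesis hr : (0 < r)%N.
Notation Xr := {ffun 'I_r -> X}.
Variable f : Xr -> R.
Hypothesis f_ge0 : forall y, 0 <= f y.
Let S : {set Xr} := [set y | 0 < f y]%SET.
Variables (nu : {ffun X -> R}) (mu : {ffun Xr -> R}).
Hypotheses (hmax : maximizer l f (nu, mu))
  (huniq : forall q, maximizer l f q -> q = (nu, mu))
  (nu_gt0 : forall x, 0 < nu x).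
Variable y0 : Xr.
Hypothesis Sy0 : y0 \in S.
Hypothesis hdet : 0 < det_factor l (nu, mu).
Notation d := #|S :\ y0|.
Notation yy := (@supp_enum X r S y0).
Notation hessM := (@hess R X l r S y0 mu).
Notation fullM := (@full_type X r S y0).
Notation centerM := (@cell_center R X l' r f mu y0).
Notation pointM := (@cell_point R X l' r f mu y0).
Notation devM := (@deviation R X r f mu y0).
Notation offsetM := (@cell_offset R X l' r f mu y0).
Notation gmatM := (@gmat R X l' r f mu y0).
Notation marg_residueM := (@marg_residue X l' r S y0).
Notation latM := (@lattice_index X l' r S y0).
Variable c : R.
Hypothesis hc : forall e : R, 0 < e -> exists K : nat, forall k, (K <= k)%N ->
  `|stirling_err R k - ln k%:R / 2 - c| <= e.
Notation prefM := (@pref R X l' r f mu y0 c).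

(** The box swept out by rho + l (center + j - T) for 0 <= rho < l and 0 <= j <= 2 T, all residues
    together. *)
Definition central M (k : 'I_d -> nat) : bool :=
  [forall i, (l * (centerM M i - window R M) <= k i)%N
             && (k i < l * (centerM M i + window R M).+1)%N].

Local Ltac clear_local :=
  clear - R X l' r hr f f_ge0 S nu mu hmax huniq nu_gt0 y0 Sy0 hdet c hc.

Lemma noncentral M (k : 'I_d -> nat) : (0 < M)%N ->
  (forall i, (window R M <= centerM M i)%N) -> ~~ central M k ->
  exists i, (window R M)%:R / M%:R <= `|devM M k 0 i|.
Proof.
move=> M0 hT; rewrite negb_forall => /existsP[i hi]; exists i.
have M0R : 0 < M%:R :> R by rewrite ltr0n.
have l0 : 0 < l%:R :> R by rewrite ltr0n.
have m0 : 0 < mu (yy i).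
  apply: (maximizer_gt0 (isT : (0 < l)%N) hr f_ge0 hmax nu_gt0 Sy0); exact: yyS.
have p0 : 0 <= M%:R * mu (yy i) / l%:R by rewrite divr_ge0 // mulr_ge0 // ltW.
have h1 := truncn_le (M%:R * mu (yy i) / l%:R); rewrite p0 in h1.
have h2 := truncnS_gt (M%:R * mu (yy i) / l%:R).
rewrite -/(centerM M i) ler_pdivlMr // in h1; rewrite -/(centerM M i) ltr_pdivrMr // in h2.
have TE : (window R M)%:R <= l%:R * (window R M)%:R :> R by rewrite ler_peMl // ler1n.
have fE : devM M k 0 i = ((k i)%:R - M%:R * mu (yy i)) / M%:R.
  by rewrite mxE; field; exact: lt0r_neq0.
rewrite fE normrM normfV (gtr0_norm M0R) ler_pM2r ?invr_gt0 //.
move: hi; rewrite negb_and -!ltnNge ltnS => /orP[hi|hi].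
  have : (k i)%:R + l%:R * (window R M)%:R <= (centerM M i)%:R * l%:R :> R.
    rewrite -!natrM -natrD ler_nat; have := hT i; move: hi.
    set T := window R M; set K := centerM M i; nia.
  rewrite ler_normr => h; apply/orP; right; lra.
have : ((centerM M i).+1)%:R * l%:R + l%:R * (window R M)%:R <= (k i)%:R :> R.
  by rewrite -!natrM -natrD ler_nat; move: hi; nia.
rewrite ler_normr => h; apply/orP; left; lra.
Qed.

(** Euclidean division by l in each coordinate separates the residue, which carries the divisibility
    condition, from the free index j. *)
Lemma central_sum M (F : ('I_d -> nat) -> R) :
  (forall k k', k =1 k' -> F k = F k') ->
  (forall i, (window R M <= centerM M i)%N) ->
  (forall (rho : {ffun 'I_d -> 'I_l}) (j : {ffun 'I_d -> 'I_(2 * window R M).+1}),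
    (\sum_i pointM M (fun i => val (rho i)) (window R M) (fun i => val (j i)) i <= M)%N) ->
  \sum_(k : {ffun 'I_d -> 'I_M.+1} | ((\sum_i k i <= M)%N
       && (marg_residueM (residue l' (fun i => val (k i))) == target l' y0 M))
       && central M (fun i => val (k i))) F (fun i => val (k i)) =
  \sum_(rho | marg_residueM rho == target l' y0 M)
    \sum_(j : {ffun 'I_d -> 'I_(2 * window R M).+1})
     F (pointM M (fun i => val (rho i)) (window R M) (fun i => val (j i))).
Proof.
set T := window R M => Fext hT hM.
pose pt (p : {ffun 'I_d -> 'I_l} * {ffun 'I_d -> 'I_(2 * T).+1}) i :=
  pointM M (fun i => val (p.1 i)) T (fun i => val (p.2 i)) i.
pose h p : {ffun 'I_d -> 'I_M.+1} := [ffun i => inord (pt p i)].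
pose g (k : {ffun 'I_d -> 'I_M.+1}) : {ffun 'I_d -> 'I_l} * {ffun 'I_d -> 'I_(2 * T).+1} :=
  ([ffun i => inZp (k i)], [ffun i => inord (k i %/ l + T - centerM M i)]).
have hE p i : val (h p i) = pt p i.
  rewrite ffunE /= inordK // ltnS; apply: leq_trans (hM p.1 p.2).
  by rewrite (bigD1 i) //= leq_addr.
have ptdiv p i : (pt p i %/ l = centerM M i + p.2 i - T)%N.
  by rewrite /pt /cell_point addnC (mulnC l) divnMDl // (divn_small (ltn_ord (p.1 i))) addn0.
rewrite pair_big_dep /= (reindex_onto h g) /=; last first.
  move=> k /andP[_ /forallP hk]; apply/ffunP => i; apply: val_inj; rewrite hE.
  have /andP[h1 h2] := hk i; rewrite -/T in h1 h2.
  have e1 : (centerM M i - T <= k i %/ l)%N by rewrite leq_divRL // mulnC.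
  have e2 : (k i %/ l < (centerM M i + T).+1)%N by rewrite ltn_divLR // mulnC.
  have e3 : val ((g k).2 i) = (k i %/ l + T - centerM M i)%N.
    by rewrite ffunE /= inordK //; have := hT i; lia.
  have e4 : val ((g k).1 i) = (k i %% l)%N by rewrite ffunE.
  rewrite /pt /cell_point e3 e4.
  have -> : (centerM M i + (k i %/ l + T - centerM M i) - T = k i %/ l)%N.
    by have := hT i; rewrite -/T; lia.
  by rewrite addnC mulnC -divn_eq.
apply: eq_big => [p|p _]; last by apply: Fext => i; rewrite hE.
have -> : g (h p) = p.
  case: p => rho j; congr (_, _); apply/ffunP => i; apply: val_inj; rewrite ffunE.
    have /ffunP := @residue_cell_point R X l' r f mu y0 M rho T (fun i => val (j i)) => /(_ i).
    by rewrite ffunE => e; rewrite -[in RHS]e hE.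
  rewrite /= hE ptdiv /= inordK; have := hT i; rewrite -/T; have := ltn_ord (j i).
    lia.
  lia.
rewrite eqxx andbT.
have -> : (\sum_i h p i <= M)%N.
  by rewrite (eq_bigr (pt p)) => [|i _]; [exact: hM | exact: hE].
have -> : residue l' (fun i => val (h p i)) = p.1.
  rewrite -[RHS](@residue_cell_point R X l' r f mu y0 M p.1 T (fun i => val (p.2 i))).
  by apply/ffunP => i; rewrite [LHS]ffunE [RHS]ffunE hE.
have -> : central M (fun i => val (h p i)).
  apply/forallP => i; rewrite hE -/T.
  have e := divn_eq (pt p i) l; rewrite ptdiv in e.
  have lt := ltn_pmod (pt p i) (isT : (0 < l)%N); have := hT i; rewrite -/T.
  have := ltn_ord (p.2 i); rewrite e; set q := (_ %% _)%N in lt *.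
  by move: (centerM M i) (nat_of_ord (p.2 i)) lt => K J; clear_local; nia.
by rewrite !andbT.
Qed.

Lemma gmat_pos : posdef gmatM.
Proof.
have hp := hess_posdef (isT : (0 < l)%N) hr f_ge0 hmax nu_gt0 Sy0 hdet.
move=> x x0; rewrite qf_gmat mulr_gt0 ?divr_gt0 ?exprn_gt0 ?ltr0n //.
exact: hp.
Qed.

Lemma gmat_sym : gmatM^T = gmatM.
Proof. by rewrite /gmat linearZ /= tr_hess. Qed.

Lemma asymptotics (e : R) : 0 < e -> exists La : R, forall N M,
  (l * N = r * M)%N -> La <= ln M%:R -> 0 < expected_Z l f N ->
  `|expected_Z l f N * expR (- (N%:R * obj l f mu))
    - prefM * (l%:R ^+ d / latM%:R) * (Num.sqrt pi ^+ d / Num.sqrt (\det gmatM))|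
   <= e.
Proof.
move=> e0.
have [dg0 hg] := gsum_cvg gmat_sym gmat_pos.
set L0 := Num.sqrt pi ^+ d / Num.sqrt (\det gmatM) in hg *.
have L00 : 0 < L0 by rewrite divr_gt0 ?exprn_gt0 ?sqrtr_gt0 ?pi_gt0.
have s0 : 0 < latM%:R :> R by rewrite ltr0n lattice_index_gt0.
pose g0 : R := l%:R ^+ d / latM%:R.
have g00 : 0 < g0 by rewrite divr_gt0 // exprn_gt0 ltr0n.
have pf0 : 0 < prefM by exact: expR_gt0.
pose B := g0 * prefM * (2 * L0 + 3).
have B0 : 0 < B by apply: mulr_gt0; [exact: mulr_gt0 | apply: addr_gt0 => //; exact: mulr_gt0].
(* A relative error between 1 - dl and 1 + 2 dl on each weight and an error dl on the Gaussian sum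
   cost at most dl (2 L0 + 3) per class; [B] adds this up over the g0 classes. *)
pose dl := Num.min 2^-1 (e / (2 * B)).
have dl0 : 0 < dl by rewrite lt_min invr_gt0 ltr0n /= divr_gt0 // mulr_gt0.
have dlh : dl <= 2^-1 by rewrite ge_min lexx.
have dle : dl * B <= e / 2.
  have : dl * (2 * B) <= e by rewrite -ler_pdivlMr; [rewrite /dl ge_min lexx orbT | exact: mulr_gt0].
  lra.
have [La1 La11 hcen] := central_weight hr f_ge0 hmax nu_gt0 Sy0 hc dl0.
have [W [M0' [W0 M01 hgs]]] := hg 1 dl ler01 dl0.
have [La2 La21 hsc] := @window_scale R 1 (W + M0') 1 ltr01 ltr01.
have [C1 [C2 [c3 [C10 C20 c30 htail]]]] := tail_weight hr f_ge0 hmax huniq nu_gt0 Sy0 hdet.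
(* From here on, c3 (ln M)^2 absorbs C1 + C2 ln M and the number (M + 1)^d of types, leaving a tail
   of at most 1 / M; the term 2 / e in the threshold then brings it below e / 2. *)
pose La3 := (C1 + C2 + 2 * d%:R + 1) / c3.
have La30 : 0 <= La3 by rewrite divr_ge0 ?addr_ge0 ?mulr_ge0 // ltW.
have e20 : 0 < 2 / e by rewrite divr_gt0.
exists (La1 + La2 + La3 + 2 / e) => N M lN hla Zpos.
set x := ln M%:R in hla *.
have hx1 : La1 <= x by move: hla La21 La30 e20; clear_local; lra.
have hx2 : La2 <= x by move: hla La11 La30 e20; clear_local; lra.
have hx3 : La3 <= x by move: hla La11 La21 e20; clear_local; lra.
have hx4 : 2 / e <= x by move: hla La11 La21 La30; clear_local; lra.
have x1 : 1 <= x by apply: le_trans hx1.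
have [hT hcen2] := hcen N M lN hx1.
have [M0 [MW MWs _ _ T2]] := hsc M hx2.
have M0R : 0 < M%:R :> R by rewrite ltr0n.
set T := window R M in hT hcen2 MWs T2.
have M0M : M0' <= M%:R by move: MW W0; clear_local; lra.
have WT : W * Num.sqrt M%:R <= T%:R.
  apply: le_trans MWs; rewrite ler_wpM2r ?sqrtr_ge0 // lerDl.
  by apply: le_trans M01; exact: ler01.
have rl : (r %| l * N)%N by rewrite lN dvdn_mulr.
have nfE : nfactor l r N = M by rewrite /nfactor lN mulKn.
have fN0 y : y \notin S -> f y = 0 by exact: f_supp0.
have ZE := expected_Z_supp Sy0 hr fN0 rl.
rewrite nfE in ZE.
(* Positivity of the expectation is what guarantees that some residue class satisfies the
   divisibility condition. *)
have [rho0 hrho0] : exists rho0, marg_residueM rho0 == target l' y0 M.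
  apply/existsP; apply: contraLR Zpos; rewrite negb_exists => /forallP h.
  rewrite ZE big1 ?ltxx // => k /andP[_ hk].
  by have := h (residue l' (fun i => val (k i))); rewrite hk.
have gE : #|[set rho | marg_residueM rho == target l' y0 M]%SET|%:R = g0.
  have := card_fiber rho0; rewrite (eqP hrho0) => h.
  by rewrite /g0 -natrX -h natrM mulfK // gt_eqF.
pose eN := expR (- (N%:R * obj l f mu)).
have eN0 : 0 < eN by exact: expR_gt0.
have eNK Y : expR (N%:R * obj l f mu) * Y * eN = Y.
  by rewrite mulrAC -expRD subrr expR0 mul1r.
have Fext (k k' : 'I_d -> nat) : k =1 k' -> weight l f (fullM M k) = weight l f (fullM M k').
  move=> ek; congr weight; apply/ffunP => y; rewrite !ffunE.
  by rewrite !(eq_bigr _ (fun i _ => ek i)); congr (_ + _)%N; apply: eq_bigr => i _; rewrite ek.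
rewrite -/eN ZE (bigID (fun k : {ffun 'I_d -> 'I_M.+1} => central M (fun i => val (k i)))) /=.
rewrite (central_sum (F := fun k => weight l f (fullM M k)) Fext hT); last first.
  by move=> rho j; have [] := hcen2 rho j.
rewrite -/T mulrDl; set tail := \sum_(k | _ && ~~ _) _.
have tail0 : 0 <= tail by apply: sumr_ge0 => k _; exact: weight_ge0.
have taile : tail * eN <= e / 2.
  pose bd := expR (C1 + C2 * x - c3 * x ^+ 2).
  have h1 : tail * eN <= \sum_(k : {ffun 'I_d -> 'I_M.+1}) bd.
    rewrite /tail mulr_suml [leRHS](bigID (fun k : {ffun 'I_d -> 'I_M.+1} => (((\sum_i k i <= M)%N
       && (marg_residueM (residue l' (fun i => val (k i))) == target l' y0 M))
       && ~~ central M (fun i => val (k i))))) /=.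
    apply: (@le_trans _ _ (\sum_(k : {ffun 'I_d -> 'I_M.+1} | (((\sum_i k i <= M)%N
       && (marg_residueM (residue l' (fun i => val (k i))) == target l' y0 M))
       && ~~ central M (fun i => val (k i)))) bd)); last first.
      by rewrite lerDl sumr_ge0 // => k _; exact: expR_ge0.
    apply: ler_sum => k /andP[/andP[kM good] nc].
    have [i hi] := noncentral M0 hT nc.
    have := htail N M (fun i => val (k i)) lN M0 T2 kM good i hi.
    by move/(ler_wpM2r (ltW eN0)); rewrite eNK.
  apply: le_trans h1 _; rewrite sumr_const card_ffun !card_ord -[_ *+ _]mulr_natl natrX.
  have h2 : M.+1%:R <= expR (x + 1).
    rewrite expRD /x lnK // -natr1; have := expR_ge1Dx (1 : R).
    have : 1 <= M%:R :> R by rewrite ler1n.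
    by clear_local; nra.
  have h3 : M.+1%:R ^+ d <= expR (d%:R * (x + 1)).
    by rewrite expRM_natl lerXn2r ?nnegrE ?expR_ge0.
  apply: (@le_trans _ _ (expR (d%:R * (x + 1)) * bd)).
    by rewrite ler_wpM2r // expR_ge0.
  rewrite /bd -expRD.
  have h4 : d%:R * (x + 1) + (C1 + C2 * x - c3 * x ^+ 2) <= - x.
    have : C1 + C2 + 2 * d%:R + 1 <= c3 * x by rewrite -ler_pdivrMl // mulrC.
    have d0 : 0 <= d%:R :> R by [].
    have x0 : 0 <= x by apply: le_trans x1; exact: ler01.
    move/(ler_wpM2r x0).
    have : C1 <= C1 * x by rewrite ler_peMr.
    have : d%:R <= d%:R * x :> R by rewrite ler_peMr.
    by move: (d%:R : R) => D; clear_local; lra.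
  apply: (@le_trans _ _ (expR (- x))); first by rewrite ler_expR.
  have x0 : 0 < x by apply: lt_le_trans x1; exact: ltr01.
  rewrite expRN; apply: (@le_trans _ _ x^-1).
    by rewrite lef_pV2 ?posrE ?expR_gt0 //; apply: le_trans (expR_ge1Dx x); rewrite lerDr.
  by rewrite -(invf_div 2 e) lef_pV2 ?posrE.
have Zrho rho : marg_residueM rho == target l' y0 M ->
    `|(\sum_(j : {ffun 'I_d -> 'I_(2 * T).+1})
       weight l f (fullM M (pointM M (fun i => val (rho i)) T (fun i => val (j i))))) * eN
      - prefM * L0| <= prefM * (dl * (2 * L0 + 3)).
  move=> good; set Zr := _ * eN.
  have aB i : `|offsetM M (fun i => val (rho i)) 0 i| <= 1.
    exact: (cell_offset_le1 hr f_ge0 hmax nu_gt0 Sy0).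
  have := hgs _ T _ M0M WT aB; set a := offsetM _ _ in aB *.
  set Y := _ * gsum _ _ _ _ => hY.
  have termE (j : {ffun 'I_d -> 'I_(2 * T).+1}) :
      let q := prefM * (Num.sqrt M%:R)^-1 ^+ d * expR (- qf gmatM (lattice_pt a j) / M%:R) in
      let w := weight l f (fullM M (pointM M (fun i => val (rho i)) T (fun i => val (j i)))) * eN in
      (1 - dl) * q <= w <= (1 + 2 * dl) * q.
    move=> q w; have [_ /(_ good)[z hz wE]] := hcen2 rho j.
    have q0 : 0 <= q by rewrite !mulr_ge0 ?expR_ge0 ?exprn_ge0 ?invr_ge0 ?sqrtr_ge0 // ltW.
    have -> : w = expR z * q.
      rewrite /w wE -/a -[RHS](eNK (expR z * q)) /q; exact: mul_rearrange.
    have /andP[z1 z2] := expR_small (ltW dl0) dlh hz.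
    by rewrite !ler_wpM2r.
  have sq : \sum_(j : {ffun 'I_d -> 'I_(2 * T).+1})
      prefM * (Num.sqrt M%:R)^-1 ^+ d * expR (- qf gmatM (lattice_pt a j) / M%:R) = prefM * Y.
    by rewrite -mulr_sumr -mulrA.
  have up : Zr <= (1 + 2 * dl) * (prefM * Y).
    rewrite /Zr mulr_suml -sq mulr_sumr; apply: ler_sum => j _.
    by have /andP[] := termE j.
  have lo : (1 - dl) * (prefM * Y) <= Zr.
    rewrite /Zr mulr_suml -sq mulr_sumr; apply: ler_sum => j _.
    by have /andP[] := termE j.
  move: hY; rewrite -/L0 !ler_norml => /andP[y1 y2].
  move: up lo pf0 dl0 dlh L00 y1 y2; move: (prefM) (L0) (dl) (Y) (Zr) => p L D' y z.
  clear_local; move=> up lo p0 D0 D1 L00 y1 y2.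
  have u1 : (1 + 2 * D') * y <= L + D' * (2 * L + 3) by nra.
  have u2 : L - D' * (2 * L + 3) <= (1 - D') * y by nra.
  have := ler_wpM2l (ltW p0) u1; have := ler_wpM2l (ltW p0) u2.
  by move=> v2 v1; apply/andP; split; lra.
have cenE : `|(\sum_(rho | marg_residueM rho == target l' y0 M)
    \sum_(j : {ffun 'I_d -> 'I_(2 * T).+1})
       weight l f (fullM M (pointM M (fun i => val (rho i)) T (fun i => val (j i))))) * eN
     - prefM * g0 * L0| <= e / 2.
  have -> : prefM * g0 * L0 = \sum_(rho | marg_residueM rho == target l' y0 M) prefM * L0.
    rewrite sumr_const -mulr_natl.
    rewrite (_ : #|_| = #|[set rho | marg_residueM rho == target l' y0 M]%SET|); last first.
      by apply: eq_card => rho; rewrite inE.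
    by rewrite gE; ring.
  rewrite mulr_suml -sumrB; apply: le_trans (ler_norm_sum _ _ _) _.
  apply: (@le_trans _ _ (\sum_(rho | marg_residueM rho == target l' y0 M) prefM * (dl * (2 * L0 + 3)))).
    by apply: ler_sum => rho; exact: Zrho.
  rewrite sumr_const -[_ *+ #|_|]mulr_natl.
  rewrite (_ : #|_| = #|[set rho | marg_residueM rho == target l' y0 M]%SET|); last first.
    by apply: eq_card => rho; rewrite inE.
  by rewrite gE; move: dle; rewrite /B; clear_local; lra.
move: cenE tail0 taile; set Zc := (\sum_(rho | _) _) * eN; rewrite !ler_norml.
move=> /andP[c1 c2] t0 t1; have t2 : 0 <= tail * eN by rewrite mulr_ge0 // ltW.
move: c1 c2 t1 t2; rewrite -/g0; clear_local; move=> c1 c2 t1 t2.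
by apply/andP; split; lra.
Qed.

End Asymptotics.

(** * The limit in closed form *)

Definition leading (R : realType) (X : finType) (l r : nat)
    (f : {ffun 'I_r -> X} -> R) (p : {ffun X -> R} * {ffun {ffun 'I_r -> X} -> R})
    (s N : nat) : R :=
  expR (N%:R * fine (max_objective l f)) * l%:R `^ ((#|X|%:R - 1) / 2) * s%:R^-1
  * det_factor l p `^ (- 2^-1).

Lemma ln_prod (R : realType) (n : nat) (F : 'I_n -> R) : (forall i, 0 < F i) ->
  ln (\prod_i F i) = \sum_i ln (F i).
Proof.
move=> F0; have [] : 0 < \prod_i F i /\ ln (\prod_i F i) = \sum_i ln (F i); last by [].
elim/big_rec2: _ => [|i x y _ [y0 <-]]; first by rewrite ln1.
by rewrite mulr_gt0 // lnM ?posrE.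
Qed.

Lemma powR_expR (R : realType) (a x : R) : 0 < a -> a `^ x = expR (x * ln a).
Proof. by move=> a0; rewrite /powR gt_eqF. Qed.

Section Leading.
Variables (R : realType) (X : finType) (l' r : nat).
Notation l := l'.+1.
Hypothesis hr : (0 < r)%N.
Notation Xr := {ffun 'I_r -> X}.
Variable f : Xr -> R.
Hypothesis f_ge0 : forall y, 0 <= f y.
Let S : {set Xr} := [set y | 0 < f y]%SET.
Variables (nu : {ffun X -> R}) (mu : {ffun Xr -> R}).
Hypotheses (hmax : maximizer l f (nu, mu))
  (huniq : forall q, maximizer l f q -> q = (nu, mu))
  (nu_gt0 : forall x, 0 < nu x).
Variable y0 : Xr.
Hypothesis Sy0 : y0 \in S.
Hypothesis hdet : 0 < det_factor l (nu, mu).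
Notation d := #|S :\ y0|.
Notation latM := (@lattice_index X l' r S y0).
Variable c : R.
Hypothesis hc : forall e : R, 0 < e -> exists K : nat, forall k, (K <= k)%N ->
  `|stirling_err R k - ln k%:R / 2 - c| <= e.

Let lnmu : \sum_(y in S) ln (mu y) =
  ln (mu y0 * \prod_(i < d) mu (@supp_enum X r S y0 i)).
Proof.
have mu0 := maximizer_gt0 (isT : (0 < l)%N) hr f_ge0 hmax nu_gt0 Sy0.
rewrite (big_supp Sy0) lnM ?posrE ?mu0 //; last first.
  by apply: prodr_gt0 => i _; apply: mu0; exact: yyS.
by rewrite ln_prod // => i; apply: mu0; exact: yyS.
Qed.

(** The l^d from the number of classes cancels against the square root of (l^2)^d in det [gmat]; the
    product of the mu(y) joins the Hessian determinant to form [det_factor]. What remains is (2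
    pi)^(d / 2) exp (-c d). *)
Lemma limit_const :
  @pref R X l' r f mu y0 c * (l%:R ^+ d / latM%:R)
  * (Num.sqrt pi ^+ d / Num.sqrt (\det (@gmat R X l' r f mu y0))) =
  l%:R `^ ((#|X|%:R - 1) / 2) * latM%:R^-1 * det_factor l (nu, mu) `^ (- 2^-1)
  * expR (d%:R * ((ln 2 + ln pi) / 2 - c)).
Proof.
have l0 : 0 < l%:R :> R by rewrite ltr0n.
have hess0 := det_hess_gt0 (isT : (0 < l)%N) hr f_ge0 hmax nu_gt0 Sy0 hdet.
have mu0 := prod_mu_gt0 (isT : (0 < l)%N) hr f_ge0 hmax nu_gt0 Sy0.
have pi0 := pi_gt0 R.
have k0 : 0 < l%:R ^+ 2 / 2 :> R by rewrite divr_gt0 // exprn_gt0.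
rewrite -(det_hess_factor (isT : (0 < l)%N) hr f_ge0 hmax nu_gt0 Sy0) /gmat detZ.
rewrite -[Num.sqrt (_ * _)]powR12_sqrt ?mulr_ge0 ?exprn_ge0 ?(ltW k0) ?(ltW hess0) //.
rewrite -[Num.sqrt pi]powR12_sqrt ?(ltW pi0) // /pref lnmu.
set P := mu y0 * _ in mu0 *; set D := \det _ in hess0 *; clearbody P D.
have L0 : 0 < (l%:R ^+ 2 / 2) ^+ d * D by rewrite mulr_gt0 // exprn_gt0.
rewrite !powR_expR //; last exact: mulr_gt0.
rewrite (lnM hess0 mu0) lnM ?posrE ?exprn_gt0 //.
rewrite lnXn // lnM ?posrE ?invr_gt0 ?exprn_gt0 // lnXn // lnV ?posrE // -expRM_natl.
rewrite -{2}[l%:R](@lnK R) ?posrE // -expRM_natl -expRN.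
transitivity (latM%:R^-1 * expR
   (((#|X|%:R - 1) * ln l%:R - ln P) / 2 - c * d%:R + d%:R * ln l%:R
    + d%:R * (2^-1 * ln pi) - 2^-1 * ((ln l%:R *+ 2 - ln 2) *+ d + ln D))).
  by rewrite !expRD; ring.
rewrite [_ / latM%:R]mulrC -!mulrA; congr (_ * _).
rewrite -!expRD; congr expR.
by rewrite -[_ *+ d]mulr_natl; field.
Qed.

Lemma expected_Z_ratio (e : R) : 0 < e -> exists N0, forall N, (N0 <= N)%N ->
  (r %| l * N)%N -> 0 < expected_Z l f N ->
  `|expected_Z l f N
    / (leading l f (nu, mu) latM N * expR (d%:R * ((ln 2 + ln pi) / 2 - c))) - 1| <= e.
Proof.
move=> e0; set g := expR (d%:R * _).
pose K := l%:R `^ ((#|X|%:R - 1) / 2) * latM%:R^-1 * det_factor l (nu, mu) `^ (- 2^-1) * g.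
have K0 : 0 < K.
  by rewrite !mulr_gt0 ?expR_gt0 ?powR_gt0 ?invr_gt0 ?ltr0n ?lattice_index_gt0.
have [La hLa] := asymptotics hr f_ge0 hmax huniq nu_gt0 Sy0 hdet hc (mulr_gt0 e0 K0).
(* Converts the threshold on ln M into one on N, as M = l N / r is at least N / r. *)
exists (r * (Num.truncn (expR La)).+1)%N => N hN hrN Zpos.
have lN : (l * N = r * ((l * N) %/ r))%N by rewrite [RHS]mulnC divnK.
have := hLa N _ lN; rewrite limit_const -/g -/K => /(_ _ Zpos) h.
have {h} : `|expected_Z l f N * expR (- (N%:R * obj l f mu)) - K| <= e * K.
  apply: h; rewrite -[La]expRK ler_ln ?posrE ?expR_gt0 //.
    apply: le_trans (ltW (truncnS_gt (expR La))) _; rewrite ler_nat leq_divRL //.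
    by rewrite mulnC; apply: leq_trans hN _; rewrite leq_pmull.
  rewrite ltr0n divn_gt0 //; apply: leq_trans (leq_trans hN _); first by rewrite leq_pmulr.
  by rewrite leq_pmull.
rewrite /leading (max_objectiveE (isT : (0 < l)%N) hr f_ge0 hmax Sy0) /=.
set E := expR (N%:R * obj l f mu); have E0 : 0 < E by exact: expR_gt0.
rewrite expRN -/E => h.
have -> : E * l%:R `^ ((#|X|%:R - 1) / 2) * latM%:R^-1
  * det_factor l (nu, mu) `^ (- 2^-1) * g = E * K by rewrite /K !mulrA.
have -> : expected_Z l f N / (E * K) - 1 = (expected_Z l f N * E^-1 - K) / K.
  by field; rewrite !gt_eqF.
by rewrite normrM normfV (gtr0_norm K0) ler_pdivrMr.
Qed.

End Leading.

(** * The constant in Stirling's formula *)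

Section Calibration.
Variable R : realType.

(** Termwise form of the Gibbs inequality against the uniform law 1 / n, from exp u >= 1 + u, strict
    for nonzero u. *)
Lemma gibbs_term (n : R) (x : R) : 0 < n -> 0 <= x ->
  0 <= x * ln (n * x) - x + n^-1 /\ (x * ln (n * x) - x + n^-1 = 0 -> x = n^-1).
Proof.
move=> n0; rewrite le_eqVlt => /predU1P[<-|x0].
  by rewrite mul0r subr0 add0r invr_ge0 ltW // => _; split.
have nx : 0 < n * x by exact: mulr_gt0.
have e : x * ln (n * x) - x + n^-1 = x * ((n * x)^-1 - 1 - ln (n * x)^-1).
  by rewrite lnV ?posrE //; field; rewrite !gt_eqF.
have v0 : 0 < (n * x)^-1 by rewrite invr_gt0.
rewrite e; set v := (n * x)^-1 in v0 *; have lv := lnK v0; split.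
  by rewrite mulr_ge0 ?(ltW x0) // -{1}lv; have := expR_ge1Dx (ln v); lra.
move=> /eqP; rewrite mulf_eq0 gt_eqF //= => /eqP h.
have l0 : ln v = 0.
  apply/eqP; apply: contraT => l0; have := expR_gt1Dx l0; rewrite lv; lra.
have : v = 1 by rewrite -lv l0 expR0.
move/(congr1 GRing.inv); rewrite invrK invr1 => h1.
by apply: (mulfI (lt0r_neq0 n0)); rewrite h1 divff // gt_eqF.
Qed.

Lemma entropy_max (T : finType) (p : {ffun T -> R}) : is_dist p ->
  entropy p <= ln #|T|%:R /\
  (entropy p = ln #|T|%:R -> forall t, p t = #|T|%:R^-1).
Proof.
move=> [p0 p1]; have n0 : 0 < #|T|%:R :> R.
  rewrite ltr0n; apply/card_gt0P/existsP; apply: contraT; rewrite negb_exists => /forallP h.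
  by move: p1; rewrite big1 => [/eqP|t]; [rewrite eq_sym oner_eq0 | have := h t].
set n := #|T|%:R in n0 *.
pose F t := p t * ln (n * p t) - p t + n^-1.
have F0 t : 0 <= F t by have [] := gibbs_term n0 (p0 t).
have sF : \sum_t F t = ln n - entropy p.
  rewrite big_split sumrB /= p1 sumr_const -[_ *+ #|T|]mulr_natl divff ?gt_eqF // subrK.
  rewrite /entropy opprK -[ln n]mul1r -p1 mulr_suml -big_split; apply: eq_bigr => t _ /=.
  have := p0 t; rewrite le_eqVlt => /predU1P[<-|pt]; first by rewrite !mul0r addr0.
  by rewrite lnM ?posrE // mulrDr.
split; first by rewrite -subr_ge0 -sF sumr_ge0.
move=> e t; have [_] := gibbs_term n0 (p0 t); apply.
have /eqP : \sum_t F t = 0 by rewrite sF e subrr.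
rewrite psumr_eq0 // => /allP/(_ t); rewrite mem_index_enum => /(_ isT)/eqP.
exact.
Qed.

Let f1 : {ffun 'I_1 -> bool} -> R := fun=> 1.
Let nu1 : {ffun bool -> R} := [ffun=> 2^-1].
Let mu1 : {ffun {ffun 'I_1 -> bool} -> R} := [ffun=> 2^-1].

Let card_X1 : #|{ffun 'I_1 -> bool}| = 2%N.
Proof. by rewrite card_ffun card_ord card_bool. Qed.

Let objective1 p : objective 1 f1 p = (entropy p.2)%:E.
Proof.
rewrite /objective big1 ?mule0 ?adde0; last by move=> y _; rewrite /f1 lne1 mule0.
by rewrite divr1 mul1r subrr mul0r subr0.
Qed.

Let entropy1 : entropy mu1 = ln 2.
Proof.
rewrite /entropy (eq_bigr (fun=> 2^-1 * ln 2^-1)) => [|y _]; last by rewrite ffunE.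
by rewrite sumr_const card_X1 lnV ?posrE // mulrN mulNrn opprK -mulrnAl -[2^-1 *+ 2]mulr_natl divff ?mul1r.
Qed.

Let marg1 (q : {ffun {ffun 'I_1 -> bool} -> R}) z :
  1%:R^-1 * \sum_(i < 1) \sum_(x : {ffun 'I_1 -> bool} | x i == z) q x = q [ffun=> z].
Proof.
rewrite invr1 mul1r big_ord1 (bigD1 [ffun=> z]) ?ffunE //= big1 ?addr0 // => x /andP[/eqP xz].
by case/negP; apply/eqP/ffunP => i; rewrite ffunE (ord1 i).
Qed.

Let feasible1 : feasible (nu1, mu1).
Proof.
split => [||z]; last by rewrite marg1 !ffunE.
- by split=> [x|]; rewrite ?ffunE //= big_bool /= !ffunE -mulr2n -[2^-1 *+ 2]mulr_natl divff.
- split=> [x|]; first by rewrite ffunE.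
  rewrite (eq_bigr (fun=> 2^-1)) => [|y _]; last by rewrite ffunE.
  by rewrite sumr_const card_X1 -[2^-1 *+ 2]mulr_natl divff.
Qed.

Let maximizer1 : maximizer 1 f1 (nu1, mu1).
Proof.
split=> [|q [_ dq _]]; first exact: feasible1.
rewrite !objective1 entropy1 lee_fin; have [] := entropy_max dq.
by rewrite card_X1.
Qed.

Let unique1 q : maximizer 1 f1 q -> q = (nu1, mu1).
Proof.
case: q => q1 q2 [[_ dq hq] /(_ _ feasible1)]; rewrite !objective1 entropy1 lee_fin /= => le2.
have q2E : q2 = mu1.
  have [ub eq] := entropy_max dq; rewrite card_X1 in ub eq.
  by apply/ffunP => y; rewrite ffunE eq //; apply/le_anti; rewrite ub.
congr (_, _) => //; apply/ffunP => z; rewrite -hq /= marg1 q2E !ffunE //.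
Qed.

Let det1 : det_factor 1 (nu1, mu1) = 1.
Proof.
rewrite /det_factor (_ : C_mx _ _ _ = 0) ?mul0mx ?subr0 ?det1 //.
by apply/matrixP => i j; rewrite !mxE subrr mulr0 mul0r; case: ifP.
Qed.

Let expected1 N : expected_Z 1 f1 N = 2 ^+ N.
Proof.
rewrite /expected_Z (eq_bigr (fun=> 2 ^+ N)) => [|g _].
  rewrite sumr_const -[_ *+ _]mulr_natr mulfK // pnatr_eq0 -lt0n; apply/card_gt0P.
  have e : nfactor 1 1 N = N by rewrite /nfactor mul1n divn1.
  exists [ffun p => (cast_ord e p.1, p.2)]; apply: bijs_bijective.
  exists (fun p => (cast_ord (esym e) p.1, p.2)) => [[a b]|[a b]].
    by rewrite ffunE /= cast_ordK.
  by rewrite ffunE /= cast_ordKV.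
rewrite /partition_fun (eq_bigr (fun=> 1)) => [|x _]; last by rewrite big1.
by rewrite sumr_const card_ffun card_bool card_ord -natrX.
Qed.

(** In this example d = 1, the index and determinant are 1, and both the expectation and the leading
    term equal 2^N. The ratio is thus constantly exp (c - (ln 2 + ln pi) / 2), yet must tend to
    1. *)
Lemma stirling_const (c : R) :
  (forall e : R, 0 < e -> exists K : nat, forall k, (K <= k)%N ->
    `|stirling_err R k - ln k%:R / 2 - c| <= e) ->
  c = (ln 2 + ln pi) / 2.
Proof.
move=> hc; pose y0 : {ffun 'I_1 -> bool} := [ffun=> true].
have Sy0 : y0 \in [set y | 0 < f1 y]%SET by rewrite inE ltr01.
have f0 y : 0 <= f1 y by exact: ler01.
have n0 x : 0 < nu1 x by rewrite ffunE invr_gt0.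
have D0 : 0 < det_factor 1 (nu1, mu1) by rewrite det1.
have St : [set y | 0 < f1 y]%SET = [set: {ffun 'I_1 -> bool}]%SET.
  by apply/setP => y; rewrite !inE ltr01.
have dE : #|[set y | 0 < f1 y]%SET :\ y0| = 1%N.
  by have := cardsD1 y0 [set y | 0 < f1 y]%SET; rewrite Sy0 St cardsT card_X1 => -[].
have iE : @lattice_index bool 0 1 [set y | 0 < f1 y]%SET y0 = 1%N.
  apply/anti_leq; rewrite lattice_index_gt0 andbT.
  by apply: leq_trans (max_card _) _; rewrite card_ffun card_ord exp1n.
set g := (ln 2 + ln pi) / 2 - c.
have gE e : 0 < e -> `|expR (- g) - 1| <= e.
  move=> e0; have o1 : (0 < 1)%N by [].
  have [N0 /(_ N0 (leqnn _))] :=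
    expected_Z_ratio (isT : (0 < 1)%N) f0 maximizer1 unique1 n0 Sy0 D0 hc e0.
  rewrite dvd1n expected1 exprn_gt0 // => /(_ isT isT).
  rewrite /leading dE iE (max_objectiveE o1 o1 f0 maximizer1 Sy0).
  rewrite -(objective_mu o1 o1 f0 maximizer1 Sy0) objective1 entropy1 /=.
  by rewrite det1 !powR1 invr1 !mulr1 mul1r expRM_natl lnK ?posrE // invfM mulrA divff
    ?mul1r -?expRN // expf_neq0.
have /eqP : `|expR (- g) - 1| = 0.
  apply/le_anti; rewrite normr_ge0 andbT; apply/ler_addgt0Pr => e e0; rewrite add0r.
  exact: gE.
rewrite normr_eq0 subr_eq0 -[X in _ == X]expR0 => /eqP/expR_inj/eqP; rewrite oppr_eq0 /g subr_eq0.
by move=> /eqP ->.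
Qed.

End Calibration.

(** The error is set to 0 at excluded N, so that it converges along all integers. *)
Lemma ratio_error (R : realType) (P : pred nat) (E L : nat -> R) : (forall N, 0 < L N) ->
  (forall e : R, 0 < e -> exists N0, forall N, (N0 <= N)%N -> P N -> `|E N / L N - 1| <= e) ->
  exists o : nat -> R, o N @[N --> \oo] --> (0 : R) /\
    forall N, P N -> E N = L N * (1 + o N).
Proof.
move=> L0 h; exists (fun N => if P N then E N / L N - 1 else 0); split; last first.
  by move=> N ->; rewrite addrC subrK mulrC divfK // gt_eqF.
apply/cvgrPdist_le => e e0; have [N0 hN] := h e e0; exists N0 => // N /= hNN.
by rewrite sub0r normrN; case: ifP => [PN|_]; [exact: hN | rewrite normr0 ltW].
Qed.

Lemma leading_gt0 (R : realType) (X : finType) (l r : nat)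
    (f : {ffun 'I_r -> X} -> R) p s N : (0 < l)%N -> (0 < s)%N -> 0 < det_factor l p ->
  0 < leading l f p s N.
Proof.
by move=> l0 s0 D0; rewrite !mulr_gt0 ?expR_gt0 ?powR_gt0 ?invr_gt0 ?ltr0n.
Qed.

Lemma expected_Z_eq0 (R : realType) (X : finType) (l r N : nat)
    (f : {ffun 'I_r -> X} -> R) : (0 < l)%N -> (0 < r)%N -> (forall y, f y = 0) ->
  (r %| l * N)%N -> (0 < N)%N -> expected_Z l f N = 0.
Proof.
move=> l0 r0 f0 rN N0; rewrite /expected_Z big1 ?mul0r // => g _.
have M0 : (0 < nfactor l r N)%N by rewrite divn_gt0 // dvdn_leq // muln_gt0 l0.
by rewrite /partition_fun big1 // => x _; rewrite (bigD1 (Ordinal M0)) //= f0 mul0r.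
Qed.

Theorem theorem5 (R : realType) (X : finType) (l r : nat)
    (hl : (0 < l)%N) (hr : (0 < r)%N) (S : {set {ffun 'I_r -> X}}) :
  exists s : nat, (0 < s)%N /\
  forall (f : {ffun 'I_r -> X} -> R)
    (f_ge0 : forall x, 0 <= f x)
    (f_supp : S = [set x | 0 < f x]%SET)
    (nu : {ffun X -> R}) (mu : {ffun {ffun 'I_r -> X} -> R})
    (hmax : maximizer l f (nu, mu))
    (huniq : forall q, maximizer l f q -> q = (nu, mu))
    (nu_gt0 : forall x, 0 < nu x)
    (hdet : 0 < det_factor l (nu, mu)),
  exists o : nat -> R,
    o N @[N --> \oo] --> (0 : R) /\
    forall N : nat, (r %| l * N)%N -> 0 < expected_Z l f N ->
      expected_Z l f N =
        expR (N%:R * fine (max_objective l f))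
        * l%:R `^ ((#|X|%:R - 1) / 2) * s%:R^-1
        * det_factor l (nu, mu) `^ (- 2^-1) * (1 + o N).
Proof.
have key s (f : {ffun 'I_r -> X} -> R) nu mu : (0 < s)%N -> 0 < det_factor l (nu, mu) ->
    (forall e : R, 0 < e -> exists N0, forall N, (N0 <= N)%N ->
      (r %| l * N)%N -> 0 < expected_Z l f N ->
      `|expected_Z l f N / leading l f (nu, mu) s N - 1| <= e) ->
    exists o : nat -> R, o N @[N --> \oo] --> (0 : R) /\
      forall N : nat, (r %| l * N)%N -> 0 < expected_Z l f N ->
        expected_Z l f N = leading l f (nu, mu) s N * (1 + o N).
  move=> s0 D0 h.
  have [|e e0|o [oc oE]] := @ratio_error R
      (fun N => (r %| l * N)%N && (0 < expected_Z l f N)) (expected_Z l f)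
      (leading l f (nu, mu) s).
  - by move=> N; exact: leading_gt0.
  - by have [N0 hN] := h e e0; exists N0 => N NN /andP[]; exact: hN.
  by exists o; split=> // N h1 h2; apply: oE; rewrite h1.
case: (set_0Vmem S) => [S0|[y0 Sy0]].
  (* With empty support the expectation vanishes for every N >= 1, so the asymptotic claim is
     vacuous. *)
  exists 1%N; split=> // f f0 fS nu mu _ _ _ D0; apply: key => // e e0; exists 1%N => N N0 rN.
  rewrite (expected_Z_eq0 hl hr) ?ltxx // => y; apply: f_supp0 => //.
  by rewrite -fS S0 inE.
(* The integer is fixed before f is given: it depends only on l, r, S and a base point y0 chosen in
   S. *)
case: l hl key => // l' _ key; exists (lattice_index l' S y0); split=> [|f f0 fS nu mu hm hu n0 D0].
  exact: lattice_index_gt0.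
apply: key => //; first exact: lattice_index_gt0.
rewrite fS in Sy0 *.
have [c hc] := stirling R; have cE := stirling_const hc.
move=> e /(expected_Z_ratio hr f0 hm hu n0 Sy0 D0 hc); rewrite cE subrr mulr0 expR0.
by case=> N0 h; exists N0 => N NN rN EN; have := h N NN rN EN; rewrite mulr1.
Qed.
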